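(* Let $\chi:\mathbb{Z}\to\mathbb{C}$ be a periodic function of period $m\ge1$ with $\chi(0)=0$. Let $n\ge 0$ be an integer and let $w\in\mathbb{C}$ satisfy $\Re w>-1$. Then \begin{align*} \hat S^{(k+w)^n,(k+w)}(\chi)=\;&(-1)^{n+1}n!\int_0^{+\infty}\frac{1}{t^n}\left(\frac{F_\chi(-t,w-1)}{t}-\sum_{k=-1}^{n}b_{\chi,k}(w)t^k\right)\frac{e^{-t}\,dt}{t}\\ &-(-1)^{n+1}n!\sum_{j=0}^{n+1}\frac{(-1)^{j+1}}{j!}H_j\,b_{\chi,n-j}(w)+(-1)^{n+1}n!\,b_{\chi,n}(w+1)\log m, \end{align*} where the twisted Bernoulli polynomials $b_{\chi,k}(w)$ are defined by the generating series $\frac1tF_\chi(-t,w-1)=\sum_{k=-1}^{\infty}b_{\chi,k}(w)t^k$.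
   Context: $H_j$ is the $j$-th harmonic number ($H_0=0$); logarithms are principal branches. The function $F_\chi$ is $$F_\chi(t,x)=\sum_{a=1}^{m}\frac{\chi(a)\,t\,e^{at}}{e^{mt}-1}e^{xt}.$$ The twisted Stirling-Ramanujan constant $\hat S^{(k+w)^n,(k+w)}(\chi)$ is the constant term (coefficient of $s^0$) in the asymptotic expansion, as the integer $s\to+\infty$, of $$\sum_{k=1}^{ms}\chi(k)(k+w)^n\log(k+w)$$ in the family of functions $s^j\log s$ ($j\ge0$) and $s^j$ ($j\in\mathbb{Z}$); this expansion exists and is unique. *)

(* Defs.v *)
From Stdlib Require Export Reals ZArith ClassicalEpsilon.
From Coquelicot Require Export Coquelicot.

Open Scope C_scope.

Definition Cexp (z : C) : C := RtoC (exp (Re z)) * (cos (Im z), sin (Im z)).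

(* Principal argument, with values in (-PI, PI]; the value at 0 is irrelevant. *)
Definition Carg (z : C) : R :=
  if Rle_dec 0 (Im z) then acos (Re z / Cmod z) else Ropp (acos (Re z / Cmod z)).

Definition Clog (z : C) : C := (ln (Cmod z), Carg z).

Definition Cpowz (z : C) (k : Z) : C :=
  match k with
  | Z0 => 1
  | Zpos p => Cpow z (Pos.to_nat p)
  | Zneg p => / Cpow z (Pos.to_nat p)
  end.

Definition harmonic (j : nat) : R := sum_n_m (fun i => Rinv (INR i)) 1 j.

Definition twisted_F (chi : Z -> C) (m : nat) (t x : C) : C :=
  sum_n_m (fun a : nat =>
      chi (Z.of_nat a) * t * Cexp (INR a * t) / (Cexp (INR m * t) - 1)
        * Cexp (x * t)) 1 m.

(* The index i of the series corresponds to the exponent k = i - 1 >= -1. *)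
Definition is_twisted_bernoulli (chi : Z -> C) (m : nat) (w : C) (b : Z -> C)
    : Prop :=
  (forall k : Z, (k < -1)%Z -> b k = 0) /\
  exists r : R, (0 < r)%R /\
    forall t : C, (0 < Cmod t < r)%R ->
      is_series (V := C_R_NormedModule)
        (fun i : nat => b (Z.of_nat i - 1)%Z * Cpowz t (Z.of_nat i - 1))
        (/ t * twisted_F chi m (- t) (w - 1)).

(* b_{chi,k}(w); a Laurent expansion at 0 exists and is unique, so the choice
   made by epsilon is forced. *)
Definition twisted_bernoulli (chi : Z -> C) (m : nat) (k : Z) (w : C) : C :=
  epsilon (inhabits (fun _ : Z => RtoC 0)) (is_twisted_bernoulli chi m w) k.

(* Asymptotic expansion of f(s), as the integer s tends to infinity, in the
   functions s^j log s (j >= 0), with coefficients a, and s^j (j in Z), with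
   coefficients c.  Only finitely many growing terms occur (those with j <= J),
   and the terms of exponent >= -N leave a remainder o(s^(-N)). *)
Definition is_log_power_expansion (f : nat -> C) (a : nat -> C) (c : Z -> C)
    : Prop :=
  exists J : nat,
    (forall j : nat, (J < j)%nat -> a j = 0 /\ c (Z.of_nat j) = 0) /\
    forall N : nat,
      filterlim
        (fun s : nat =>
           Cpow (INR s) N *
             (f s
              - sum_n (fun j : nat => a j * (Cpow (INR s) j * ln (INR s))) J
              - sum_n (fun i : nat =>
                         c (Z.of_nat i - Z.of_nat N)%Z
                           * Cpowz (INR s) (Z.of_nat i - Z.of_nat N)) (J + N)))
        eventually (locally (T := C_R_NormedModule) (RtoC 0)).

Definition is_constant_term (f : nat -> C) (S : C) : Prop :=
  exists (a : nat -> C) (c : Z -> C),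
    is_log_power_expansion f a c /\ c 0%Z = S.

Definition twisted_log_sum (chi : Z -> C) (m n : nat) (w : C) (s : nat) : C :=
  sum_n_m (fun k : nat =>
      chi (Z.of_nat k) * Cpow (INR k + w) n * Clog (INR k + w)) 1 (m * s).

(* The twisted Stirling-Ramanujan constant; the expansion exists and is unique
   when chi is m-periodic with m >= 1 and Re w > -1, so the choice is forced. *)
Definition stirling_ramanujan (chi : Z -> C) (m n : nat) (w : C) : C :=
  epsilon (inhabits (RtoC 0)) (is_constant_term (twisted_log_sum chi m n w)).

Definition sr_integrand (chi : Z -> C) (m n : nat) (w : C) (t : R) : C :=
  / Cpow t n
  * (twisted_F chi m (- t) (w - 1) / t
     - sum_n (fun i : nat => twisted_bernoulli chi m (Z.of_nat i - 1) w
                             * Cpowz t (Z.of_nat i - 1)) (n + 1))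
  * (exp (- t) / t)%R.

(* Main.v *)
Require Import Defs.
From Stdlib Require Import Lra Lia Psatz.


(** The logarithm has the regularised Laplace representation
[b^n log b = (-1)^(n+1) n! int_0^oo t^(-n-1) (e^(-bt) - e^(-t) T_n(t)) dt + polynomial in b],
where [T_n] is the Taylor polynomial of [e^((1-b)t)]: Frullani's integral for [n = 0], then
integration by parts. Summing over [b = k + w], [k <= ms], with weights [chi k], periodicity turns
[sum_k chi(k) e^(-(k+w-1)t)] into [(1 - e^(-mst)) F(-t,w-1)/t]. The integral therefore splits into
the one of the theorem, minus the same representation of [(ms)^p log (ms)], [p <= n+1], weighted by
the Laurent coefficients [b_(n-p)(w+1)], minus [int t^(-n-1) e^(-mst) (Laurent remainder) dt], which
is a series in negative powers of [s]. The constant term in [s] is read off from this: it involves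
[b_n(w+1) log m] and the values at [0] of the correcting polynomials, namely [1/(p p!)], and
[sum_j C(p,j) (-1)^(j+1) H_j = 1/p] converts the latter into harmonic numbers. *)

Open Scope C_scope.

(** * Finite sums *)

(** Both the Laurent coefficients and the Stirling-Ramanujan constant are chosen by epsilon, so each
    needs an existence and a uniqueness proof: division of power series and comparison of
    coefficients for the former, an explicit expansion and linear independence of [s^j log s] and
    [s^j] for the latter. The regulariser [e^(-t)] in front of [T_n] is the one in the integrand of
    the theorem. This is what lets the subtracted Taylor terms, once summed over [k], combine with
    the Laurent terms of [F]: both come from one identity between generating functions, read once on
    functions and once on coefficients. The shift from [w] to [w + 1] appears because the factor
    [e^(-t)] of the upper end [e^(-mst) e^(-t)] of the geometric sum is absorbed into the generating
    function. It also helps convergence: [Re (w + 1) > 0], so the shifted remainder is [O(t^L)] on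
    the whole half-line and [e^(-mst)] alone makes it integrable. The correcting polynomials, summed
    against [chi] over [k <= ms], give a polynomial in [s] vanishing at [s = 0] (empty sum), so they
    do not reach the constant term. Only those attached to [(ms)^p log (ms)] do. *)

Fixpoint csum (f : nat -> C) (n : nat) : C :=
  match n with O => 0 | S k => csum f k + f k end.

Lemma csum_ext (f g : nat -> C) n :
  (forall i, (i < n)%nat -> f i = g i) -> csum f n = csum g n.
Proof.
  induction n as [|n IH]; intros H; simpl; [reflexivity|].
  rewrite IH, H; auto.
Qed.

Lemma csum_zero (f : nat -> C) n :
  (forall i, (i < n)%nat -> f i = 0) -> csum f n = 0.
Proof.
  induction n as [|n IH]; intros H; simpl; [reflexivity|].
  rewrite IH, H; auto; ring.
Qed.

Lemma csum_plus f g n : csum (fun i => f i + g i) n = csum f n + csum g n.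
Proof. induction n as [|n IH]; simpl; [ring|rewrite IH; ring]. Qed.

Lemma csum_minus f g n : csum (fun i => f i - g i) n = csum f n - csum g n.
Proof. induction n as [|n IH]; simpl; [ring|rewrite IH; ring]. Qed.

Lemma csum_scal c f n : csum (fun i => c * f i) n = c * csum f n.
Proof. induction n as [|n IH]; simpl; [ring|rewrite IH; ring]. Qed.

Lemma csum_scal_r c f n : csum (fun i => f i * c) n = csum f n * c.
Proof. induction n as [|n IH]; simpl; [ring|rewrite IH; ring]. Qed.

Lemma csum_app f n k : csum f (n + k) = csum f n + csum (fun i => f (n + i)%nat) k.
Proof.
  induction k as [|k IH].
  - rewrite Nat.add_0_r; simpl; ring.
  - rewrite Nat.add_succ_r; simpl. rewrite IH; ring.
Qed.

Lemma csum_Sl f n : csum f (S n) = f O + csum (fun i => f (S i)) n.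
Proof. change (S n) with (1 + n)%nat. rewrite csum_app; simpl; ring. Qed.

Lemma csum_swap (f : nat -> nat -> C) n k :
  csum (fun i => csum (f i) k) n = csum (fun j => csum (fun i => f i j) n) k.
Proof.
  induction n as [|n IH]; simpl.
  - symmetry; apply csum_zero; reflexivity.
  - rewrite IH, csum_plus; reflexivity.
Qed.

Lemma csum_rev f n : csum f n = csum (fun i => f (n - 1 - i)%nat) n.
Proof.
  induction n as [|n IH]; [reflexivity|].
  rewrite (csum_Sl (fun i => f (S n - 1 - i)%nat)).
  replace (S n - 1 - 0)%nat with n by lia.
  rewrite (csum_ext (fun i => f (S n - 1 - S i)%nat) (fun i => f (n - 1 - i)%nat))
    by (intros; f_equal; lia).
  rewrite <- IH. simpl. ring.
Qed.

(** Regroups the triangle [i + j < n] by antidiagonals [k = i + j]. It serves both for Cauchy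
    products and for the harmonic identity. *)
Lemma csum_triangle (f : nat -> nat -> C) n :
  csum (fun i => csum (f i) (n - i)) n
  = csum (fun k => csum (fun i => f i (k - i)%nat) (S k)) n.
Proof.
  induction n as [|n IH]; [reflexivity|].
  cbn [csum]. replace (S n - n)%nat with 1%nat by lia.
  rewrite (csum_ext (fun i => csum (f i) (S n - i))
             (fun i => csum (f i) (n - i) + f i (n - i)%nat)).
  - rewrite csum_plus, IH. simpl. rewrite Nat.sub_diag. ring.
  - intros i Hi. replace (S n - i)%nat with (S (n - i)) by lia. reflexivity.
Qed.

Lemma csum_pad (f : nat -> C) n k : (n <= k)%nat ->
  (forall i, (n <= i < k)%nat -> f i = 0) -> csum f k = csum f n.
Proof.
  intros Hnk H. replace k with (n + (k - n))%nat by lia.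
  rewrite csum_app, (csum_zero (fun i => f (n + i)%nat)); [ring|].
  intros; apply H; lia.
Qed.

Lemma csum_single (f : nat -> C) n j : (j < n)%nat ->
  (forall i, (i < n)%nat -> i <> j -> f i = 0) -> csum f n = f j.
Proof.
  intros Hj H. rewrite (csum_pad f (S j) n) by
    (try lia; intros; apply H; lia).
  simpl. rewrite csum_zero; [ring|]. intros; apply H; lia.
Qed.

Lemma sum_n_csum (f : nat -> C) n : sum_n f n = csum f (S n).
Proof.
  induction n as [|n IH].
  - rewrite sum_O. simpl. ring.
  - rewrite sum_Sn, IH. reflexivity.
Qed.

Lemma sum_n_m_csum (f : nat -> C) n : sum_n_m f 1 n = csum (fun i => f (S i)) n.
Proof.
  induction n as [|n IH].
  - rewrite sum_n_m_zero by lia. reflexivity.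
  - rewrite sum_n_Sm by lia. rewrite IH. reflexivity.
Qed.

(** The real majorant is written as the real part of a complex [csum], so that all rewriting rules
    for [csum] apply to bounds as well. *)
Lemma Cmod_csum_le (f : nat -> C) (g : nat -> R) n :
  (forall i, (i < n)%nat -> Cmod (f i) <= g i)%R ->
  (Cmod (csum f n) <= Re (csum (fun i => RtoC (g i)) n))%R.
Proof.
  induction n as [|n IH]; intros H; simpl.
  - rewrite Cmod_0; lra.
  - eapply Rle_trans; [apply Cmod_triangle|].
    pose proof (IH (fun i Hi => H i (Nat.lt_lt_succ_r _ _ Hi))).
    pose proof (H n (Nat.lt_succ_diag_r n)). unfold Re in *. simpl. lra.
Qed.

Lemma Cmod_csum_le_const (f : nat -> C) (M : R) n :
  (forall i, (i < n)%nat -> Cmod (f i) <= M)%R -> (Cmod (csum f n) <= INR n * M)%R.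
Proof.
  intros H. eapply Rle_trans; [apply (Cmod_csum_le f (fun _ => M)); exact H|].
  apply Req_le. clear H. induction n as [|n IH].
  - simpl; ring.
  - rewrite S_INR. cbn [csum]. unfold Re in *. simpl in *. lra.
Qed.

Lemma RtoC_neq_0 (x : R) : x <> 0%R -> RtoC x <> 0.
Proof. intros H E. apply H. now injection E. Qed.

Lemma INR_fact_C_neq_0 n : RtoC (INR (fact n)) <> 0.
Proof. apply RtoC_neq_0, INR_fact_neq_0. Qed.

(** * Continuity and derivatives of complex functions of a real variable *)

(** Continuity is stated by coordinates, as is differentiability in [cderiv], so that real calculus
    applies to each coordinate separately. *)
Definition ccont (f : R -> C) (t : R) : Prop :=
  continuous (fun u => fst (f u)) t /\ continuous (fun u => snd (f u)) t.

Definition cderiv (f : R -> C) (t : R) (l : C) : Prop :=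
  is_derive (fun u => fst (f u)) t (fst l) /\ is_derive (fun u => snd (f u)) t (snd l).

Lemma cderiv_ext_loc (f g : R -> C) t l :
  locally t (fun u => f u = g u) -> cderiv f t l -> cderiv g t l.
Proof.
  intros H [H1 H2]; split;
    [apply (is_derive_ext_loc (fun u => fst (f u)))|apply (is_derive_ext_loc (fun u => snd (f u)))];
    try assumption; (eapply filter_imp; [|exact H]); simpl; intros u E; rewrite E; reflexivity.
Qed.

Lemma cderiv_ccont f t l : cderiv f t l -> ccont f t.
Proof. intros [H1 H2]; split; apply @ex_derive_continuous; eexists; eassumption. Qed.

Lemma cderiv_const c t : cderiv (fun _ => c) t 0.
Proof. split; apply @is_derive_const. Qed.

Lemma cderiv_RtoC (f : R -> R) t (l : R) : is_derive f t l -> cderiv (fun u => RtoC (f u)) t l.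
Proof. intros H; split; [exact H|exact (is_derive_const (K := R_AbsRing) (V := R_NormedModule) 0%R t)]. Qed.

Lemma cderiv_plus f g t lf lg :
  cderiv f t lf -> cderiv g t lg -> cderiv (fun u => f u + g u) t (lf + lg).
Proof.
  intros [H1 H2] [H3 H4]; split; apply @is_derive_plus; assumption.
Qed.

Lemma cderiv_mult f g t lf lg :
  cderiv f t lf -> cderiv g t lg -> cderiv (fun u => f u * g u) t (lf * g t + f t * lg).
Proof.
  intros [H1 H2] [H3 H4]; split; simpl.
  - replace (fst lf * fst (g t) - snd lf * snd (g t) + (fst (f t) * fst lg - snd (f t) * snd lg))%R
      with (minus (fst lf * fst (g t) + fst (f t) * fst lg) (snd lf * snd (g t) + snd (f t) * snd lg))%R
      by (unfold minus, plus, opp; simpl; ring).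
    apply @is_derive_minus; apply (is_derive_mult (K:=R_AbsRing)); auto; intros; apply Rmult_comm.
  - replace (fst lf * snd (g t) + snd lf * fst (g t) + (fst (f t) * snd lg + snd (f t) * fst lg))%R
      with (plus (fst lf * snd (g t) + fst (f t) * snd lg) (snd lf * fst (g t) + snd (f t) * fst lg))%R
      by (unfold minus, plus, opp; simpl; ring).
    apply @is_derive_plus; apply (is_derive_mult (K:=R_AbsRing)); auto; intros; apply Rmult_comm.
Qed.

Lemma cderiv_eq f t l l' : l = l' -> cderiv f t l -> cderiv f t l'.
Proof. intros ->; auto. Qed.

Lemma cderiv_scal c f t l : cderiv f t l -> cderiv (fun u => c * f u) t (c * l).
Proof.
  intros H. apply (cderiv_eq _ _ (0 * f t + c * l)); [ring|].
  apply (cderiv_mult (fun _ => c)); [apply cderiv_const|exact H].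
Qed.

Lemma cderiv_csum (f : nat -> R -> C) (l : nat -> C) t n :
  (forall i, (i < n)%nat -> cderiv (f i) t (l i)) ->
  cderiv (fun u => csum (fun i => f i u) n) t (csum l n).
Proof.
  induction n as [|n IH]; intros H; simpl; [apply cderiv_const|].
  apply cderiv_plus; [apply IH; intros; apply H; lia|apply H; lia].
Qed.

Lemma ccont_const c t : ccont (fun _ => c) t.
Proof. split; apply @continuous_const. Qed.

Lemma ccont_plus f g t : ccont f t -> ccont g t -> ccont (fun u => f u + g u) t.
Proof. intros [H1 H2] [H3 H4]; split; apply @continuous_plus; assumption. Qed.

Lemma ccont_opp f t : ccont f t -> ccont (fun u => - f u) t.
Proof. intros [H1 H2]; split; apply @continuous_opp; assumption. Qed.

Lemma ccont_minus f g t : ccont f t -> ccont g t -> ccont (fun u => f u - g u) t.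
Proof. intros H1 H2. apply ccont_plus; [|apply ccont_opp]; assumption. Qed.

Lemma ccont_mult f g t : ccont f t -> ccont g t -> ccont (fun u => f u * g u) t.
Proof.
  intros [H1 H2] [H3 H4]; split; simpl.
  - apply @continuous_minus; apply @continuous_mult; assumption.
  - apply @continuous_plus; apply @continuous_mult; assumption.
Qed.

Lemma ccont_inv (f : R -> C) t : f t <> 0 -> ccont f t -> ccont (fun u => / f u) t.
Proof.
  intros Hn [H1 H2].
  assert (Hd : (fst (f t) ^ 2 + snd (f t) ^ 2 <> 0)%R).
  { intros E. apply Hn. apply Cmod_eq_0. unfold Cmod. rewrite E. apply sqrt_0. }
  assert (Hc : continuous (fun u => / (fst (f u) ^ 2 + snd (f u) ^ 2))%R t).
  { apply @continuous_comp with (g := Rinv).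
    - apply (continuous_ext (fun u => plus (mult (fst (f u)) (fst (f u))) (mult (snd (f u)) (snd (f u))))).
      + intros u. unfold plus, mult; simpl. ring.
      + apply (continuous_plus (V := R_NormedModule));
          apply (continuous_mult (K := R_AbsRing)); assumption.
    - apply (continuous_Rinv _ Hd). }
  split; simpl; unfold Rdiv.
  - apply @continuous_mult; [assumption|exact Hc].
  - apply @continuous_mult; [apply @continuous_opp; assumption|exact Hc].
Qed.

Lemma ccont_RtoC (f : R -> R) t : continuous f t -> ccont (fun u => RtoC (f u)) t.
Proof. intros H; split; [exact H|exact (continuous_const (V := R_UniformSpace) 0%R t)]. Qed.

Lemma ccont_id t : ccont (fun u => RtoC u) t.
Proof. apply ccont_RtoC, @continuous_id. Qed.

Lemma ccont_pow f t n : ccont f t -> ccont (fun u => f u ^ n) t.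
Proof. intros H; induction n; simpl; [apply ccont_const|apply ccont_mult; assumption]. Qed.

Lemma ccont_csum (f : nat -> R -> C) t n :
  (forall i, (i < n)%nat -> ccont (f i) t) -> ccont (fun u => csum (fun i => f i u) n) t.
Proof.
  induction n as [|n IH]; intros H; simpl; [apply ccont_const|].
  apply ccont_plus; [apply IH; intros; apply H; lia|apply H; lia].
Qed.

(** A quadratic bound on the first-order error yields the derivative. It replaces differentiation
    under the integral sign: for a parametric integral the error is itself one integral, which can
    be bounded pointwise. *)
Lemma cderiv_of_quadratic (f : R -> C) t (l : C) (M d : R) : (0 < d)%R ->
  (forall h, (Rabs h < d)%R -> (Cmod (f (t + h)%R - f t - h * l) <= M * h ^ 2)%R) ->
  cderiv f t l.
Proof.
  intros Hd H.
  (* Both coordinates are handled at once through the three properties they share: real-linearity,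
     split into additivity and homogeneity, and being 1-Lipschitz. *)
  assert (key : forall (p : C -> R), (forall z, (Rabs (p z) <= Cmod z)%R) ->
     (forall x y : C, p (x - y)%C = (p x - p y)%R) -> (forall (h : R) (z : C), p (h * z)%C = (h * p z)%R) ->
     is_derive (fun u => p (f u)) t (p l)).
  { intros p Hp Hm Hs. apply is_derive_Reals. intros eps He.
    assert (Hd' : (0 < Rmin d (eps / (Rabs M + 1)))%R).
    { apply Rmin_pos; [exact Hd|]. apply Rdiv_lt_0_compat; [exact He|].
      pose proof (Rabs_pos M); lra. }
    exists (mkposreal _ Hd'). simpl. intros h Hh0 Hh.
    assert (h1 : (Rabs h < d)%R) by (eapply Rlt_le_trans; [exact Hh|apply Rmin_l]).
    assert (h2 : (Rabs h < eps / (Rabs M + 1))%R) by (eapply Rlt_le_trans; [exact Hh|apply Rmin_r]).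
    specialize (H h h1).
    assert (E : (Rabs (p (f (t + h)%R) - p (f t) - h * p l) <= M * h ^ 2)%R).
    { rewrite <- Hs, <- !Hm. eapply Rle_trans; [apply Hp|exact H]. }
    replace ((p (f (t + h)%R) - p (f t)) / h - p l)%R with
      ((p (f (t + h)%R) - p (f t) - h * p l) / h)%R by (field; assumption).
    unfold Rdiv. rewrite Rabs_mult, Rabs_inv.
    assert (hp : (0 < Rabs h)%R) by (apply Rabs_pos_lt; assumption).
    apply Rle_lt_trans with (M * h ^ 2 * / Rabs h)%R.
    { apply Rmult_le_compat_r; [left; apply Rinv_0_lt_compat; exact hp|exact E]. }
    replace (h ^ 2)%R with (Rabs h * Rabs h)%R by (rewrite <- Rabs_mult; simpl; rewrite Rmult_1_r; apply Rabs_pos_eq; nra).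
    replace (M * (Rabs h * Rabs h) * / Rabs h)%R with (M * Rabs h)%R by (field; lra).
    apply Rle_lt_trans with ((Rabs M + 1) * Rabs h)%R.
    { apply Rmult_le_compat_r; [lra|]. pose proof (Rle_abs M); lra. }
    pose proof (Rabs_pos M).
    replace eps with ((Rabs M + 1) * (eps / (Rabs M + 1)))%R by (field; lra).
    apply Rmult_lt_compat_l; lra. }
  split.
  - apply (key (fun z => fst z)).
    + exact re_le_Cmod.
    + intros; reflexivity.
    + intros; simpl; ring.
  - apply (key (fun z => snd z)).
    + intros z. eapply Rle_trans; [apply Rmax_r|apply Rmax_Cmod].
    + intros; reflexivity.
    + intros; simpl; ring.
Qed.

(** * Complex-valued integrals over compact intervals *)

Definition C_RInt (f : R -> C) (a b : R) (l : C) : Prop :=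
  is_RInt (V := C_R_CompleteNormedModule) f a b l.

Lemma C_RInt_FTC (F f : R -> C) a b :
  (forall x, Rmin a b <= x <= Rmax a b -> cderiv F x (f x))%R ->
  (forall x, Rmin a b <= x <= Rmax a b -> ccont f x)%R ->
  C_RInt f a b (F b - F a).
Proof.
  intros Hd Hc.
  apply (is_RInt_fct_extend_pair (U := R_NormedModule) (V := R_NormedModule)).
  - apply (is_RInt_derive (fun u => fst (F u)) (fun u => fst (f u))).
    + intros; apply Hd; assumption.
    + intros; apply Hc; assumption.
  - apply (is_RInt_derive (fun u => snd (F u)) (fun u => snd (f u))).
    + intros; apply Hd; assumption.
    + intros; apply Hc; assumption.
Qed.

Lemma C_RInt_ex (f : R -> C) a b :
  (forall x, Rmin a b <= x <= Rmax a b -> ccont f x)%R -> exists l, C_RInt f a b l.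
Proof.
  intros Hc.
  destruct (ex_RInt_continuous (fun u => fst (f u)) a b) as [l1 H1]; [intros; apply Hc; assumption|].
  destruct (ex_RInt_continuous (fun u => snd (f u)) a b) as [l2 H2]; [intros; apply Hc; assumption|].
  exists (l1, l2).
  apply (is_RInt_fct_extend_pair (U := R_NormedModule) (V := R_NormedModule)); assumption.
Qed.

Lemma C_RInt_plus f g a b lf lg :
  C_RInt f a b lf -> C_RInt g a b lg -> C_RInt (fun t => f t + g t) a b (lf + lg).
Proof. intros; apply (is_RInt_plus (V := C_R_CompleteNormedModule)); assumption. Qed.

(** The module structure carries real scalars only, so a complex factor is multiplied out on
    coordinates. *)
Lemma C_RInt_scal c f a b l :
  C_RInt f a b l -> C_RInt (fun t => c * f t) a b (c * l).
Proof.
  intros H.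
  pose proof (is_RInt_fct_extend_fst (U := R_NormedModule) (V := R_NormedModule) f a b l H) as H1.
  pose proof (is_RInt_fct_extend_snd (U := R_NormedModule) (V := R_NormedModule) f a b l H) as H2.
  apply (is_RInt_fct_extend_pair (U := R_NormedModule) (V := R_NormedModule)); simpl.
  - apply (is_RInt_minus (V := R_NormedModule)); apply (is_RInt_scal (V := R_NormedModule)); assumption.
  - apply (is_RInt_plus (V := R_NormedModule)); apply (is_RInt_scal (V := R_NormedModule)); assumption.
Qed.

Lemma C_RInt_norm_le f (g : R -> R) a b l (lg : R) : (a <= b)%R ->
  (forall x, a <= x <= b -> Cmod (f x) <= g x)%R ->
  C_RInt f a b l -> is_RInt g a b lg -> (Cmod l <= lg)%R.
Proof.
  intros Hab Hb Hf Hg. rewrite Cmod_norm.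
  apply (norm_RInt_le (V := C_R_NormedModule) f g a b l lg Hab); auto.
  intros x Hx. specialize (Hb x Hx). rewrite Cmod_norm in Hb. exact Hb.
Qed.

(* [ring] does not see that the carrier of a canonical structure on R is R. *)
Ltac rring := match goal with |- @eq _ ?x ?y => change (@eq R x y); ring end.

(** * The complex exponential *)

Lemma Cexp_RtoC (x : R) : Cexp (RtoC x) = RtoC (exp x).
Proof.
  unfold Cexp; simpl. rewrite cos_0, sin_0. apply injective_projections; simpl; ring.
Qed.

Lemma Cexp_0 : Cexp 0 = 1.
Proof. rewrite Cexp_RtoC, exp_0. reflexivity. Qed.

Lemma Cexp_plus (a b : C) : Cexp (a + b) = Cexp a * Cexp b.
Proof.
  unfold Cexp; simpl. unfold Re, Im. simpl. rewrite exp_plus, cos_plus, sin_plus.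
  apply injective_projections; simpl; ring.
Qed.

Lemma Cmod_Cexp (z : C) : Cmod (Cexp z) = exp (Re z).
Proof.
  unfold Cexp. rewrite Cmod_mult, Cmod_R, Rabs_pos_eq by (left; apply exp_pos).
  unfold Cmod; simpl.
  replace (cos (Im z) * (cos (Im z) * 1) + sin (Im z) * (sin (Im z) * 1))%R with 1%R.
  - rewrite sqrt_1; ring.
  - pose proof (sin2_cos2 (Im z)) as H. unfold Rsqr in H. lra.
Qed.

Lemma Cexp_neq_0 (z : C) : Cexp z <> 0.
Proof. apply Cmod_gt_0. rewrite Cmod_Cexp. apply exp_pos. Qed.

Lemma Cexp_opp (z : C) : Cexp (- z) = / Cexp z.
Proof.
  pose proof (Cexp_neq_0 z) as H.
  assert (E : Cexp (- z) * Cexp z = 1) by (rewrite <- Cexp_plus, <- Cexp_0; f_equal; ring).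
  replace (Cexp (- z)) with (Cexp (- z) * Cexp z * / Cexp z) by (field; exact H).
  rewrite E. ring.
Qed.

Lemma cderiv_Cexp (c : C) (t : R) : cderiv (fun u => Cexp (c * u)) t (c * Cexp (c * t)).
Proof.
  destruct c as [a b]. split; simpl.
  - apply (is_derive_ext (fun u : R => exp (a * u) * cos (b * u))%R).
    + intros u. replace (a * u - b * 0)%R with (a * u)%R by ring.
      replace (a * 0 + b * u)%R with (b * u)%R by ring. rring.
    + auto_derive; [trivial|].
      replace (a * t - b * 0)%R with (a * t)%R by ring.
      replace (a * 0 + b * t)%R with (b * t)%R by ring. ring.
  - apply (is_derive_ext (fun u : R => exp (a * u) * sin (b * u))%R).
    + intros u. replace (a * u - b * 0)%R with (a * u)%R by ring.
      replace (a * 0 + b * u)%R with (b * u)%R by ring. rring.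
    + auto_derive; [trivial|].
      replace (a * t - b * 0)%R with (a * t)%R by ring.
      replace (a * 0 + b * t)%R with (b * t)%R by ring. ring.
Qed.

Lemma ccont_Cexp (c : C) (t : R) : ccont (fun u => Cexp (c * u)) t.
Proof. eapply cderiv_ccont, cderiv_Cexp. Qed.

Lemma cderiv_pow (n : nat) (t : R) :
  cderiv (fun u => RtoC u ^ S n) t (INR (S n) * RtoC t ^ n).
Proof.
  rewrite <- RtoC_pow, <- RtoC_mult.
  apply (cderiv_ext_loc (fun u => RtoC (u ^ S n)%R)).
  - apply filter_forall. intros u. apply RtoC_pow.
  - apply cderiv_RtoC. auto_derive; [trivial|]. change (1 * (INR (S n) * t ^ n) = INR (S n) * t ^ n)%R. ring.
Qed.

Lemma cderiv_poly (a : nat -> C) (p : nat) (t : R) :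
  cderiv (fun u => csum (fun i => a i * RtoC u ^ i) (S p)) t
    (csum (fun i => INR (S i) * a (S i) * RtoC t ^ i) p).
Proof.
  apply (cderiv_ext_loc (fun u => a O + csum (fun i => a (S i) * RtoC u ^ S i) p)).
  - apply filter_forall. intros u. rewrite (csum_Sl (fun i => a i * RtoC u ^ i)). change (RtoC u ^ 0) with (RtoC 1). ring.
  - eapply cderiv_eq; [|apply cderiv_plus; [apply cderiv_const|
      apply (cderiv_csum (fun i u => a (S i) * RtoC u ^ S i)); intros i _;
      apply cderiv_scal, cderiv_pow]].
    rewrite Cplus_0_l. apply csum_ext. intros. ring.
Qed.

(** The case [p = 0] is also used below, to integrate a constant majorant over [[0,1]]. *)
Lemma RInt_pow (p : nat) (c : R) :
  is_RInt (fun u => c * u ^ p)%R 0 1 (c / INR (S p))%R.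
Proof.
  replace (c / INR (S p))%R with
    (minus (c / INR (S p) * 1 ^ (S p)) (c / INR (S p) * 0 ^ (S p)))%R.
  2:{ rewrite pow1, pow_i by lia. unfold minus, plus, opp; simpl; ring. }
  apply (is_RInt_derive (fun u => c / INR (S p) * u ^ (S p))%R).
  - intros x _. auto_derive; [trivial|]. change (c / INR (S p) * (1 * (INR (S p) * x ^ p)) = c * x ^ p)%R. field. apply not_0_INR; lia.
  - intros x _. apply continuity_pt_filterlim. reg.
Qed.

Definition exp_taylor (z : C) (p : nat) : C := csum (fun i => z ^ i / INR (fact i)) p.

(** Induction on the order: the derivative in [u] of the remainder at [zu] is [z] times the
    remainder of one order less, so integrating [u^p] over [[0,1]] supplies the missing factor
    [1/(p+1)]. The factor [exp |Re z|] dominates [|e^(zu)|] along the whole segment. *)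
Lemma Cexp_taylor_le (z : C) (p : nat) :
  (Cmod (Cexp z - exp_taylor z p) <= Cmod z ^ p / INR (fact p) * exp (Rabs (Re z)))%R.
Proof.
  unfold exp_taylor. revert z. induction p as [|p IH]; intros z.
  - simpl csum. replace (Cexp z - 0) with (Cexp z) by ring. rewrite Cmod_Cexp. simpl.
    unfold Rdiv. rewrite Rinv_1, !Rmult_1_l.
    destruct (Rle_abs (Re z)) as [H|H]; [left; apply exp_increasing, H|rewrite <- H; lra].
  - set (F := fun u : R => Cexp (z * u) - csum (fun i => (z ^ i / INR (fact i)) * RtoC u ^ i) (S p)).
    set (f := fun u : R => z * (Cexp (z * u) - csum (fun i => (z * u) ^ i / INR (fact i)) p)).
    assert (HF : forall x, cderiv F x (f x)).
    { intros x. unfold F, f. eapply cderiv_eq; [|apply cderiv_plus; [apply cderiv_Cexp|]].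
      2:{ eapply (cderiv_ext_loc (fun u => (-(1)) * csum (fun i => (z ^ i / INR (fact i)) * RtoC u ^ i) (S p))).
          2: apply cderiv_scal, cderiv_poly.
          apply filter_forall; intros; cbv beta; ring. }
      transitivity (z * Cexp (z * x) - z * csum (fun i => (z * x) ^ i / INR (fact i)) p); [|ring].
      rewrite <- (csum_scal z). rewrite (csum_ext (fun i => INR (S i) * (z ^ S i / INR (fact (S i))) * RtoC x ^ i) (fun i => z * ((z * x) ^ i / INR (fact i)))); [ring|].
      intros i _. rewrite Cpow_mult_l, Cpow_S. rewrite fact_simpl, mult_INR, RtoC_mult.
      field. split; [apply INR_fact_C_neq_0|apply RtoC_neq_0, not_0_INR; lia]. }
    assert (Hf : forall x, ccont f x).
    { intros x. apply ccont_mult; [apply ccont_const|]. apply ccont_minus; [apply ccont_Cexp|].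
      apply (ccont_csum (fun i u => (z * RtoC u) ^ i / INR (fact i))). intros i _.
      apply ccont_mult; [|apply ccont_const]. apply ccont_pow, ccont_mult; [apply ccont_const|apply ccont_id]. }
    pose proof (C_RInt_FTC F f 0 1 (fun x _ => HF x) (fun x _ => Hf x)) as HI.
    assert (E : F 1%R - F 0%R = Cexp z - csum (fun i => z ^ i / INR (fact i)) (S p)).
    { unfold F. replace (z * RtoC 1) with z by ring. replace (z * RtoC 0) with (RtoC 0) by ring.
      rewrite Cexp_0.
      rewrite (csum_ext (fun i => z ^ i / INR (fact i) * RtoC 1 ^ i) (fun i => z ^ i / INR (fact i)))
        by (intros; rewrite Cpow_1_l; ring).
      rewrite (csum_Sl (fun i => z ^ i / INR (fact i) * RtoC 0 ^ i)).
      rewrite (csum_zero (fun i => z ^ S i / INR (fact (S i)) * RtoC 0 ^ S i)) by (intros; rewrite (Cpow_S 0); ring).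
      simpl. replace (1 / 1) with (RtoC 1) by (field; apply RtoC_neq_0; lra). ring. }
    rewrite <- E.
    replace (Cmod z ^ S p / INR (fact (S p)) * exp (Rabs (Re z)))%R
      with ((Cmod z ^ S p / INR (fact p) * exp (Rabs (Re z))) / INR (S p))%R.
    2:{ rewrite fact_simpl, mult_INR. field. split; [apply INR_fact_neq_0|apply not_0_INR; lia]. }
    eapply C_RInt_norm_le; [|  | exact HI | apply RInt_pow]; [lra|].
    intros x Hx. unfold f. rewrite Cmod_mult.
    eapply Rle_trans; [apply Rmult_le_compat_l; [apply Cmod_ge_0|apply IH]|].
    rewrite Cmod_mult, Cmod_R, (Rabs_pos_eq x) by lra.
    assert (H1 : (exp (Rabs (Re (z * x))) <= exp (Rabs (Re z)))%R).
    { assert (H : (Rabs (Re (z * x)) <= Rabs (Re z))%R).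
      { unfold Re; simpl. replace (fst z * x - snd z * 0)%R with (fst z * x)%R by ring.
        rewrite Rabs_mult, (Rabs_pos_eq x) by lra. pose proof (Rabs_pos (fst z)). nra. }
      destruct H as [H|H]; [left; apply exp_increasing, H|rewrite H; lra]. }
    rewrite Rpow_mult_distr. simpl pow. unfold Rdiv.
    assert (H2 : (0 <= Cmod z * (Cmod z ^ p * x ^ p * / INR (fact p)))%R).
    { repeat apply Rmult_le_pos; try apply pow_le; try apply Cmod_ge_0; try lra.
      left; apply Rinv_0_lt_compat, INR_fact_lt_0. }
    replace (Cmod z * Cmod z ^ p * / INR (fact p) * exp (Rabs (Re z)) * x ^ p)%R with
      (Cmod z * (Cmod z ^ p * x ^ p * / INR (fact p)) * exp (Rabs (Re z)))%R by ring.
    rewrite <- Rmult_assoc. apply Rmult_le_compat_l; assumption.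
Qed.

(** * Improper integrals over the positive half-line *)

Definition clim0 (F : R -> C) (l : C) : Prop :=
  forall eps : R, (0 < eps)%R ->
    exists d : R, (0 < d)%R /\ forall t, (0 < t < d)%R -> (Cmod (F t - l) < eps)%R.

Definition climinf (F : R -> C) (l : C) : Prop :=
  forall eps : R, (0 < eps)%R ->
    exists M : R, forall t, (M < t)%R -> (Cmod (F t - l) < eps)%R.

Lemma clim0_bound (F : R -> C) l (K d : R) : (0 < d)%R ->
  (forall t, (0 < t < d)%R -> (Cmod (F t - l) <= K * t)%R) -> clim0 F l.
Proof.
  intros Hd H eps He. pose proof (Rabs_pos K) as HK. exists (Rmin d (eps / (Rabs K + 1))). split.
  { apply Rmin_pos; [lra|]. apply Rdiv_lt_0_compat; lra. }
  intros t [H0 H1].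
  assert (h1 : (t < d)%R) by (eapply Rlt_le_trans; [exact H1|apply Rmin_l]).
  assert (h2 : (t < eps / (Rabs K + 1))%R) by (eapply Rlt_le_trans; [exact H1|apply Rmin_r]).
  eapply Rle_lt_trans; [apply H; lra|].
  apply Rle_lt_trans with ((Rabs K + 1) * t)%R.
  { apply Rmult_le_compat_r; [lra|]. pose proof (Rle_abs K); lra. }
  replace eps with ((Rabs K + 1) * (eps / (Rabs K + 1)))%R by (field; lra).
  apply Rmult_lt_compat_l; lra.
Qed.

Lemma climinf_bound (F : R -> C) l (K : R) :
  (forall t, (1 < t)%R -> (Cmod (F t - l) <= K / t)%R) -> climinf F l.
Proof.
  intros H eps He. pose proof (Rabs_pos K) as HK. exists (Rmax 1 ((Rabs K + 1) / eps)). intros t Ht.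
  assert (h1 : (1 < t)%R) by (eapply Rle_lt_trans; [apply Rmax_l|exact Ht]).
  assert (h2 : ((Rabs K + 1) / eps < t)%R) by (eapply Rle_lt_trans; [apply Rmax_r|exact Ht]).
  eapply Rle_lt_trans; [apply H; lra|].
  apply Rmult_lt_reg_r with t; [lra|]. unfold Rdiv. rewrite Rmult_assoc, Rinv_l, Rmult_1_r by lra.
  apply Rle_lt_trans with (Rabs K); [apply Rle_abs|].
  apply Rmult_lt_compat_l with (r := eps) in h2; [|lra].
  replace (eps * ((Rabs K + 1) / eps))%R with (Rabs K + 1)%R in h2 by (field; lra). lra.
Qed.

Definition cint (f : R -> C) (l : C) : Prop :=
  is_RInt_gen (V := C_R_CompleteNormedModule) f (at_right 0) (Rbar_locally p_infty) l.

Lemma cint_intro (f : R -> C) (l : C) :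
  (forall eps : R, (0 < eps)%R -> exists d M : R, (0 < d)%R /\
     forall a b, (0 < a < d)%R -> (M < b)%R -> exists y, C_RInt f a b y /\ (Cmod (y - l) < eps)%R) ->
  cint f l.
Proof.
  intros H P [eps HP]. destruct (H eps (cond_pos eps)) as (d & M & Hd & HdM).
  apply (Filter_prod _ _ _ (fun a => 0 < a < d)%R (fun b => M < b)%R).
  - exists (mkposreal d Hd). intros y Hy Hy0. split; [exact Hy0|].
    unfold ball in Hy; simpl in Hy; unfold AbsRing_ball, abs, minus, plus, opp in Hy; simpl in Hy.
    apply Rabs_lt_between in Hy. lra.
  - exists M. auto.
  - intros a b Ha Hb. destruct (HdM a b Ha Hb) as (y & Hy & Hl).
    exists y. split; [exact Hy|]. apply HP. apply C_NormedModule_mixin_compat1. exact Hl.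
Qed.

Lemma cint_elim (f : R -> C) (l : C) : cint f l ->
  forall eps : R, (0 < eps)%R -> exists d M : R, (0 < d)%R /\
     forall a b, (0 < a < d)%R -> (M < b)%R -> exists y, C_RInt f a b y /\ (Cmod (y - l) < eps)%R.
Proof.
  intros H eps He.
  specialize (H (fun y : C => (Cmod (y - l) < eps)%R)).
  destruct H as [Q S [d Hd] [M HM] HQS].
  (* The uniform balls on [C] are coordinatewise squares, so passing to the modulus costs a factor
     [sqrt 2]. *)
  { assert (He' : (0 < eps / sqrt 2)%R) by (apply Rdiv_lt_0_compat; [lra|apply Rlt_sqrt2_0]).
    exists (mkposreal _ He'). intros y Hy.
    apply C_NormedModule_mixin_compat2 in Hy. simpl in Hy.
    replace (sqrt 2 * (eps / sqrt 2))%R with eps in Hy by (field; apply sqrt2_neq_0). exact Hy. }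
  exists d, M. split; [apply cond_pos|]. intros a b Ha Hb.
  apply (HQS a b); [|apply HM, Hb]. apply Hd; [|lra].
  unfold ball; simpl; unfold AbsRing_ball, abs, minus, plus, opp; simpl.
  apply Rabs_lt_between. lra.
Qed.

Lemma cint_FTC (F f : R -> C) (l0 l1 : C) :
  (forall t, (0 < t)%R -> cderiv F t (f t)) -> (forall t, (0 < t)%R -> ccont f t) ->
  clim0 F l0 -> climinf F l1 -> cint f (l1 - l0).
Proof.
  intros Hd Hc H0 H1. apply cint_intro. intros eps He.
  destruct (H0 (eps / 2)%R) as (d & Hd0 & Hd1); [lra|]. destruct (H1 (eps / 2)%R) as (M & HM); [lra|].
  exists d, (Rmax M d). split; [exact Hd0|]. intros a b Ha Hb.
  assert (hM : (M < b)%R) by (eapply Rle_lt_trans; [apply Rmax_l|exact Hb]).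
  assert (hd : (d < b)%R) by (eapply Rle_lt_trans; [apply Rmax_r|exact Hb]).
  exists (F b - F a). split.
  - apply C_RInt_FTC; intros x Hx; rewrite Rmin_left in Hx by lra; [apply Hd|apply Hc]; lra.
  - replace (F b - F a - (l1 - l0)) with ((F b - l1) + - (F a - l0)) by ring.
    eapply Rle_lt_trans; [apply Cmod_triangle|]. rewrite Cmod_opp.
    specialize (Hd1 a Ha). specialize (HM b hM). lra.
Qed.


Lemma cint_plus f g lf lg : cint f lf -> cint g lg -> cint (fun t => f t + g t) (lf + lg).
Proof. exact (is_RInt_gen_plus (V := C_R_CompleteNormedModule) f g lf lg). Qed.

(** As for compact intervals, the scalar is complex, so the limit is taken by hand in its epsilon
    form. *)
Lemma cint_scal c f l : cint f l -> cint (fun t => c * f t) (c * l).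
Proof.
  intros H. apply cint_intro. intros eps He. pose proof (Cmod_ge_0 c) as Hc.
  destruct (cint_elim f l H (eps / (Cmod c + 1))%R) as (d & M & Hd & HdM).
  { apply Rdiv_lt_0_compat; lra. }
  exists d, M. split; [exact Hd|]. intros a b Ha Hb.
  destruct (HdM a b Ha Hb) as (y & Hy & Hl). exists (c * y). split.
  - apply C_RInt_scal, Hy.
  - replace (c * y - c * l) with (c * (y - l)) by ring. rewrite Cmod_mult.
    apply Rle_lt_trans with ((Cmod c) * (eps / (Cmod c + 1)))%R.
    + apply Rmult_le_compat_l; lra.
    + apply Rmult_lt_reg_r with (Cmod c + 1)%R; [lra|].
      replace (Cmod c * (eps / (Cmod c + 1)) * (Cmod c + 1))%R with (Cmod c * eps)%R by (field; lra). nra.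
Qed.

Lemma cint_minus f g lf lg : cint f lf -> cint g lg -> cint (fun t => f t - g t) (lf - lg).
Proof. exact (is_RInt_gen_minus (V := C_R_CompleteNormedModule) f g lf lg). Qed.

Lemma cint_ext f g l : (forall t, (0 < t)%R -> f t = g t) -> cint f l -> cint g l.
Proof.
  intros E H. apply cint_intro. intros eps He.
  destruct (cint_elim f l H eps He) as (d & M & Hd & HdM).
  exists d, (Rmax M d). split; [exact Hd|]. intros a b Ha Hb.
  assert (hM : (M < b)%R) by (eapply Rle_lt_trans; [apply Rmax_l|exact Hb]).
  assert (hd : (d < b)%R) by (eapply Rle_lt_trans; [apply Rmax_r|exact Hb]).
  destruct (HdM a b Ha hM) as (y & Hy & Hl). exists y. split; [|exact Hl].
  eapply (is_RInt_ext (V := C_R_CompleteNormedModule)); [|exact Hy].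
  intros x Hx. rewrite Rmin_left in Hx by lra. apply E. lra.
Qed.

Lemma cint_eq f l l' : l = l' -> cint f l -> cint f l'.
Proof. intros ->; auto. Qed.

Lemma cint_zero : cint (fun _ => 0) 0.
Proof.
  apply (cint_eq _ (0 - 0)); [ring|].
  apply (cint_FTC (fun _ => 0)); intros.
  - apply cderiv_const.
  - apply ccont_const.
  - apply (clim0_bound _ _ 0 1); [lra|]. intros t _. rewrite Rmult_0_l. right.
    replace (0 - 0) with (RtoC 0) by ring. apply Cmod_0.
  - apply (climinf_bound _ _ 0). intros t _. right.
    replace (0 - 0) with (RtoC 0) by ring. rewrite Cmod_0. unfold Rdiv; ring.
Qed.

Lemma cint_csum (f : nat -> R -> C) (l : nat -> C) n :
  (forall i, (i < n)%nat -> cint (f i) (l i)) ->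
  cint (fun t => csum (fun i => f i t) n) (csum l n).
Proof.
  induction n as [|n IH]; intros H; simpl; [apply cint_zero|].
  apply cint_plus; [apply IH; intros; apply H; lia|apply H; lia].
Qed.

Lemma cint_unique f l l' : cint f l -> cint f l' -> l = l'.
Proof.
  intros H H'. apply is_RInt_gen_unique in H. apply is_RInt_gen_unique in H'. congruence.
Qed.

(** Both improper integrals are truncated to one common interval [[a,b]], where the compact
    inequality holds, with an error [eps/2] each. *)
Lemma cint_norm_le (f : R -> C) (g : R -> R) (l : C) (lg : R) :
  (forall t, (0 < t)%R -> (Cmod (f t) <= g t)%R) ->
  cint f l -> cint (fun t => RtoC (g t)) lg -> (Cmod l <= lg)%R.
Proof.
  intros Hb Hf Hg. apply le_epsilon. intros eps He.
  destruct (cint_elim _ _ Hf (eps / 2)%R) as (d & M & Hd & HdM); [lra|].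
  destruct (cint_elim _ _ Hg (eps / 2)%R) as (d' & M' & Hd' & HdM'); [lra|].
  set (a := (Rmin d d' / 2)%R). set (b := (Rmax (Rmax M M') a + 1)%R).
  assert (ha : (0 < a /\ a < d /\ a < d')%R).
  { unfold a. pose proof (Rmin_pos d d' Hd Hd'). pose proof (Rmin_l d d'). pose proof (Rmin_r d d'). lra. }
  assert (hb : (M < b /\ M' < b /\ a < b)%R).
  { unfold b. pose proof (Rmax_l M M'). pose proof (Rmax_r M M').
    pose proof (Rmax_l (Rmax M M') a). pose proof (Rmax_r (Rmax M M') a). lra. }
  destruct (HdM a b) as (y & Hy & Hl); [lra|lra|].
  destruct (HdM' a b) as (y' & Hy' & Hl'); [lra|lra|].
  assert (Hyy : (Cmod y <= fst y')%R).
  { eapply C_RInt_norm_le; [| |exact Hy|].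
    - lra.
    - intros x Hx. apply Hb. lra.
    - apply (is_RInt_fct_extend_fst (U := R_NormedModule) (V := R_NormedModule) _ a b y' Hy'). }
  assert (H1 : (fst y' - lg <= Cmod (y' - lg))%R).
  { eapply Rle_trans; [apply Rle_abs|]. apply (re_le_Cmod (y' - lg)). }
  assert (H2 : (Cmod l <= Cmod y + Cmod (y - l))%R).
  { replace l with (y + - (y - l)) at 1 by ring. rewrite <- (Cmod_opp (y - l)). apply Cmod_triangle. }
  lra.
Qed.

Lemma ccont_exp_neg (x t : R) : ccont (fun u => RtoC (exp (- (x * u)))) t.
Proof. apply ccont_RtoC, continuity_pt_filterlim. reg. Qed.

(** Decomposes along the syntax of the function. The nonvanishing of denominators remains as
    subgoals. *)
Ltac ccont_tac :=
  lazymatch goal with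
  | |- ccont (fun _ => ?c) _ => apply ccont_const
  | |- ccont (fun u => RtoC u) _ => apply ccont_id
  | |- ccont (fun u => RtoC (exp (- (?x * u)))) _ => apply ccont_exp_neg
  | |- ccont (fun u => Cexp (?c * RtoC u)) _ => apply ccont_Cexp
  | |- ccont (fun u => @?f u + @?g u) _ => apply (ccont_plus f g); ccont_tac
  | |- ccont (fun u => @?f u - @?g u) _ => apply (ccont_minus f g); ccont_tac
  | |- ccont (fun u => - @?f u) _ => apply (ccont_opp f); ccont_tac
  | |- ccont (fun u => @?f u * @?g u) _ => apply (ccont_mult f g); ccont_tac
  | |- ccont (fun u => @?f u / @?g u) _ =>
      apply (ccont_mult f (fun u => / g u)); [ccont_tac|apply (ccont_inv g); [|ccont_tac]]
  | |- ccont (fun u => / @?f u) _ => apply (ccont_inv f); [|ccont_tac]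
  | |- ccont (fun u => @?f u ^ ?n) _ => apply (ccont_pow f); ccont_tac
  | |- ccont (fun u => csum (fun i => @?f u i) ?n) _ =>
      apply (ccont_csum (fun i u => f u i)); intros; cbv beta; ccont_tac
  | |- _ => idtac
  end.

Lemma exp_neg_le (d t : R) : (0 < d)%R -> (0 < t)%R -> (exp (- (d * t)) <= / d / t)%R.
Proof.
  intros Hd Ht. assert (H : (0 < d * t)%R) by (apply Rmult_lt_0_compat; assumption).
  rewrite exp_Ropp. unfold Rdiv. rewrite <- Rinv_mult.
  apply Rinv_le_contravar; [exact H|]. pose proof (exp_ineq1 (d * t)). lra.
Qed.

Lemma exp_neg_le_1 (y : R) : (0 <= y)%R -> (exp (- y) <= 1)%R.
Proof.
  intros [H|H].
  - left. rewrite <- exp_0. apply exp_increasing. lra.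
  - rewrite <- H, Ropp_0, exp_0. lra.
Qed.

Lemma exp_le (x y : R) : (x <= y)%R -> (exp x <= exp y)%R.
Proof. intros [H|H]; [left; apply exp_increasing, H|rewrite H; lra]. Qed.

(** Split [e^(-dt)] into two equal halves: one absorbs [t^k] by induction, the other absorbs the
    extra factor [t]. *)
Lemma pow_exp_neg_le (k : nat) : forall d : R, (0 < d)%R ->
  exists K, forall t, (0 < t)%R -> (t ^ k * exp (- (d * t)) <= K / t)%R.
Proof.
  induction k as [|k IH]; intros d Hd.
  - exists (/ d)%R. intros t Ht. simpl. rewrite Rmult_1_l. apply exp_neg_le; assumption.
  - destruct (IH (d / 2)%R) as [K HK]; [lra|]. exists (K * / (d / 2))%R. intros t Ht.
    specialize (HK t Ht). pose proof (exp_neg_le (d / 2) t ltac:(lra) Ht) as H2.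
    replace (exp (- (d * t))) with (exp (- (d / 2 * t)) * exp (- (d / 2 * t)))%R
      by (rewrite <- exp_plus; f_equal; field).
    pose proof (exp_pos (- (d / 2 * t))) as H3. pose proof (pow_lt t k Ht) as H4.
    replace (t ^ S k * (exp (- (d / 2 * t)) * exp (- (d / 2 * t))))%R
      with ((t ^ k * exp (- (d / 2 * t))) * (t * exp (- (d / 2 * t))))%R by (simpl; ring).
    replace (K * / (d / 2) / t)%R with ((K / t) * (t * (/ (d / 2) / t)))%R by (field; lra).
    apply Rmult_le_compat; try (apply Rmult_le_pos; lra); [exact HK|].
    apply Rmult_le_compat_l; lra.
Qed.

(** Cauchy criterion for [F b - F a] as [a] tends to 0 and [b] to infinity. Near 0 the integrand is
    bounded by [K], so the primitive is Lipschitz; at infinity the exponential majorant is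
    integrated exactly. *)
Lemma cint_dominated (f : R -> C) (K d : R) : (0 < d)%R ->
  (forall t, (0 < t)%R -> ccont f t) ->
  (forall t, (0 < t)%R -> (Cmod (f t) <= K * exp (- (d * t)))%R) ->
  exists l, cint f l.
Proof.
  intros Hd Hc Hb.
  assert (HK : (0 <= K)%R).
  { specialize (Hb 1%R Rlt_0_1). pose proof (Cmod_ge_0 (f 1%R)). pose proof (exp_pos (- (d * 1))).
    apply Rnot_lt_le. intros H1. nra. }
  set (F := fun t => RInt (V := C_R_CompleteNormedModule) f 1 t).
  assert (HF0 : forall a b, (0 < a)%R -> (0 < b)%R -> exists y, C_RInt f a b y).
  { intros a b Ha Hb'. apply C_RInt_ex. intros x [Hx _]. apply Hc.
    pose proof (Rmin_pos a b Ha Hb'). lra. }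
  assert (HF1 : forall t, (0 < t)%R -> C_RInt f 1 t (F t)).
  { intros t Ht. apply (RInt_correct (V := C_R_CompleteNormedModule)).
    apply (HF0 1%R t); lra. }
  assert (HF : forall a b, (0 < a)%R -> (0 < b)%R -> C_RInt f a b (F b - F a)).
  { intros a b Ha Hb'. replace (F b - F a) with (- F a + F b) by ring.
    apply (is_RInt_Chasles (V := C_R_CompleteNormedModule) f a 1 b).
    - apply (is_RInt_swap (V := C_R_CompleteNormedModule)), HF1, Ha.
    - apply HF1, Hb'. }
  assert (Hlip : forall a b, (0 < a)%R -> (0 < b)%R -> (Cmod (F b - F a) <= Rabs (b - a) * K)%R).
  { intros a b Ha Hb'. rewrite Cmod_norm.
    apply (norm_RInt_le_const_abs (V := C_R_NormedModule) f a b (F b - F a) K).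
    - intros x Hx. rewrite <- Cmod_norm. pose proof (Rmin_pos a b Ha Hb').
      eapply Rle_trans; [apply Hb; lra|].
      pose proof (exp_neg_le_1 (d * x)). assert (0 <= d * x)%R by (apply Rmult_le_pos; lra). nra.
    - apply HF; assumption. }
  assert (Htail0 : forall M a b, (0 < M)%R -> (M <= a)%R -> (a <= b)%R ->
     (Cmod (F b - F a) <= K / d * (/ d / M))%R).
  { intros M a b HM Ha Hab.
    apply Rle_trans with ((- (K / d) * exp (- (d * b))) - (- (K / d) * exp (- (d * a))))%R.
    - eapply C_RInt_norm_le; [exact Hab| |apply HF; lra|].
      + intros x Hx. apply Hb. lra.
      + apply (is_RInt_derive (fun x => - (K / d) * exp (- (d * x)))%R).
        * intros x _. auto_derive; [trivial|]. field. lra.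
        * intros x _. apply continuity_pt_filterlim. reg.
    - pose proof (exp_pos (- (d * b))). 
      assert (0 <= K / d)%R by (apply Rdiv_le_0_compat; lra).
      assert (exp (- (d * a)) <= / d / M)%R.
      { eapply Rle_trans; [|apply exp_neg_le; assumption]. apply exp_le. nra. }
      nra. }
  assert (Htail : forall M a b, (0 < M)%R -> (M <= a)%R -> (M <= b)%R ->
     (Cmod (F b - F a) <= K / d * (/ d / M))%R).
  { intros M a b HM Ha Hb'. destruct (Rle_lt_dec a b) as [h|h].
    - apply Htail0; assumption.
    - rewrite <- Cmod_opp. replace (- (F b - F a)) with (F a - F b) by ring.
      apply Htail0; lra. }
  destruct (proj1 (filterlim_locally_cauchy (U := C_R_CompleteNormedModule)
     (F := filter_prod (at_right 0) (Rbar_locally p_infty))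
     (fun ab : R * R => F (snd ab) - F (fst ab)))) as [l Hl].
  (* The thresholds make the variation at each end at most [e]. The added [1] in [dd] and [M] keeps
     both of them positive when [K = 0]. *)
  - intros eps. set (e := (eps / 4)%R). assert (He : (0 < e)%R) by (unfold e; pose proof (cond_pos eps); lra).
    set (dd := (e / (K + 1))%R). assert (Hdd : (0 < dd)%R) by (unfold dd; apply Rdiv_lt_0_compat; lra).
    set (M := ((K / d * / d + 1) / e)%R).
    assert (HKd : (0 <= K / d * / d)%R).
    { apply Rmult_le_pos; [apply Rdiv_le_0_compat; lra|left; apply Rinv_0_lt_compat; lra]. }
    assert (HM : (0 < M)%R) by (unfold M; apply Rdiv_lt_0_compat; lra).
    exists (fun ab => 0 < fst ab < dd /\ M < snd ab)%R. split.
    + apply (Filter_prod _ _ _ (fun a => 0 < a < dd)%R (fun b => M < b)%R).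
      * exists (mkposreal dd Hdd). intros y Hy Hy0. split; [exact Hy0|].
        unfold ball in Hy; simpl in Hy; unfold AbsRing_ball, abs, minus, plus, opp in Hy; simpl in Hy.
        apply Rabs_lt_between in Hy. lra.
      * exists M. auto.
      * simpl. auto.
    + intros [a b] [a' b'] [Ha Hb1] [Ha' Hb1']. simpl in *.
      apply C_NormedModule_mixin_compat1.
      change (Cmod ((F b' - F a') - (F b - F a)) < eps)%R.
      replace ((F b' - F a') - (F b - F a)) with ((F b' - F b) + (F a - F a')) by ring.
      eapply Rle_lt_trans; [apply Cmod_triangle|].
      pose proof (Htail M b b' HM ltac:(lra) ltac:(lra)) as h1.
      pose proof (Hlip a' a ltac:(lra) ltac:(lra)) as h2.
      assert (h3 : (Rabs (a - a') * K <= e)%R).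
      { apply Rle_trans with (dd * (K + 1))%R; [|right; unfold dd; field; lra].
        apply Rmult_le_compat; try lra; [apply Rabs_pos|].
        apply Rabs_le. lra. }
      assert (h4 : (K / d * (/ d / M) <= e)%R).
      { unfold M. replace (K / d * (/ d / ((K / d * / d + 1) / e)))%R with
          (e * ((K / d * / d) / (K / d * / d + 1)))%R.
        - rewrite <- (Rmult_1_r e) at 2. apply Rmult_le_compat_l; [lra|].
          apply Rmult_le_reg_r with (K / d * / d + 1)%R; [lra|].
          unfold Rdiv at 1. rewrite Rmult_assoc, Rinv_l by lra. lra.
        - field. repeat split; try lra.
          intros E. assert (K / d * / d + 1 = 0)%R; [|lra].
          replace (K / d * / d + 1)%R with ((K + d * d) / (d * d))%R by (field; lra).
          replace (K + d * d)%R with 0%R by lra. unfold Rdiv; ring. }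
      unfold e in *. pose proof (cond_pos eps). lra.
  - exists l. apply cint_intro. intros eps He.
    destruct (Hl (fun y : C => (Cmod (y - l) < eps)%R)) as [Q S [dd Hdd] [M HM] HQS].
    { assert (He' : (0 < eps / sqrt 2)%R) by (apply Rdiv_lt_0_compat; [lra|apply Rlt_sqrt2_0]).
      exists (mkposreal _ He'). intros y Hy.
      apply C_NormedModule_mixin_compat2 in Hy. simpl in Hy.
      replace (sqrt 2 * (eps / sqrt 2))%R with eps in Hy by (field; apply sqrt2_neq_0). exact Hy. }
    exists dd, (Rmax M 0). split; [apply cond_pos|]. intros a b Ha Hb1.
    pose proof (Rmax_l M 0). pose proof (Rmax_r M 0).
    exists (F b - F a). split; [apply HF; lra|].
    apply (HQS a b); [|apply HM; lra]. apply Hdd; [|lra].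
    unfold ball; simpl; unfold AbsRing_ball, abs, minus, plus, opp; simpl.
    apply Rabs_lt_between. lra.
Qed.

(** By parts: [t^(j+1) e^(-xt)] vanishes at both ends, so the integral of its derivative is 0, which
    expresses the moment of order [j + 1] through that of order [j]. *)
Lemma cint_moment (x : R) (j : nat) : (0 < x)%R ->
  cint (fun t => RtoC t ^ j * RtoC (exp (- (x * t)))) (INR (fact j) / RtoC x ^ S j).
Proof.
  intros Hx. assert (Hx0 : RtoC x <> 0) by (apply RtoC_neq_0; lra).
  induction j as [|j IH].
  - apply (cint_ext (fun t => RtoC (exp (- (x * t))))); [intros; simpl; ring|].
    apply (cint_eq _ (0 - RtoC (- / x))).
    { rewrite RtoC_opp, RtoC_inv by lra. simpl. field. exact Hx0. }
    apply (cint_FTC (fun t => RtoC (- (/ x) * exp (- (x * t))))).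
    + intros t Ht. apply cderiv_RtoC. auto_derive; [trivial|]. field. lra.
    + intros t _. apply ccont_exp_neg.
    + apply (clim0_bound _ _ 1 1); [lra|]. intros t Ht. rewrite <- RtoC_minus, Cmod_R.
      replace (- / x * exp (- (x * t)) - - / x)%R with (/ x * (1 - exp (- (x * t))))%R by ring.
      assert (H0 : (0 <= x * t)%R) by (apply Rmult_le_pos; lra).
      pose proof (exp_neg_le_1 _ H0).
      assert (1 - x * t <= exp (- (x * t)))%R.
      { destruct (Req_dec (x * t) 0) as [E|E]; [rewrite E, Ropp_0, exp_0; lra|].
        pose proof (exp_ineq1 (- (x * t)) ltac:(lra)). lra. }
      assert (0 < / x)%R by (apply Rinv_0_lt_compat; lra).
      rewrite Rabs_pos_eq by (apply Rmult_le_pos; lra).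
      apply Rle_trans with (/ x * (x * t))%R; [apply Rmult_le_compat_l; lra|right; field; lra].
    + apply (climinf_bound _ _ (/ x * / x)). intros t Ht.
      replace (RtoC (- / x * exp (- (x * t))) - 0) with (RtoC (- / x * exp (- (x * t)))) by ring.
      rewrite Cmod_R, Rabs_mult, Rabs_Ropp.
      assert (0 < / x)%R by (apply Rinv_0_lt_compat; lra).
      rewrite (Rabs_pos_eq (/ x)), (Rabs_pos_eq (exp _)) by (try (left; apply exp_pos); lra).
      unfold Rdiv. rewrite Rmult_assoc. apply Rmult_le_compat_l; [lra|]. apply exp_neg_le; lra.
  - pose proof (cint_FTC (fun t => RtoC (t ^ S j * exp (- (x * t))))
      (fun t => INR (S j) * (RtoC t ^ j * RtoC (exp (- (x * t)))) - RtoC x * (RtoC t ^ S j * RtoC (exp (- (x * t))))) 0 0) as HD.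
    assert (HD' : cint (fun t => INR (S j) * (RtoC t ^ j * RtoC (exp (- (x * t)))) - RtoC x * (RtoC t ^ S j * RtoC (exp (- (x * t))))) (0 - 0)).
    { apply HD; clear HD.
      - intros t Ht. rewrite <- !RtoC_pow, <- !RtoC_mult, <- RtoC_minus. apply cderiv_RtoC.
        auto_derive; [trivial|].
        change (1 * (INR (S j) * t ^ j) * exp (- (x * t)) + t ^ S j * (- (x * 1) * exp (- (x * t)))
          = INR (S j) * (t ^ j * exp (- (x * t))) - x * (t ^ S j * exp (- (x * t))))%R. ring.
      - intros t _. ccont_tac.
      - apply (clim0_bound _ _ 1 1); [lra|]. intros t Ht.
        replace (RtoC (t ^ S j * exp (- (x * t))) - 0) with (RtoC (t ^ S j * exp (- (x * t)))) by ring.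
        assert (h1 : (0 <= t ^ j <= 1)%R) by (split; [apply pow_le; lra|rewrite <- (pow1 j); apply pow_incr; lra]).
        assert (h2 : (0 < exp (- (x * t)) <= 1)%R) by (split; [apply exp_pos|apply exp_neg_le_1, Rmult_le_pos; lra]).
        rewrite Cmod_R, Rabs_pos_eq by (apply Rmult_le_pos; [apply pow_le|]; lra).
        simpl. rewrite Rmult_assoc, (Rmult_comm t), (Rmult_comm 1). 
        rewrite (Rmult_comm t 1). apply Rmult_le_compat_r; [lra|]. nra.
      - destruct (pow_exp_neg_le (S j) x Hx) as [K HK]. apply (climinf_bound _ _ K). intros t Ht.
        replace (RtoC (t ^ S j * exp (- (x * t))) - 0) with (RtoC (t ^ S j * exp (- (x * t)))) by ring.
        rewrite Cmod_R, Rabs_pos_eq; [apply HK; lra|].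
        apply Rmult_le_pos; [apply pow_le; lra|left; apply exp_pos]. }
    pose proof (cint_scal (/ x) _ _ (cint_minus _ _ _ _ (cint_scal (INR (S j)) _ _ IH) HD')) as H.
    eapply cint_ext; [|eapply cint_eq; [|exact H]].
    + intros t Ht. cbv beta. field. exact Hx0.
    + rewrite fact_simpl, mult_INR, RtoC_mult, !Cpow_S. field. split; [|exact Hx0]. apply Cpow_nz, Hx0.
Qed.

(** * The logarithm as a regularised integral *)

(** In the right half-plane the arc cosine form of the argument becomes an arc tangent, a single
    differentiable formula without the case split on the sign of [Im z]. *)
Lemma Carg_atan (z : C) : (0 < Re z)%R -> Carg z = atan (Im z / Re z).
Proof.
  destruct z as [x y]. unfold Carg, Re, Im, Cmod. simpl fst; simpl snd. intros Hx.
  set (th := atan (y / x)).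
  assert (Hc : (x / sqrt (x ^ 2 + y ^ 2))%R = cos th).
  { unfold th. rewrite cos_atan. unfold Rsqr.
    replace (x ^ 2 + y ^ 2)%R with (x ^ 2 * (1 + y / x * (y / x)))%R by (field; lra).
    assert (0 < 1 + y / x * (y / x))%R by nra.
    rewrite sqrt_mult by (try apply pow2_ge_0; lra).
    rewrite sqrt_pow2 by lra.
    assert (0 < sqrt (1 + y / x * (y / x)))%R by (apply sqrt_lt_R0; lra).
    field. lra. }
  rewrite Hc. pose proof (atan_bound (y / x)) as Hb. fold th in Hb.
  pose proof PI_RGT_0.
  destruct (Rle_dec 0 y) as [Hy|Hy].
  - assert (0 <= th)%R.
    { unfold th. rewrite <- atan_0. destruct Hy as [Hy|Hy].
      - left. apply atan_increasing. apply Rdiv_lt_0_compat; lra.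
      - rewrite <- Hy. right. f_equal. field. lra. }
    apply acos_cos. lra.
  - assert (th < 0)%R.
    { unfold th. rewrite <- atan_0. apply atan_increasing.
      unfold Rdiv. assert (0 < / x)%R by (apply Rinv_0_lt_compat; lra). nra. }
    rewrite <- cos_neg. rewrite acos_cos by lra. ring.
Qed.

Lemma Clog_RtoC (x : R) : (0 < x)%R -> Clog (RtoC x) = RtoC (ln x).
Proof.
  intros Hx. unfold Clog. rewrite Carg_atan by exact Hx.
  rewrite Cmod_R, Rabs_pos_eq by lra. unfold Re, Im; simpl.
  replace (0 / x)%R with 0%R by (field; lra). rewrite atan_0. reflexivity.
Qed.

(** Only the derivative along a segment issuing from 1 is required, since [log b] is recovered as
    the integral of [dz/z] from 1 to [b]. *)
Lemma cderiv_Clog_segment (d : C) (t : R) : (0 < Re (1 + t * d))%R ->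
  cderiv (fun u => Clog (1 + RtoC u * d)) t (d / (1 + RtoC t * d)).
Proof.
  intros Ht. destruct d as [a b]. unfold Re in Ht. simpl in Ht.
  replace (1 + (t * a - 0 * b))%R with (1 + t * a)%R in Ht by ring.
  (* The real part stays positive near [t], so the arc tangent formula holds on a neighbourhood and
     may be differentiated. *)
  assert (Hloc : locally t (fun u : R => (0 < 1 + u * a)%R)).
  { apply (locally_open (fun u : R => (0 < 1 + u * a)%R) _).
    - apply (open_comp (fun u : R => 1 + u * a)%R (fun v => 0 < v)%R); [|apply open_gt].
      intros x _. apply (continuity_pt_filterlim (fun u : R => 1 + u * a)%R x). reg.
    - intros x H; exact H.
    - exact Ht. }
  assert (Hn : ((1 + t * a) ^ 2 + (t * b) ^ 2 <> 0)%R) by nra.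
  split.
  - apply (is_derive_ext_loc (fun u : R => ln (sqrt ((1 + u * a) ^ 2 + (u * b) ^ 2)))).
    + eapply filter_imp; [|exact Hloc]. intros u Hu. simpl. unfold Cmod; simpl.
      do 2 f_equal. ring.
    + auto_derive.
      { split; [|split; [|trivial]].
        - nra.
        - apply sqrt_lt_R0. nra. }
      simpl.
      assert (Hs : (0 < sqrt ((1 + t * a) * ((1 + t * a) * 1) + t * b * (t * b * 1)))%R) by (apply sqrt_lt_R0; nra).
      assert (Hs2 := sqrt_sqrt ((1 + t * a) * ((1 + t * a) * 1) + t * b * (t * b * 1)) ltac:(nra)).
      set (s := sqrt ((1 + t * a) * ((1 + t * a) * 1) + t * b * (t * b * 1))) in *.
      match goal with |- @eq _ ?x ?y => change (@eq R x y) end.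
      replace ((1 + (t * a - 0 * b)) * ((1 + (t * a - 0 * b)) * 1) + (0 + (t * b + 0 * a)) * ((0 + (t * b + 0 * a)) * 1))%R
        with (s * s)%R by (rewrite Hs2; ring).
      field. lra.
  - apply (is_derive_ext_loc (fun u : R => atan (u * b / (1 + u * a)))).
    + eapply filter_imp; [|exact Hloc]. intros u Hu. simpl. rewrite Carg_atan.
      * unfold Re, Im; simpl. f_equal. f_equal; ring.
      * unfold Re; simpl. lra.
    + auto_derive; [repeat split; lra|]. simpl.
      match goal with |- @eq _ ?x ?y => change (@eq R x y) end. unfold Rsqr.
      field. repeat split; try lra; nra.
Qed.

(** The Taylor coefficients at 0 of [e^((1-b)t)]. *)
Definition exp_coeff (b : C) (i : nat) : C := (1 - b) ^ i / INR (fact i).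

(** The numerator is [e^(-t)] times the Taylor remainder of [e^((1-b)t)] after [p + 1] terms. Hence
    the quotient is bounded near 0, while the factor [e^(-t)] keeps the subtracted terms integrable
    at infinity. *)
Definition log_kernel (b : C) (p : nat) (t : R) : C :=
  (Cexp (- b * t) - RtoC (exp (- (1 * t))) * csum (fun i => exp_coeff b i * RtoC t ^ i) (S p))
  / RtoC t ^ S p.

(** * Frullani's integral for a complex argument *)

Section Frullani.

Variable b : C.
Hypothesis Hb : (0 < Re b)%R.

Let d := b - 1.
Let seg (u : R) : C := 1 + RtoC u * d.
Let rho := Rmin 1 (Re b).

Lemma seg_rho_pos : (0 < rho)%R.
Proof. apply Rmin_pos; lra. Qed.

Lemma seg_Re u : (0 <= u <= 1)%R -> (rho <= Re (seg u))%R.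
Proof.
  intros Hu. unfold seg, d, Re in *. simpl.
  pose proof (Rmin_l 1 (fst b)). pose proof (Rmin_r 1 (fst b)). fold Re in *.
  unfold rho, Re. nra.
Qed.

Lemma seg_Cmod_ge u : (0 <= u <= 1)%R -> (rho <= Cmod (seg u))%R.
Proof.
  intros Hu. eapply Rle_trans; [apply seg_Re, Hu|].
  eapply Rle_trans; [apply Rle_abs|apply re_le_Cmod].
Qed.

Lemma seg_neq_0 u : (0 <= u <= 1)%R -> seg u <> 0.
Proof. intros Hu. apply Cmod_gt_0. pose proof (seg_Cmod_ge u Hu). pose proof seg_rho_pos. lra. Qed.

Lemma seg_Cmod_le u : (0 <= u <= 1)%R -> (Cmod (seg u) <= 1 + Cmod d)%R.
Proof.
  intros Hu. unfold seg. eapply Rle_trans; [apply Cmod_triangle|].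
  rewrite Cmod_1, Cmod_mult, Cmod_R, Rabs_pos_eq by lra. pose proof (Cmod_ge_0 d). nra.
Qed.

(** Integrating [k t] over [u] gives [K t], the integral of [e^(-zt)/z] along the segment from 1 to
    [b]. It is a primitive in [t] of [(e^(-bt) - e^(-t))/t], and goes from [log b] at 0 to 0 at
    infinity. The exponential is kept as a product so that its dependence on [u] has the form
    [Cexp (c * u)]. *)
Let k (t u : R) : C := d / seg u * (Cexp (- RtoC t) * Cexp (- (RtoC t * d) * RtoC u)).

Lemma frullani_kernel_eq t u : k t u = d / seg u * Cexp (- seg u * t).
Proof. unfold k. rewrite <- Cexp_plus. unfold seg. do 2 f_equal. ring. Qed.

Lemma ccont_seg_inv u : (0 <= u <= 1)%R -> ccont (fun u => d / seg u) u.
Proof. intros Hu. unfold seg. ccont_tac. apply seg_neq_0, Hu. Qed.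

Lemma ccont_frullani_kernel t u : (0 <= u <= 1)%R -> ccont (k t) u.
Proof. intros Hu. unfold k. apply (ccont_mult (fun u => d / seg u)); [apply ccont_seg_inv, Hu|ccont_tac]. Qed.

Let K (t : R) : C := RInt (V := C_R_CompleteNormedModule) (k t) 0 1.

Lemma frullani_primitive_spec t : C_RInt (k t) 0 1 (K t).
Proof.
  apply (RInt_correct (V := C_R_CompleteNormedModule)). apply C_RInt_ex.
  intros u Hu. rewrite Rmin_left, Rmax_right in Hu by lra. apply ccont_frullani_kernel, Hu.
Qed.

Lemma Clog_segment_RInt : C_RInt (fun u => d / seg u) 0 1 (Clog b).
Proof.
  replace (Clog b) with (Clog (seg 1%R) - Clog (seg 0%R)).
  - apply (C_RInt_FTC (fun u => Clog (seg u))); intros u Hu; rewrite Rmin_left, Rmax_right in Hu by lra.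
    + apply cderiv_Clog_segment. pose proof (seg_Re u Hu). pose proof seg_rho_pos. unfold seg in *. lra.
    + apply ccont_seg_inv, Hu.
  - unfold seg, d. replace (1 + RtoC 1 * (b - 1)) with b by ring.
    replace (1 + RtoC 0 * (b - 1)) with (RtoC 1) by ring.
    rewrite Clog_RtoC, ln_1 by lra. ring.
Qed.

Lemma exp_segment_RInt t : (0 < t)%R ->
  C_RInt (fun u => - d * (Cexp (- RtoC t) * Cexp (- (RtoC t * d) * RtoC u))) 0 1
    ((Cexp (- b * t) - Cexp (- RtoC t)) / t).
Proof.
  intros Ht. assert (Ht0 : RtoC t <> 0) by (apply RtoC_neq_0; lra).
  set (F := fun u : R => / RtoC t * (Cexp (- RtoC t) * Cexp (- (RtoC t * d) * RtoC u))).
  replace ((Cexp (- b * t) - Cexp (- RtoC t)) / t) with (F 1%R - F 0%R).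
  - apply C_RInt_FTC.
    + intros u _. unfold F. eapply cderiv_eq; [|apply cderiv_scal, cderiv_scal, cderiv_Cexp].
      field. exact Ht0.
    + intros u _. ccont_tac.
  - unfold F. rewrite <- !Cexp_plus.
    replace (- RtoC t + - (RtoC t * d) * RtoC 1) with (- b * t) by (unfold d; ring).
    replace (- RtoC t + - (RtoC t * d) * RtoC 0) with (- RtoC t) by ring.
    field. exact Ht0.
Qed.

Lemma Cmod_Cexp_seg t u : (0 <= t)%R -> (0 <= u <= 1)%R ->
  (Cmod (Cexp (- seg u * t)) <= exp (- (rho * t)))%R.
Proof.
  intros Ht Hu. rewrite Cmod_Cexp. apply exp_le. pose proof (seg_Re u Hu).
  unfold Re in *. cbn [Cmult Copp fst snd RtoC]. nra.
Qed.

Lemma Cmod_seg_inv u : (0 <= u <= 1)%R -> (Cmod (d / seg u) <= Cmod d / rho)%R.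
Proof.
  intros Hu. rewrite Cmod_div by (apply seg_neq_0, Hu). unfold Rdiv.
  apply Rmult_le_compat_l; [apply Cmod_ge_0|].
  apply Rinv_le_contravar; [apply seg_rho_pos|apply seg_Cmod_ge, Hu].
Qed.

Lemma Cmod_exp_seg_taylor h u p : (Rabs h <= 1)%R -> (0 <= u <= 1)%R ->
  (Cmod (Cexp (- seg u * h) - exp_taylor (- seg u * h) p)
    <= ((1 + Cmod d) * Rabs h) ^ p * exp (1 + Cmod d))%R.
Proof.
  intros Hh Hu. eapply Rle_trans; [apply Cexp_taylor_le|].
  pose proof (seg_Cmod_le u Hu) as H1. pose proof (Cmod_ge_0 (seg u)). pose proof (Cmod_ge_0 d).
  pose proof (Rabs_pos h).
  assert (E : Cmod (- seg u * h) = (Cmod (seg u) * Rabs h)%R) by (rewrite Cmod_mult, Cmod_opp, Cmod_R; reflexivity).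
  assert (HB2 : (Cmod (- seg u * h) <= (1 + Cmod d) * Rabs h)%R) by (rewrite E; nra).
  apply Rmult_le_compat; try (left; apply exp_pos).
  - apply Rdiv_le_0_compat; [apply pow_le, Cmod_ge_0|apply INR_fact_lt_0].
  - apply Rle_trans with (Cmod (- seg u * h) ^ p)%R.
    + assert (1 <= INR (fact p))%R by (change 1%R with (INR 1); apply le_INR, lt_O_fact).
      unfold Rdiv. rewrite <- (Rmult_1_r (_ ^ p)) at 2. apply Rmult_le_compat_l; [apply pow_le, Cmod_ge_0|].
      rewrite <- Rinv_1. apply Rinv_le_contravar; lra.
    + apply pow_incr. split; [apply Cmod_ge_0|exact HB2].
  - apply exp_le. eapply Rle_trans; [apply re_le_Cmod|]. nra.
Qed.

(** The first-order error of [K] is a single integral over the segment whose integrand contains the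
    second-order Taylor remainder of [e^(-zh)], hence is [O(h^2)] uniformly in [u]. *)
Lemma frullani_primitive_deriv t : (0 < t)%R -> cderiv K t (log_kernel b 0 t).
Proof.
  intros Ht. assert (Ht0 : RtoC t <> 0) by (apply RtoC_neq_0; lra).
  set (B := (1 + Cmod d)%R).
  apply (cderiv_of_quadratic K t _ (Cmod d / rho * (B ^ 2 * exp B)) 1); [lra|].
  intros h Hh.
  pose proof (C_RInt_plus _ _ _ _ _ _ (C_RInt_plus _ _ _ _ _ _ (frullani_primitive_spec (t + h)%R)
     (C_RInt_scal (-(1)) _ _ _ _ (frullani_primitive_spec t)))
     (C_RInt_scal (- RtoC h) _ _ _ _ (exp_segment_RInt t Ht))) as HI.
  replace (K (t + h)%R - K t - h * log_kernel b 0 t)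
    with (K (t + h)%R + - (1) * K t + - RtoC h * ((Cexp (- b * t) - Cexp (- RtoC t)) / t)).
  2:{ unfold log_kernel. rewrite <- Cexp_RtoC, Rmult_1_l, RtoC_opp. simpl. unfold exp_coeff. simpl. field. exact Ht0. }
  (* Writing the constant over [INR 1] presents it as the integral over [[0,1]] of the constant
     majorant. *)
  replace (Cmod d / rho * (B ^ 2 * exp B) * h ^ 2)%R with
    ((Cmod d / rho * (B ^ 2 * exp B) * h ^ 2) / INR 1)%R by (simpl; field; pose proof seg_rho_pos; lra).
  eapply C_RInt_norm_le; [| |exact HI|apply (RInt_pow 0)]; [lra|].
  intros u Hu. cbv beta. rewrite !frullani_kernel_eq.
  replace (Cexp (- RtoC t) * Cexp (- (RtoC t * d) * RtoC u)) with (Cexp (- seg u * t))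
    by (rewrite <- Cexp_plus; f_equal; unfold seg; ring).
  replace (- seg u * (t + h)%R) with (- seg u * t + - seg u * h) by (rewrite RtoC_plus; ring).
  rewrite Cexp_plus.
  (* The value at [t + h], the value at [t] and the derivative term share the factor [e^(-zt)]. What
     remains is [e^(-zh)] minus its two first Taylor terms. *)
  match goal with |- (Cmod ?z <= _)%R =>
    replace z with (d / seg u * (Cexp (- seg u * t) * (Cexp (- seg u * h) - exp_taylor (- seg u * h) 2))) end.
  2:{ unfold exp_taylor. simpl. field. apply seg_neq_0, Hu. }
  rewrite !Cmod_mult.
  replace (Cmod d / rho * (B ^ 2 * exp B) * h ^ 2 * u ^ 0)%R
    with (Cmod d / rho * (1 * ((B * Rabs h) ^ 2 * exp B)))%R.
  2:{ rewrite Rpow_mult_distr, pow2_abs. simpl. ring. }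
  apply Rmult_le_compat; [apply Cmod_ge_0|apply Rmult_le_pos; apply Cmod_ge_0|apply Cmod_seg_inv, Hu|].
  apply Rmult_le_compat; [apply Cmod_ge_0|apply Cmod_ge_0| |].
  - eapply Rle_trans; [apply Cmod_Cexp_seg; lra|]. apply exp_neg_le_1.
    apply Rmult_le_pos; [left; apply seg_rho_pos|lra].
  - apply Cmod_exp_seg_taylor; [lra|exact Hu].
Qed.

(** At [t = 0] the kernel is [d / seg u], whose integral is [Clog b]; the difference is controlled
    by [e^(-zt) - 1 = O(t)], uniformly on the segment. *)
Lemma frullani_primitive_0 : clim0 K (Clog b).
Proof.
  set (B := (1 + Cmod d)%R).
  apply (clim0_bound _ _ (Cmod d / rho * (B * exp B)) 1); [lra|]. intros t Ht.
  pose proof (C_RInt_plus _ _ _ _ _ _ (frullani_primitive_spec t) (C_RInt_scal (-(1)) _ _ _ _ Clog_segment_RInt)) as HI.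
  replace (K t - Clog b) with (K t + - (1) * Clog b) by ring.
  replace (Cmod d / rho * (B * exp B) * t)%R with
    ((Cmod d / rho * (B * exp B) * t) / INR 1)%R by (simpl; field; pose proof seg_rho_pos; lra).
  eapply C_RInt_norm_le; [| |exact HI|apply (RInt_pow 0)]; [lra|].
  intros u Hu. cbv beta. rewrite !frullani_kernel_eq.
  match goal with |- (Cmod ?z <= _)%R =>
    replace z with (d / seg u * (Cexp (- seg u * t) - exp_taylor (- seg u * t) 1)) end.
  2:{ unfold exp_taylor. simpl. field. apply seg_neq_0, Hu. }
  rewrite Cmod_mult.
  replace (Cmod d / rho * (B * exp B) * t * u ^ 0)%R
    with (Cmod d / rho * ((B * Rabs t) ^ 1 * exp B))%R by (rewrite (Rabs_pos_eq t) by lra; simpl; ring).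
  apply Rmult_le_compat; [apply Cmod_ge_0|apply Cmod_ge_0|apply Cmod_seg_inv, Hu|].
  apply Cmod_exp_seg_taylor; [rewrite Rabs_pos_eq; lra|exact Hu].
Qed.

Lemma frullani_primitive_infty : climinf K 0.
Proof.
  apply (climinf_bound _ _ (Cmod d / rho * / rho)). intros t Ht. pose proof seg_rho_pos as Hr.
  replace (K t - 0) with (K t) by ring.
  replace (Cmod d / rho * / rho / t)%R with
    ((Cmod d / rho * (/ rho / t)) / INR 1)%R by (simpl; field; lra).
  eapply C_RInt_norm_le; [| |exact (frullani_primitive_spec t)|apply (RInt_pow 0)]; [lra|].
  intros u Hu. rewrite frullani_kernel_eq, Cmod_mult.
  simpl pow. rewrite Rmult_1_r.
  apply Rmult_le_compat; [apply Cmod_ge_0|apply Cmod_ge_0|apply Cmod_seg_inv, Hu|].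
  eapply Rle_trans; [apply Cmod_Cexp_seg; lra|]. apply exp_neg_le; lra.
Qed.

Lemma ccont_log_kernel p t : (0 < t)%R -> ccont (log_kernel b p) t.
Proof.
  intros Ht. unfold log_kernel. ccont_tac. apply Cpow_nz, RtoC_neq_0. lra.
Qed.

Lemma cint_log_kernel_0 : cint (log_kernel b 0) (- Clog b).
Proof.
  apply (cint_eq _ (0 - Clog b)); [ring|].
  apply (cint_FTC K).
  - apply frullani_primitive_deriv.
  - apply ccont_log_kernel.
  - apply frullani_primitive_0.
  - apply frullani_primitive_infty.
Qed.

End Frullani.

(** The polynomial in [b] accumulated by successive integrations by parts. Its recursion is the one
    produced in [log_kernel_step]. *)
Fixpoint log_kernel_poly (p : nat) (b : C) : C :=
  match p with
  | O => 0
  | S q => / INR (S q) * (- b * log_kernel_poly q b + exp_coeff b (S q))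
  end.

Lemma INR_S_C_neq_0 n : RtoC (INR (S n)) <> 0.
Proof. apply RtoC_neq_0, not_0_INR. lia. Qed.

Lemma exp_coeff_S b i : INR (S i) * exp_coeff b (S i) = (1 - b) * exp_coeff b i.
Proof.
  unfold exp_coeff. rewrite fact_simpl, mult_INR, RtoC_mult, Cpow_S. field.
  split; [apply INR_fact_C_neq_0|apply INR_S_C_neq_0].
Qed.

Lemma exp_coeff_taylor b (t : R) n :
  csum (fun i => exp_coeff b i * RtoC t ^ i) n = exp_taylor ((1 - b) * t) n.
Proof.
  apply csum_ext. intros i _. unfold exp_coeff. rewrite Cpow_mult_l. field. apply INR_fact_C_neq_0.
Qed.

Lemma cderiv_inv_pow n t : (0 < t)%R ->
  cderiv (fun u => / RtoC u ^ n) t (- INR n / RtoC t ^ S n).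
Proof.
  intros Ht.
  apply (cderiv_ext_loc (fun u => RtoC (/ u ^ n)%R)).
  - exists (mkposreal t Ht). intros u Hu.
    unfold ball in Hu; simpl in Hu; unfold AbsRing_ball, abs, minus, plus, opp in Hu; simpl in Hu.
    apply Rabs_lt_between in Hu. rewrite RtoC_inv, RtoC_pow by (apply pow_nonzero; lra). reflexivity.
  - rewrite <- RtoC_pow, <- RtoC_opp, <- RtoC_div by (apply pow_nonzero; lra). apply cderiv_RtoC.
    auto_derive; [apply pow_nonzero; lra|].
    destruct n as [|n]; [simpl; field; lra|]. cbn [Init.Nat.pred].
    assert (t ^ n <> 0)%R by (apply pow_nonzero; lra).
    simpl pow. match goal with |- @eq _ ?x ?y => change (@eq R x y) end. field. lra.
Qed.

Lemma cderiv_exp_neg t : cderiv (fun u => RtoC (exp (- (1 * u)))) t (- RtoC (exp (- (1 * t)))).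
Proof. rewrite <- RtoC_opp. apply cderiv_RtoC. auto_derive; [trivial|]. rring. Qed.

(** * Raising the order of the kernel by integration by parts *)

Section IntegrationByParts.

Variables (b : C) (p : nat).
Hypothesis Hb : (0 < Re b)%R.

Let e (t : R) : C := RtoC (exp (- (1 * t))).
Let T (n : nat) (t : R) : C := csum (fun i => exp_coeff b i * RtoC t ^ i) n.
Let h (t : R) : C := Cexp (- b * t) - e t * T (S (S p)) t.
(** The boundary term. Its numerator subtracts [p + 2] Taylor terms although the denominator has
    degree [p + 1]: the extra term makes it [O(t)] at 0, so both boundary values vanish. *)
Let D (t : R) : C := h t * / RtoC t ^ S p.
Let D' (t : R) : C :=
  (- b * Cexp (- b * t) + e t * T (S (S p)) t - e t * ((1 - b) * T (S p) t)) / RtoC t ^ S p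
  - INR (S p) * (h t / RtoC t ^ S (S p)).

Lemma cderiv_log_kernel_numerator t : (0 < t)%R -> cderiv D t (D' t).
Proof.
  intros Ht. assert (Ht0 : RtoC t <> 0) by (apply RtoC_neq_0; lra).
  unfold D.
  assert (Hh : cderiv h t (- b * Cexp (- b * t) + e t * T (S (S p)) t - e t * ((1 - b) * T (S p) t))).
  { unfold h. eapply cderiv_eq; [|apply cderiv_plus; [apply cderiv_Cexp|]].
    2:{ apply (cderiv_ext_loc (fun u => (-(1)) * (e u * T (S (S p)) u))).
        { apply filter_forall. intros; cbv beta; ring. }
        apply cderiv_scal, cderiv_mult; [apply cderiv_exp_neg|apply cderiv_poly]. }
    rewrite (csum_ext (fun i => INR (S i) * exp_coeff b (S i) * RtoC t ^ i)
       (fun i => (1 - b) * (exp_coeff b i * RtoC t ^ i))) by (intros; rewrite exp_coeff_S; ring).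
    rewrite csum_scal. fold (T (S p) t). fold (e t). ring. }
  eapply cderiv_eq; [|apply cderiv_mult; [exact Hh|apply cderiv_inv_pow, Ht]].
  unfold D'. field. repeat split; try apply Cpow_nz; exact Ht0.
Qed.

Lemma log_kernel_numerator_0 : clim0 D 0.
Proof.
  apply (clim0_bound _ _ (Cmod (1 - b) ^ S (S p) * exp (Cmod (1 - b))) 1); [lra|]. intros t Ht.
  assert (Ht0 : RtoC t <> 0) by (apply RtoC_neq_0; lra).
  replace (D t - 0) with (e t * ((Cexp ((1 - b) * t) - exp_taylor ((1 - b) * t) (S (S p))) / RtoC t ^ S p)).
  2:{ unfold D, h, T. rewrite exp_coeff_taylor.
      replace (Cexp (- b * t)) with (e t * Cexp ((1 - b) * t)).
      - field. apply Cpow_nz, Ht0.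
      - unfold e. rewrite <- Cexp_RtoC, <- Cexp_plus. f_equal. rewrite Rmult_1_l, RtoC_opp. ring. }
  assert (Hpt : (0 < t ^ S p)%R) by (apply pow_lt; lra).
  rewrite Cmod_mult, Cmod_div by (apply Cpow_nz, Ht0).
  rewrite Cmod_pow, Cmod_R, (Rabs_pos_eq t) by lra.
  pose proof (Cexp_taylor_le ((1 - b) * t) (S (S p))) as HT.
  rewrite Cmod_mult, Cmod_R, (Rabs_pos_eq t) in HT by lra.
  set (x := Cmod (Cexp ((1 - b) * t) - exp_taylor ((1 - b) * t) (S (S p)))) in *.
  assert (He : (Cmod (e t) <= 1)%R).
  { unfold e. rewrite Cmod_R, Rabs_pos_eq by (left; apply exp_pos). apply exp_neg_le_1. lra. }
  pose proof (Cmod_ge_0 (1 - b)) as H1.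
  assert (Hx : (x <= (Cmod (1 - b) ^ S (S p) * exp (Cmod (1 - b)) * t) * t ^ S p)%R).
  { eapply Rle_trans; [exact HT|].
    replace (Cmod (1 - b) ^ S (S p) * exp (Cmod (1 - b)) * t * t ^ S p)%R
      with ((Cmod (1 - b) * t) ^ S (S p) * exp (Cmod (1 - b)))%R by (rewrite Rpow_mult_distr; simpl; ring).
    assert (Hp0 : (0 <= (Cmod (1 - b) * t) ^ S (S p))%R) by (apply pow_le; nra).
    apply Rmult_le_compat; try (left; apply exp_pos).
    - apply Rdiv_le_0_compat; [exact Hp0|apply INR_fact_lt_0].
    - assert (1 <= INR (fact (S (S p))))%R by (change 1%R with (INR 1); apply le_INR, lt_O_fact).
      unfold Rdiv. rewrite <- (Rmult_1_r (_ ^ _)) at 2. apply Rmult_le_compat_l; [exact Hp0|].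
      rewrite <- Rinv_1. apply Rinv_le_contravar; lra.
    - apply exp_le. eapply Rle_trans; [apply re_le_Cmod|].
      rewrite Cmod_mult, Cmod_R, (Rabs_pos_eq t) by lra. nra. }
  apply Rle_trans with (1 * (x / t ^ S p))%R.
  { apply Rmult_le_compat_r; [|exact He]. apply Rdiv_le_0_compat; [apply Cmod_ge_0|exact Hpt]. }
  rewrite Rmult_1_l. apply Rmult_le_reg_r with (t ^ S p)%R; [exact Hpt|].
  unfold Rdiv. rewrite Rmult_assoc, Rinv_l, Rmult_1_r by lra. exact Hx.
Qed.

Lemma log_kernel_numerator_infty : climinf D 0.
Proof.
  set (B := Re (csum (fun i => RtoC (Cmod (exp_coeff b i))) (S (S p)))).
  apply (climinf_bound _ _ (/ Re b + B * / 1)). intros t Ht.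
  assert (Ht0 : RtoC t <> 0) by (apply RtoC_neq_0; lra).
  assert (Hpt : (1 <= t ^ S p)%R) by (apply pow_R1_Rle; lra).
  replace (D t - 0) with (Cexp (- b * t) * / RtoC t ^ S p
     + - (e t * csum (fun i => exp_coeff b i * RtoC t ^ i * / RtoC t ^ S p) (S (S p)))).
  2:{ unfold D, h, T. rewrite csum_scal_r. ring. }
  unfold Rdiv. rewrite Rmult_plus_distr_r.
  eapply Rle_trans; [apply Cmod_triangle|]. rewrite Cmod_opp, !Cmod_mult, Cmod_inv by (apply Cpow_nz, Ht0).
  rewrite Cmod_pow, Cmod_R, (Rabs_pos_eq t) by lra.
  assert (Hi : (0 < / t ^ S p <= 1)%R).
  { split; [apply Rinv_0_lt_compat; lra|]. rewrite <- Rinv_1. apply Rinv_le_contravar; lra. }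
  apply Rplus_le_compat.
  - rewrite Cmod_Cexp. apply Rle_trans with (exp (- (Re b * t)) * 1)%R.
    + apply Rmult_le_compat; try lra; [left; apply exp_pos|].
      apply exp_le. unfold Re. cbn [Cmult Copp fst snd RtoC]. lra.
    + rewrite Rmult_1_r. apply exp_neg_le; lra.
  - assert (HB : (Cmod (csum (fun i => exp_coeff b i * RtoC t ^ i * / RtoC t ^ S p)%C (S (S p))) <= B)%R).
    { unfold B. apply Cmod_csum_le. intros i Hi'. rewrite !Cmod_mult, Cmod_inv by (apply Cpow_nz, Ht0).
      rewrite !Cmod_pow, Cmod_R, (Rabs_pos_eq t) by lra.
      rewrite <- (Rmult_1_r (Cmod (exp_coeff b i))) at 2. rewrite Rmult_assoc.
      apply Rmult_le_compat_l; [apply Cmod_ge_0|].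
      apply Rmult_le_reg_r with (t ^ S p)%R; [lra|]. rewrite Rmult_assoc, Rinv_l, Rmult_1_r, Rmult_1_l by lra.
      apply Rle_pow; [lra|lia]. }
    assert (He : (Cmod (e t) <= / 1 / t)%R).
    { unfold e. rewrite Cmod_R, Rabs_pos_eq by (left; apply exp_pos). apply exp_neg_le; lra. }
    rewrite (Rmult_comm B), (Rmult_assoc _ B), (Rmult_comm B), <- Rmult_assoc.
    apply Rmult_le_compat; try apply Cmod_ge_0; assumption.
Qed.

(** In [D'] the two truncations differ by one monomial, which over [t^(p+1)] leaves a multiple of
    [e^(-t)]. Thus [D'] is [- b] times the kernel of order [p], plus [exp_coeff b (p+1) e^(-t)],
    minus [p + 1] times the kernel of order [p + 1], and it integrates to 0. *)
Lemma log_kernel_step l : cint (log_kernel b p) l ->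
  cint (log_kernel b (S p)) (/ INR (S p) * (- b * l + exp_coeff b (S p))).
Proof.
  intros Hl.
  assert (HD : cint D' (0 - 0)).
  { apply (cint_FTC D).
    - apply cderiv_log_kernel_numerator.
    - intros t Ht. unfold D', h, e, T. ccont_tac; apply Cpow_nz, RtoC_neq_0; lra.
    - apply log_kernel_numerator_0.
    - apply log_kernel_numerator_infty. }
  pose proof (cint_scal (/ INR (S p)) _ _ (cint_minus _ _ _ _ (cint_plus _ _ _ _ (cint_scal (- b) _ _ Hl)
    (cint_scal (exp_coeff b (S p)) _ _ (cint_moment 1 0 Rlt_0_1))) HD)) as H.
  eapply cint_ext; [|eapply cint_eq; [|exact H]].
  - intros t Ht. cbv beta. assert (Ht0 : RtoC t <> 0) by (apply RtoC_neq_0; lra).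
    unfold D', h, log_kernel. change (RtoC t ^ 0) with (RtoC 1). fold (e t).
    fold (T (S p) t). fold (T (S (S p)) t).
    assert (ET : T (S (S p)) t = T (S p) t + exp_coeff b (S p) * RtoC t ^ S p) by reflexivity.
    rewrite ET, (Cpow_S t (S p)).
    field. repeat split; [apply Cpow_nz; exact Ht0|exact Ht0|apply INR_S_C_neq_0].
  - replace (INR (fact 0) / RtoC 1 ^ 1) with (RtoC 1) by (simpl; field; apply RtoC_neq_0; lra).
    field. apply INR_S_C_neq_0.
Qed.

End IntegrationByParts.

Lemma cint_log_kernel (b : C) (p : nat) : (0 < Re b)%R ->
  cint (log_kernel b p) ((-(1)) ^ S p / INR (fact p) * (b ^ p * Clog b) + log_kernel_poly p b).
Proof.
  intros Hb. induction p as [|p IH].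
  - eapply cint_eq; [|apply cint_log_kernel_0, Hb]. simpl. field.
  - eapply cint_eq; [|apply (log_kernel_step b p Hb), IH].
    cbn [log_kernel_poly]. rewrite fact_simpl, mult_INR, RtoC_mult, !Cpow_S. field.
    split; [apply INR_S_C_neq_0|apply INR_fact_C_neq_0].
Qed.

(** * Polynomial functions *)

Definition polynomial (f : C -> C) : Prop :=
  exists (c : nat -> C) (d : nat), forall x, f x = csum (fun i => c i * x ^ i) d.

Lemma polynomial_ext f g : (forall x, f x = g x) -> polynomial f -> polynomial g.
Proof. intros E (c & d & H). exists c, d. intros x. rewrite <- E. apply H. Qed.

Lemma polynomial_const a : polynomial (fun _ => a).
Proof. exists (fun _ => a), 1%nat. intros x. simpl. ring. Qed.

Lemma polynomial_scal a f : polynomial f -> polynomial (fun x => a * f x).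
Proof.
  intros (c & d & H). exists (fun i => a * c i), d. intros x.
  rewrite H, <- csum_scal. apply csum_ext. intros; ring.
Qed.

Lemma polynomial_plus f g : polynomial f -> polynomial g -> polynomial (fun x => f x + g x).
Proof.
  intros (c & d & H) (c' & d' & H').
  (* The coefficient sequences are unconstrained past their lengths, so each is cut at its own
     length before adding. *)
  exists (fun i => (if Nat.ltb i d then c i else RtoC 0) + (if Nat.ltb i d' then c' i else 0)), (Nat.max d d').
  intros x. rewrite H, H'. symmetry.
  rewrite (csum_ext _ (fun i => (if Nat.ltb i d then c i else RtoC 0) * x ^ i
     + (if Nat.ltb i d' then c' i else 0) * x ^ i)) by (intros; ring).
  rewrite csum_plus. f_equal.
  - rewrite (csum_pad _ d (Nat.max d d')); [|lia|].
    + apply csum_ext. intros i Hi. apply Nat.ltb_lt in Hi. rewrite Hi. reflexivity.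
    + intros i Hi. destruct (Nat.ltb_spec i d); [lia|ring].
  - rewrite (csum_pad _ d' (Nat.max d d')); [|lia|].
    + apply csum_ext. intros i Hi. apply Nat.ltb_lt in Hi. rewrite Hi. reflexivity.
    + intros i Hi. destruct (Nat.ltb_spec i d'); [lia|ring].
Qed.

Lemma polynomial_mul_X f : polynomial f -> polynomial (fun x => x * f x).
Proof.
  intros (c & d & H).
  exists (fun i => match i with O => RtoC 0 | S j => c j end), (S d). intros x.
  rewrite csum_Sl, H, <- csum_scal.
  rewrite (csum_ext (fun i => x * (c i * x ^ i)) (fun i => c i * x ^ S i)) by (intros; rewrite Cpow_S; ring).
  ring.
Qed.

Lemma polynomial_mul_affine a b f : polynomial f -> polynomial (fun x => (a + b * x) * f x).
Proof.
  intros H. apply (polynomial_ext (fun x => a * f x + b * (x * f x))); [intros; ring|].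
  apply polynomial_plus; apply polynomial_scal; [|apply polynomial_mul_X]; exact H.
Qed.

Lemma polynomial_csum (f : nat -> C -> C) n :
  (forall i, (i < n)%nat -> polynomial (f i)) -> polynomial (fun x => csum (fun i => f i x) n).
Proof.
  induction n as [|n IH]; intros H; simpl; [apply polynomial_const|].
  apply polynomial_plus; [apply IH; intros; apply H; lia|apply H; lia].
Qed.

Lemma polynomial_affine_pow a b n : polynomial (fun x => (a + b * x) ^ n).
Proof.
  induction n as [|n IH]; simpl; [apply polynomial_const|].
  apply (polynomial_mul_affine a b (fun x => (a + b * x) ^ n)), IH.
Qed.

Lemma polynomial_comp_affine a b f : polynomial f -> polynomial (fun x => f (a + b * x)).
Proof.
  intros (c & d & H).
  apply (polynomial_ext (fun x => csum (fun i => c i * (a + b * x) ^ i) d)); [intros; symmetry; apply H|].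
  apply (polynomial_csum (fun i x => c i * (a + b * x) ^ i)). intros i _.
  apply polynomial_scal, polynomial_affine_pow.
Qed.

Lemma polynomial_exp_coeff i : polynomial (fun b => exp_coeff b i).
Proof.
  apply (polynomial_ext (fun b => / INR (fact i) * (1 + (-(1)) * b) ^ i)).
  - intros b. unfold exp_coeff. replace (1 + - (1) * b) with (1 - b) by ring.
    field. apply INR_fact_C_neq_0.
  - apply polynomial_scal, polynomial_affine_pow.
Qed.

Lemma polynomial_log_kernel_poly p : polynomial (log_kernel_poly p).
Proof.
  induction p as [|p IH]; [apply polynomial_const|].
  change (polynomial (fun b => / INR (S p) * (- b * log_kernel_poly p b + exp_coeff b (S p)))).
  apply polynomial_scal, polynomial_plus; [|apply polynomial_exp_coeff].
  apply (polynomial_ext (fun b => (-(1)) * (b * log_kernel_poly p b))); [intros; ring|].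
  apply polynomial_scal, polynomial_mul_X, IH.
Qed.

Lemma log_kernel_poly_0 p : log_kernel_poly (S p) 0 = / (INR (S p) * INR (fact (S p))).
Proof.
  cbn [log_kernel_poly]. unfold exp_coeff. replace (1 - 0) with (RtoC 1) by ring. rewrite Cpow_1_l.
  field. split; [apply INR_fact_C_neq_0|apply INR_S_C_neq_0].
Qed.

(** The basis [exp_coeff b l] is chosen because the sums of [chi(k) exp_coeff (k+w) l] are evaluated
    by [bernoulli_diff]. *)
Lemma log_kernel_poly_span p : exists (q : nat -> C) (d : nat),
  forall b, log_kernel_poly p b = csum (fun l => q l * exp_coeff b l) d.
Proof.
  destruct (polynomial_comp_affine 1 (-(1)) _ (polynomial_log_kernel_poly p)) as (c & d & H).
  exists (fun i => c i * INR (fact i)), d. intros b.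
  replace b with (1 + - (1) * (1 - b)) at 1 by ring. rewrite H.
  apply csum_ext. intros i _. unfold exp_coeff. field. apply INR_fact_C_neq_0.
Qed.

(** * Complex power series *)

Definition cser (a : nat -> C) (l : C) : Prop :=
  forall eps : R, (0 < eps)%R ->
    exists N, forall n, (N <= n)%nat -> (Cmod (csum a n - l) < eps)%R.

Lemma is_series_cser (a : nat -> C) (l : C) :
  is_series (V := C_R_NormedModule) a l <-> cser a l.
Proof.
  split.
  - intros H eps He.
    assert (He' : (0 < eps / sqrt 2)%R) by (apply Rdiv_lt_0_compat; [lra|apply Rlt_sqrt2_0]).
    destruct (H (fun y : C => (Cmod (y - l) < eps)%R)) as [N HN].
    { exists (mkposreal _ He'). intros y Hy.
      apply C_NormedModule_mixin_compat2 in Hy. simpl in Hy.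
      replace (sqrt 2 * (eps / sqrt 2))%R with eps in Hy by (field; apply sqrt2_neq_0). exact Hy. }
    (* [csum a n] has [n] terms whereas [sum_n a n] has [n + 1], hence the shift. *)
    exists (S N). intros n Hn. destruct n as [|n]; [lia|].
    specialize (HN n ltac:(lia)). cbv beta in HN.
    change (sum_n (G := C_R_NormedModule) a n) with (sum_n (G := C_AbelianMonoid) a n) in HN.
    rewrite sum_n_csum in HN. exact HN.
  - intros H P [eps HP]. destruct (H eps (cond_pos eps)) as [N HN].
    exists N. intros n Hn. apply HP. apply C_NormedModule_mixin_compat1.
    change (sum_n (G := C_R_NormedModule) a n) with (sum_n (G := C_AbelianMonoid) a n).
    rewrite sum_n_csum. apply HN. lia.
Qed.

Lemma cser_ext a b l : (forall i, a i = b i) -> cser a l -> cser b l.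
Proof.
  intros E H eps He. destruct (H eps He) as [N HN]. exists N. intros n Hn.
  rewrite <- (csum_ext a b) by auto. apply HN, Hn.
Qed.

Lemma cser_plus a b la lb : cser a la -> cser b lb -> cser (fun i => a i + b i) (la + lb).
Proof.
  intros Ha Hb eps He. destruct (Ha (eps / 2)%R) as [N HN]; [lra|].
  destruct (Hb (eps / 2)%R) as [N' HN']; [lra|].
  exists (N + N')%nat. intros n Hn. rewrite csum_plus.
  replace (csum a n + csum b n - (la + lb)) with ((csum a n - la) + (csum b n - lb)) by ring.
  eapply Rle_lt_trans; [apply Cmod_triangle|].
  specialize (HN n ltac:(lia)). specialize (HN' n ltac:(lia)). lra.
Qed.

Lemma cser_scal c a l : cser a l -> cser (fun i => c * a i) (c * l).
Proof.
  intros H eps He. pose proof (Cmod_ge_0 c) as Hc.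
  destruct (H (eps / (Cmod c + 1))%R) as [N HN]; [apply Rdiv_lt_0_compat; lra|].
  exists N. intros n Hn. rewrite csum_scal. replace (c * csum a n - c * l) with (c * (csum a n - l)) by ring.
  rewrite Cmod_mult. specialize (HN n Hn).
  assert (Hp := Cmod_ge_0 (csum a n - l)).
  apply Rle_lt_trans with ((Cmod c) * (eps / (Cmod c + 1)))%R; [apply Rmult_le_compat_l; lra|].
  apply Rmult_lt_reg_r with (Cmod c + 1)%R; [lra|].
  replace (Cmod c * (eps / (Cmod c + 1)) * (Cmod c + 1))%R with (Cmod c * eps)%R by (field; lra). nra.
Qed.

Lemma cser_unique a l l' : cser a l -> cser a l' -> l = l'.
Proof.
  intros H H'. replace l with ((l - l') + l') by ring.
  replace (l - l') with (RtoC 0); [ring|]. symmetry. apply Cmod_eq_0, Rle_antisym; [|apply Cmod_ge_0].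
  apply le_epsilon. intros eps He.
  destruct (H (eps / 2)%R) as [N HN]; [lra|]. destruct (H' (eps / 2)%R) as [N' HN']; [lra|].
  specialize (HN (N + N')%nat ltac:(lia)). specialize (HN' (N + N')%nat ltac:(lia)).
  replace (l - l') with ((csum a (N + N') - l') + - (csum a (N + N') - l)) by ring.
  eapply Rle_trans; [apply Cmod_triangle|]. rewrite Cmod_opp. lra.
Qed.

Lemma Cmod_geometric_le (a : nat -> C) (A q : R) n k : (0 <= q < 1)%R ->
  (forall i, (Cmod (a i) <= A * q ^ i)%R) ->
  (Cmod (csum a (n + k) - csum a n) <= A * q ^ n / (1 - q))%R.
Proof.
  intros Hq H.
  assert (HA : (0 <= A)%R).
  { pose proof (H O) as H0. simpl in H0. pose proof (Cmod_ge_0 (a O)). lra. }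
  assert (E : (Cmod (csum a (n + k) - csum a n) <= A * q ^ n * (1 - q ^ k) / (1 - q))%R).
  { induction k as [|k IH].
    - rewrite Nat.add_0_r. replace (csum a n - csum a n) with (RtoC 0) by ring.
      rewrite Cmod_0. simpl. right. field. lra.
    - rewrite Nat.add_succ_r. cbn [csum].
      replace (csum a (n + k) + a (n + k)%nat - csum a n)
        with ((csum a (n + k) - csum a n) + a (n + k)%nat) by ring.
      eapply Rle_trans; [apply Cmod_triangle|].
      eapply Rle_trans; [apply Rplus_le_compat; [apply IH|apply H]|].
      right. rewrite pow_add. simpl. field. lra. }
  eapply Rle_trans; [exact E|]. unfold Rdiv. apply Rmult_le_compat_r; [left; apply Rinv_0_lt_compat; lra|].
  rewrite <- (Rmult_1_r (A * q ^ n)) at 2. apply Rmult_le_compat_l.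
  - apply Rmult_le_pos; [exact HA|apply pow_le; lra].
  - pose proof (pow_le q k ltac:(lra)). lra.
Qed.

Lemma cser_tail_le a l (A q : R) n : (0 <= q < 1)%R ->
  (forall i, (Cmod (a i) <= A * q ^ i)%R) -> cser a l ->
  (Cmod (l - csum a n) <= A * q ^ n / (1 - q))%R.
Proof.
  intros Hq H Hl. apply le_epsilon. intros eps He. destruct (Hl eps He) as [N HN].
  specialize (HN (n + N)%nat ltac:(lia)).
  replace (l - csum a n) with ((csum a (n + N) - csum a n) + - (csum a (n + N) - l)) by ring.
  eapply Rle_trans; [apply Cmod_triangle|]. rewrite Cmod_opp.
  pose proof (Cmod_geometric_le a A q n N Hq H). lra.
Qed.

Lemma cser_geometric_ex a (A q : R) : (0 <= q < 1)%R ->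
  (forall i, (Cmod (a i) <= A * q ^ i)%R) -> exists l, cser a l.
Proof.
  intros Hq H.
  destruct (ex_series_le (V := C_R_CompleteNormedModule) a (fun i => A * q ^ i)%R) as [l Hl].
  - intros n. pose proof (H n) as Hn. rewrite Cmod_norm in Hn. exact Hn.
  - exists (A * / (1 - q))%R. apply (is_series_scal (V := R_NormedModule)), is_series_geom. rewrite Rabs_pos_eq; lra.
  - exists l. apply is_series_cser. exact Hl.
Qed.

Lemma pow_small (q : R) : (0 <= q < 1)%R -> forall eps : R, (0 < eps)%R ->
  exists N, forall n, (N <= n)%nat -> (q ^ n < eps)%R.
Proof.
  intros Hq eps He. destruct (pow_lt_1_zero q ltac:(rewrite Rabs_pos_eq; lra) eps He) as [N HN].
  exists N. intros n Hn. specialize (HN n Hn). rewrite Rabs_pos_eq in HN by (apply pow_le; lra). exact HN.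
Qed.

Definition conv (a b : nat -> C) (k : nat) : C := csum (fun i => a i * b (k - i)%nat) (S k).

Lemma INR_S_le_pow2 k : (INR (S k) <= 2 ^ k)%R.
Proof.
  induction k as [|k IH]; [simpl; lra|].
  rewrite S_INR. simpl pow. assert (1 <= 2 ^ k)%R by (apply pow_R1_Rle; lra). lra.
Qed.

(** The difference between [csum a n * lb] and the Cauchy partial sum is the sum over [i < n] of
    [a i] times a tail of [b], each of size at most [2AB q^n]. The ratio [1/4] is chosen so that
    [n q^n <= 2^n 4^(-n)] tends to 0 with no finer estimate. *)
Lemma cser_mult a b la lb (A B q : R) : (0 <= q <= / 4)%R ->
  (forall i, (Cmod (a i) <= A * q ^ i)%R) -> (forall i, (Cmod (b i) <= B * q ^ i)%R) ->
  cser a la -> cser b lb -> cser (conv a b) (la * lb).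
Proof.
  intros Hq Ha Hb Hla Hlb.
  assert (HA : (0 <= A)%R) by (pose proof (Ha O) as H0; simpl in H0; pose proof (Cmod_ge_0 (a O)); lra).
  assert (HB : (0 <= B)%R) by (pose proof (Hb O) as H0; simpl in H0; pose proof (Cmod_ge_0 (b O)); lra).
  assert (Hdiff : forall n, (Cmod (csum a n * lb - csum (conv a b) n) <= A * B * 2 * (/ 2) ^ n)%R).
  { intros n. unfold conv. rewrite <- (csum_triangle (fun i j => a i * b j)).
    rewrite <- csum_scal_r, <- csum_minus.
    eapply Rle_trans; [apply (Cmod_csum_le_const _ (A * B * 2 * q ^ n))|].
    - intros i Hi. rewrite csum_scal. replace (a i * lb - a i * csum b (n - i)) with (a i * (lb - csum b (n - i))) by ring.
      rewrite Cmod_mult. pose proof (cser_tail_le b lb B q (n - i) ltac:(lra) Hb Hlb) as Ht.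
      eapply Rle_trans; [apply Rmult_le_compat; [apply Cmod_ge_0|apply Cmod_ge_0|apply Ha|exact Ht]|].
      replace (q ^ n)%R with (q ^ i * q ^ (n - i))%R by (rewrite <- pow_add; f_equal; lia).
      assert (Hi2 : (/ (1 - q) <= 2)%R).
      { rewrite <- (Rinv_inv 2). apply Rinv_le_contravar; lra. }
      assert (Hp : (0 <= A * q ^ i * (B * q ^ (n - i)))%R)
        by (apply Rmult_le_pos; apply Rmult_le_pos; try assumption; apply pow_le; lra).
      unfold Rdiv.
      replace (A * q ^ i * (B * q ^ (n - i) * / (1 - q)))%R with ((A * q ^ i * (B * q ^ (n - i))) * / (1 - q))%R by ring.
      replace (A * B * 2 * (q ^ i * q ^ (n - i)))%R with ((A * q ^ i * (B * q ^ (n - i))) * 2)%R by ring.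
      apply Rmult_le_compat_l; assumption.
    - replace (INR n * (A * B * 2 * q ^ n))%R with (A * B * 2 * (INR n * q ^ n))%R by ring.
      apply Rmult_le_compat_l; [repeat apply Rmult_le_pos; lra|].
      apply Rle_trans with (2 ^ n * (/ 4) ^ n)%R.
      + apply Rmult_le_compat; [apply pos_INR|apply pow_le; lra| |apply pow_incr; lra].
        eapply Rle_trans; [|apply INR_S_le_pow2]. rewrite S_INR; lra.
      + rewrite <- Rpow_mult_distr. right. f_equal. lra. }
  intros eps He.
  pose proof (cser_scal lb _ _ Hla) as Hs.
  destruct (Hs (eps / 2)%R) as [N HN]; [lra|].
  assert (HAB : (0 <= A * B * 2)%R) by (repeat apply Rmult_le_pos; lra).
  destruct (pow_small (/ 2) ltac:(lra) (eps / 2 / (A * B * 2 + 1))%R) as [N' HN'].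
  { apply Rdiv_lt_0_compat; lra. }
  exists (N + N')%nat. intros n Hn.
  replace (csum (conv a b) n - la * lb) with ((csum (fun i => lb * a i) n - lb * la) + - (csum a n * lb - csum (conv a b) n)).
  2:{ rewrite csum_scal. ring. }
  eapply Rle_lt_trans; [apply Cmod_triangle|]. rewrite Cmod_opp.
  specialize (HN n ltac:(lia)). specialize (HN' n ltac:(lia)). specialize (Hdiff n).
  assert (A * B * 2 * (/ 2) ^ n <= eps / 2)%R; [|lra].
  apply Rle_trans with ((A * B * 2) * (eps / 2 / (A * B * 2 + 1)))%R; [apply Rmult_le_compat_l; lra|].
  apply Rmult_le_reg_r with (A * B * 2 + 1)%R; [lra|].
  replace (A * B * 2 * (eps / 2 / (A * B * 2 + 1)) * (A * B * 2 + 1))%R with (A * B * 2 * (eps / 2))%R by (field; lra).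
  nra.
Qed.

(* The expansion is only asserted off the origin, because the functions of
   interest are quotients taking a junk value there. *)
Definition is_ps (h : nat -> C) (H : C -> C) : Prop :=
  exists r A : R, (0 < r)%R /\ (forall i, (Cmod (h i) * r ^ i <= A)%R) /\
    forall t : C, (0 < Cmod t < r)%R -> cser (fun i => h i * t ^ i) (H t).

Lemma cser_terms_bounded a l : cser a l -> exists A, forall i, (Cmod (a i) <= A)%R.
Proof.
  intros H. destruct (H 1%R Rlt_0_1) as [N HN].
  assert (Hfin : forall M, exists A, forall i, (i < M)%nat -> (Cmod (a i) <= A)%R).
  { induction M as [|M [A HA]]; [exists 0%R; intros; lia|].
    exists (Rmax A (Cmod (a M))). intros i Hi. destruct (Nat.eq_dec i M) as [->|Hne]; [apply Rmax_r|].
    eapply Rle_trans; [apply HA; lia|apply Rmax_l]. }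
  destruct (Hfin N) as [A HA]. exists (Rmax A 2). intros i.
  destruct (Nat.lt_ge_cases i N) as [Hi|Hi].
  - eapply Rle_trans; [apply HA, Hi|apply Rmax_l].
  - eapply Rle_trans; [|apply Rmax_r].
    replace (a i) with ((csum a (S i) - l) + - (csum a i - l)) by (simpl; ring).
    eapply Rle_trans; [apply Cmod_triangle|]. rewrite Cmod_opp.
    pose proof (HN i Hi). pose proof (HN (S i) ltac:(lia)). lra.
Qed.

(** The coefficient bound required by [is_ps] follows from convergence alone: the terms at the real
    point [r/2] are bounded. *)
Lemma is_ps_intro (h : nat -> C) (H : C -> C) (r : R) : (0 < r)%R ->
  (forall t : C, (0 < Cmod t < r)%R -> cser (fun i => h i * t ^ i) (H t)) -> is_ps h H.
Proof.
  intros Hr Hs.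
  assert (Hr2 : Cmod (RtoC (r / 2)) = (r / 2)%R) by (rewrite Cmod_R, Rabs_pos_eq; lra).
  destruct (cser_terms_bounded _ _ (Hs (RtoC (r / 2)) ltac:(rewrite Hr2; lra))) as [A HA].
  exists (r / 2)%R, A. repeat split; [lra| |].
  - intros i. specialize (HA i). rewrite Cmod_mult, Cmod_pow, Hr2 in HA. exact HA.
  - intros t Ht. apply Hs. lra.
Qed.

Lemma pow_bound_mono (h : nat -> C) (r r' A : R) : (0 < r' <= r)%R ->
  (forall i, (Cmod (h i) * r ^ i <= A)%R) -> forall i, (Cmod (h i) * r' ^ i <= A)%R.
Proof.
  intros Hr H i. eapply Rle_trans; [|apply H]. apply Rmult_le_compat_l; [apply Cmod_ge_0|].
  apply pow_incr. lra.
Qed.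

Lemma ps_term_le (h : nat -> C) (r A : R) (t : C) : (0 < r)%R ->
  (forall i, (Cmod (h i) * r ^ i <= A)%R) ->
  forall i, (Cmod (h i * t ^ i)%C <= A * (Cmod t / r) ^ i)%R.
Proof.
  intros Hr H i. rewrite Cmod_mult, Cmod_pow. unfold Rdiv. rewrite Rpow_mult_distr, pow_inv.
  assert (0 < r ^ i)%R by (apply pow_lt; lra).
  replace (Cmod (h i) * Cmod t ^ i)%R with ((Cmod (h i) * r ^ i) * (Cmod t ^ i * / r ^ i))%R by (field; lra).
  apply Rmult_le_compat_r; [|apply H].
  apply Rmult_le_pos; [apply pow_le, Cmod_ge_0|left; apply Rinv_0_lt_compat; lra].
Qed.

(** Restricting to half the radius makes the geometric ratio at most [1/2], whence the factor 2 in
    the constant. *)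
Lemma ps_remainder h H n : is_ps h H ->
  exists K d : R, (0 < d)%R /\ (0 <= K)%R /\ forall t : C, (0 < Cmod t < d)%R ->
    (Cmod (H t - csum (fun i => h i * t ^ i)%C n) <= K * Cmod t ^ n)%R.
Proof.
  intros (r & A & Hr & HA & Hs).
  assert (HA0 : (0 <= A)%R) by (pose proof (HA O) as H0; simpl in H0; pose proof (Cmod_ge_0 (h O)); lra).
  exists (A * 2 * / r ^ n)%R, (r / 2)%R.
  assert (Hrn : (0 < r ^ n)%R) by (apply pow_lt; lra).
  assert (0 < / r ^ n)%R by (apply Rinv_0_lt_compat; lra).
  repeat split; [lra|repeat apply Rmult_le_pos; lra|]. intros t Ht.
  assert (Hq : (0 <= Cmod t / r <= / 2)%R).
  { split; [apply Rdiv_le_0_compat; lra|]. apply Rmult_le_reg_r with r; [lra|].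
    unfold Rdiv. rewrite Rmult_assoc, Rinv_l by lra. lra. }
  eapply Rle_trans; [apply (cser_tail_le _ _ A (Cmod t / r)); [lra| |apply Hs; lra]|].
  - apply ps_term_le; assumption.
  - unfold Rdiv at 2. rewrite Rpow_mult_distr, pow_inv.
    assert (Hi2 : (/ (1 - Cmod t / r) <= 2)%R).
    { rewrite <- (Rinv_inv 2). apply Rinv_le_contravar; lra. }
    assert (0 <= A * (Cmod t ^ n * / r ^ n))%R.
    { apply Rmult_le_pos; [lra|]. apply Rmult_le_pos; [apply pow_le|]; lra. }
    unfold Rdiv at 1.
    replace (A * 2 * / r ^ n * Cmod t ^ n)%R with ((A * (Cmod t ^ n * / r ^ n)) * 2)%R by ring.
    apply Rmult_le_compat_l; assumption.
Qed.

Lemma is_ps_ext h g H : (forall i, h i = g i) -> is_ps h H -> is_ps g H.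
Proof.
  intros E (r & A & Hr & HA & Hs). exists r, A. repeat split; auto.
  - intros i. rewrite <- E. apply HA.
  - intros t Ht. eapply cser_ext; [|apply Hs, Ht]. intros i. cbv beta. rewrite E. reflexivity.
Qed.

Lemma is_ps_ext_near h (H G : C -> C) (d : R) : (0 < d)%R ->
  (forall t : C, (0 < Cmod t < d)%R -> H t = G t) -> is_ps h H -> is_ps h G.
Proof.
  intros Hd E (r & A & Hr & HA & Hs). apply (is_ps_intro h G (Rmin d r)).
  - apply Rmin_pos; lra.
  - intros t Ht. pose proof (Rmin_l d r). pose proof (Rmin_r d r). rewrite <- E by lra. apply Hs. lra.
Qed.

Lemma is_ps_plus h g H G : is_ps h H -> is_ps g G -> is_ps (fun i => h i + g i) (fun t => H t + G t).
Proof.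
  intros (r & A & Hr & HA & Hs) (r' & A' & Hr' & HA' & Hs').
  apply (is_ps_intro _ _ (Rmin r r')); [apply Rmin_pos; lra|]. intros t Ht.
  pose proof (Rmin_l r r'). pose proof (Rmin_r r r').
  eapply cser_ext; [|apply cser_plus; [apply Hs|apply Hs']; lra]. intros i. cbv beta. ring.
Qed.

Lemma is_ps_scal c h H : is_ps h H -> is_ps (fun i => c * h i) (fun t => c * H t).
Proof.
  intros (r & A & Hr & HA & Hs).
  apply (is_ps_intro _ _ r); [lra|]. intros t Ht.
  eapply cser_ext; [|apply cser_scal, Hs, Ht]. intros i. cbv beta. ring.
Qed.

Lemma is_ps_minus h g H G : is_ps h H -> is_ps g G -> is_ps (fun i => h i - g i) (fun t => H t - G t).
Proof.
  intros Hh Hg. apply (is_ps_ext (fun i => h i + (-(1)) * g i)); [intros; ring|].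
  apply (is_ps_ext_near _ (fun t => H t + (-(1)) * G t) _ 1); [lra|intros; ring|].
  apply is_ps_plus; [exact Hh|apply is_ps_scal, Hg].
Qed.

Lemma is_ps_zero : is_ps (fun _ => 0) (fun _ => 0).
Proof.
  apply (is_ps_intro _ _ 1); [lra|]. intros t _ eps He. exists O. intros n _.
  rewrite csum_zero by (intros; ring). replace (0 - 0) with (RtoC 0) by ring. rewrite Cmod_0. exact He.
Qed.

Lemma is_ps_csum (h : nat -> nat -> C) (H : nat -> C -> C) n :
  (forall k, (k < n)%nat -> is_ps (h k) (H k)) ->
  is_ps (fun i => csum (fun k => h k i) n) (fun t => csum (fun k => H k t) n).
Proof.
  induction n as [|n IH]; intros Hk; simpl; [apply is_ps_zero|].
  apply is_ps_plus; [apply IH; intros; apply Hk; lia|apply Hk; lia].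
Qed.

Lemma is_ps_mult h g H G : is_ps h H -> is_ps g G -> is_ps (conv h g) (fun t => H t * G t).
Proof.
  intros (r & A & Hr & HA & Hs) (r' & A' & Hr' & HA' & Hs').
  set (R0 := Rmin r r'). assert (HR : (0 < R0)%R) by (apply Rmin_pos; lra).
  pose proof (Rmin_l r r'). pose proof (Rmin_r r r').
  (* A quarter of the common radius, to meet the ratio [1/4] demanded by [cser_mult]. *)
  apply (is_ps_intro _ _ (R0 / 4)); [lra|]. intros t Ht.
  assert (Hq : (0 <= Cmod t / R0 <= / 4)%R).
  { split; [apply Rdiv_le_0_compat; lra|]. apply Rmult_le_reg_r with R0; [lra|].
    unfold Rdiv. rewrite Rmult_assoc, Rinv_l by lra. lra. }
  eapply cser_ext; [|apply (cser_mult (fun i => h i * t ^ i) (fun i => g i * t ^ i) _ _ A A' (Cmod t / R0) Hq)].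
  - intros k. unfold conv. rewrite <- csum_scal_r. apply csum_ext. intros i Hi.
    replace (t ^ k) with (t ^ i * t ^ (k - i)) by (rewrite <- Cpow_add_r; f_equal; lia). ring.
  - apply ps_term_le; [lra|]. apply (pow_bound_mono _ r); [unfold R0 in *; lra|exact HA].
  - apply ps_term_le; [lra|]. apply (pow_bound_mono _ r'); [unfold R0 in *; lra|exact HA'].
  - apply Hs. unfold R0 in *; lra.
  - apply Hs'. unfold R0 in *; lra.
Qed.

Lemma is_ps_exp c : is_ps (fun i => c ^ i / INR (fact i)) (fun t => Cexp (c * t)).
Proof.
  apply (is_ps_intro _ _ 1); [lra|]. intros t Ht eps He.
  set (M := (Cmod (c * t))).
  assert (Hl : exists N, forall n, (N <= n)%nat -> (M ^ n / INR (fact n) < eps / exp M)%R).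
  { destruct (cv_speed_pow_fact M (eps / exp M)%R) as [N HN].
    { apply Rdiv_lt_0_compat; [exact He|apply exp_pos]. }
    exists N. intros n Hn. specialize (HN n Hn). unfold Rdist in HN. rewrite Rminus_0_r in HN.
    eapply Rle_lt_trans; [apply Rle_abs|exact HN]. }
  destruct Hl as [N HN]. exists N. intros n Hn. specialize (HN n Hn).
  rewrite <- Cmod_opp.
  replace (- (csum (fun i => c ^ i / INR (fact i) * t ^ i) n - Cexp (c * t)))
    with (Cexp (c * t) - exp_taylor (c * t) n).
  2:{ unfold exp_taylor. rewrite (csum_ext (fun i => (c * t) ^ i / INR (fact i)) (fun i => c ^ i / INR (fact i) * t ^ i)); [ring|].
      intros. rewrite Cpow_mult_l. field. apply INR_fact_C_neq_0. }
  eapply Rle_lt_trans; [apply Cexp_taylor_le|]. fold M.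
  apply Rle_lt_trans with (M ^ n / INR (fact n) * exp M)%R.
  - apply Rmult_le_compat_l; [apply Rdiv_le_0_compat; [apply pow_le, Cmod_ge_0|apply INR_fact_lt_0]|].
    apply exp_le, re_le_Cmod.
  - pose proof (exp_pos M). replace eps with (eps / exp M * exp M)%R by (field; lra).
    apply Rmult_lt_compat_r; lra.
Qed.

(** Strong induction: once the lower coefficients vanish, the remainder bound of order [i + 1]
    divided by [t^i] gives [|h i| <= K t] for all small [t > 0]. *)
Lemma ps_zero_coeffs h : is_ps h (fun _ => 0) -> forall i, h i = 0.
Proof.
  intros Hps. induction i as [i IH] using lt_wf_ind.
  destruct (ps_remainder h _ (S i) Hps) as (K & e & He & HK & Hb).
  apply Cmod_eq_0. apply Rle_antisym; [|apply Cmod_ge_0].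
  apply le_epsilon. intros eps Heps.
  set (t := Rmin (e / 2) (eps / (K + 1))).
  assert (Ht : (0 < t)%R) by (apply Rmin_pos; [lra|apply Rdiv_lt_0_compat; lra]).
  assert (Ht1 : (t <= e / 2)%R) by apply Rmin_l. assert (Ht2 : (t <= eps / (K + 1))%R) by apply Rmin_r.
  assert (Hct : Cmod (RtoC t) = t) by (rewrite Cmod_R, Rabs_pos_eq; lra).
  specialize (Hb (RtoC t) ltac:(rewrite Hct; lra)). rewrite Hct in Hb.
  cbn [csum] in Hb. rewrite csum_zero in Hb by (intros j Hj; rewrite IH by exact Hj; ring).
  replace (0 - (0 + h i * RtoC t ^ i)) with (- (h i * RtoC t ^ i)) in Hb by ring.
  rewrite Cmod_opp, Cmod_mult, Cmod_pow, Hct in Hb. simpl in Hb.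
  assert (Hti : (0 < t ^ i)%R) by (apply pow_lt; lra).
  assert (H1 : (Cmod (h i) <= K * t)%R).
  { apply Rmult_le_reg_r with (t ^ i)%R; [exact Hti|]. eapply Rle_trans; [exact Hb|]. right; ring. }
  rewrite Rplus_0_l. eapply Rle_trans; [exact H1|].
  apply Rle_trans with (K * (eps / (K + 1)))%R; [apply Rmult_le_compat_l; lra|].
  apply Rmult_le_reg_r with (K + 1)%R; [lra|].
  replace (K * (eps / (K + 1)) * (K + 1))%R with (K * eps)%R by (field; lra). nra.
Qed.

Lemma ps_unique h g H G (d : R) : (0 < d)%R ->
  (forall t : C, (0 < Cmod t < d)%R -> H t = G t) -> is_ps h H -> is_ps g G ->
  forall i, h i = g i.
Proof.
  intros Hd E Hh Hg i.
  assert (H0 : is_ps (fun i => h i - g i) (fun _ => 0)).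
  { apply (is_ps_ext_near _ (fun t => H t - G t) _ d Hd).
    - intros t Ht. rewrite E by exact Ht. ring.
    - apply is_ps_minus; assumption. }
  pose proof (ps_zero_coeffs _ H0 i) as Hi. cbv beta in Hi.
  replace (h i) with ((h i - g i) + g i) by ring. rewrite Hi. ring.
Qed.

(** * Division of power series *)

Section Quotient.

Variables (nu e : nat -> C).

(** Course-of-values recursion made structural: stage [n] carries the first [n] quotient
    coefficients, and the next one is solved from the convolution equation. *)
Fixpoint quotient_prefix (n : nat) : nat -> C :=
  match n with
  | O => fun _ => 0
  | S k => fun i => if Nat.eqb i k
      then (nu k - csum (fun j => quotient_prefix k j * e (k - j)%nat) k) / e O
      else quotient_prefix k i
  end.

Definition quotient_coeff (i : nat) : C := quotient_prefix (S i) i.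

Lemma quotient_prefix_eq n i : (i < n)%nat -> quotient_prefix n i = quotient_coeff i.
Proof.
  induction n as [|n IH]; [lia|]. intros Hi. destruct (Nat.eq_dec i n) as [->|Hne]; [reflexivity|].
  cbn [quotient_prefix]. rewrite (proj2 (Nat.eqb_neq i n) Hne). apply IH. lia.
Qed.

Lemma quotient_coeff_eq k :
  quotient_coeff k = (nu k - csum (fun j => quotient_coeff j * e (k - j)%nat) k) / e O.
Proof.
  unfold quotient_coeff at 1. cbn [quotient_prefix]. rewrite Nat.eqb_refl.
  rewrite (csum_ext (fun j => quotient_prefix k j * e (k - j)%nat) (fun j => quotient_coeff j * e (k - j)%nat)); [reflexivity|].
  intros j Hj. rewrite quotient_prefix_eq by exact Hj. reflexivity.
Qed.

Lemma quotient_conv k : e O <> 0 -> conv quotient_coeff e k = nu k.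
Proof.
  intros He. unfold conv. cbn [csum]. rewrite Nat.sub_diag. rewrite (quotient_coeff_eq k) at 1.
  field. exact He.
Qed.

(** With [rho = s (1 + al)] one has [rho - s = al s], so [al] times the sum of [s^(k-j) rho^j] over
    [j < k] telescopes to [rho^k - s^k]. The term [- s^k] cancels the contribution of [nu k], and
    the bound reproduces itself. *)
Lemma quotient_coeff_le (al s : R) : e O <> 0 -> (0 <= al)%R -> (0 < s)%R ->
  (forall i, (Cmod (nu i) <= al * Cmod (e O) * s ^ i)%R) ->
  (forall i, (Cmod (e i) <= al * Cmod (e O) * s ^ i)%R) ->
  forall i, (Cmod (quotient_coeff i) <= al * (s * (1 + al)) ^ i)%R.
Proof.
  intros He Hal Hs Hnu Hee. set (rho := (s * (1 + al))%R).
  apply Cmod_gt_0 in He.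
  assert (Hsum : forall k, RtoC al * csum (fun j => RtoC (s ^ (k - j) * rho ^ j)) k = RtoC (rho ^ k - s ^ k)).
  { induction k as [|k IH]; [simpl; rewrite Rminus_diag; ring|].
    cbn [csum].
    rewrite (csum_ext (fun j => RtoC (s ^ (S k - j) * rho ^ j)) (fun j => RtoC s * RtoC (s ^ (k - j) * rho ^ j))).
    - rewrite csum_scal. replace (S k - k)%nat with 1%nat by lia.
      replace (RtoC al * (RtoC s * csum (fun j => RtoC (s ^ (k - j) * rho ^ j)) k + RtoC (s ^ 1 * rho ^ k)))
        with (RtoC s * (RtoC al * csum (fun j => RtoC (s ^ (k - j) * rho ^ j)) k) + RtoC al * RtoC (s ^ 1 * rho ^ k)) by ring.
      rewrite IH, <- !RtoC_mult, <- RtoC_plus. f_equal. unfold rho at 3. simpl.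
      unfold rho. ring.
    - intros j Hj. rewrite <- RtoC_mult. f_equal. replace (S k - j)%nat with (S (k - j)) by lia. simpl. ring. }
  induction i as [i IH] using lt_wf_ind.
  rewrite quotient_coeff_eq, Cmod_div by (apply Cmod_gt_0; exact He).
  apply Rmult_le_reg_r with (Cmod (e O)); [exact He|].
  unfold Rdiv. rewrite Rmult_assoc, Rinv_l, Rmult_1_r by lra.
  eapply Rle_trans; [apply Cmod_triangle|]. rewrite Cmod_opp.
  assert (Hc : (Cmod (csum (fun j => quotient_coeff j * e (i - j)%nat)%C i)
     <= Re (csum (fun j => RtoC (al * rho ^ j * (al * Cmod (e O) * s ^ (i - j)))) i))%R).
  { apply Cmod_csum_le. intros j Hj. rewrite Cmod_mult.
    apply Rmult_le_compat; try apply Cmod_ge_0; [apply IH, Hj|apply Hee]. }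
  rewrite (csum_ext (fun j => RtoC (al * rho ^ j * (al * Cmod (e O) * s ^ (i - j)))) (fun j => RtoC (al * Cmod (e O)) * (RtoC al * RtoC (s ^ (i - j) * rho ^ j)))) in Hc.
  2:{ intros j _. rewrite <- !RtoC_mult. f_equal. ring. }
  rewrite !csum_scal, Hsum, <- RtoC_mult in Hc. simpl in Hc.
  specialize (Hnu i). nra.
Qed.

End Quotient.

Lemma is_ps_near_nonzero e E : is_ps e E -> e O <> 0 ->
  exists d : R, (0 < d)%R /\ forall t : C, (0 < Cmod t < d)%R -> E t <> 0.
Proof.
  intros H He. apply Cmod_gt_0 in He. destruct (ps_remainder e E 1 H) as (K & d & Hd & HK & Hb).
  exists (Rmin d (Cmod (e O) / (K + 1))). split; [apply Rmin_pos; [lra|apply Rdiv_lt_0_compat; lra]|].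
  intros t Ht HE. pose proof (Rmin_l d (Cmod (e O) / (K + 1))). pose proof (Rmin_r d (Cmod (e O) / (K + 1))).
  specialize (Hb t ltac:(lra)). rewrite HE in Hb. simpl in Hb.
  replace (0 - (0 + e O * 1)) with (- e O) in Hb by ring. rewrite Cmod_opp in Hb.
  assert ((K + 1) * Cmod t < Cmod (e O))%R; [|lra].
  replace (Cmod (e O)) with ((K + 1) * (Cmod (e O) / (K + 1)))%R by (field; lra).
  apply Rmult_lt_compat_l; lra.
Qed.

(** The coefficient bound makes the formal quotient converge to some [Q]. The Cauchy product [Q E]
    has the coefficients of [N], so [Q E = N] near 0, and division is legitimate where [E] does not
    vanish. *)
Lemma is_ps_div nu e N E : is_ps nu N -> is_ps e E -> e O <> 0 ->
  is_ps (quotient_coeff nu e) (fun t => N t / E t).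
Proof.
  intros HN HE He0. destruct (is_ps_near_nonzero e E HE He0) as (d & Hd & Hnz).
  pose proof HN as (r & A & Hr & HA & Hs). pose proof HE as (r' & A' & Hr' & HA' & Hs').
  assert (He : (0 < Cmod (e O))%R) by (apply Cmod_gt_0, He0).
  set (R0 := Rmin r r'). assert (HR : (0 < R0)%R) by (apply Rmin_pos; lra).
  assert (HR1 : (R0 <= r)%R) by apply Rmin_l. assert (HR2 : (R0 <= r')%R) by apply Rmin_r.
  set (B := Rmax A A').
  assert (HB : (0 <= B)%R).
  { pose proof (HA O) as H0; simpl in H0; pose proof (Cmod_ge_0 (nu O)). pose proof (Rmax_l A A'). unfold B. lra. }
  (* [al] and [s] put the bounds for both numerator and denominator in the single form that
     [quotient_coeff_le] expects, normalised by the leading coefficient. *)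
  set (al := (B / Cmod (e O))%R). assert (Hal : (0 <= al)%R) by (apply Rdiv_le_0_compat; lra).
  set (s := (/ R0)%R). assert (Hsp : (0 < s)%R) by (apply Rinv_0_lt_compat; lra).
  assert (Hpow : forall (f : nat -> C) A0, (A0 <= B)%R -> (forall i, (Cmod (f i) * R0 ^ i <= A0)%R) ->
     forall i, (Cmod (f i) <= al * Cmod (e O) * s ^ i)%R).
  { intros f A0 HA0 Hf i. unfold al, s. rewrite pow_inv. assert (0 < R0 ^ i)%R by (apply pow_lt; lra).
    replace (B / Cmod (e O) * Cmod (e O) * / R0 ^ i)%R with (B * / R0 ^ i)%R by (field; lra).
    apply Rmult_le_reg_r with (R0 ^ i)%R; [lra|]. rewrite Rmult_assoc, Rinv_l, Rmult_1_r by lra.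
    eapply Rle_trans; [apply Hf|exact HA0]. }
  assert (Hq : forall i, (Cmod (quotient_coeff nu e i) <= al * (s * (1 + al)) ^ i)%R).
  { apply quotient_coeff_le; try assumption.
    - apply (Hpow nu A); [apply Rmax_l|]. apply (pow_bound_mono _ r); [lra|exact HA].
    - apply (Hpow e A'); [apply Rmax_r|]. apply (pow_bound_mono _ r'); [lra|exact HA']. }
  set (rho := (s * (1 + al))%R) in *. assert (Hrho : (0 < rho)%R) by (apply Rmult_lt_0_compat; lra).
  assert (Hex : forall t : C, (Cmod t < / rho)%R -> exists l, cser (fun i => quotient_coeff nu e i * t ^ i) l).
  { intros t Ht. apply (cser_geometric_ex _ al (rho * Cmod t)).
    - split; [apply Rmult_le_pos; [lra|apply Cmod_ge_0]|].
      apply Rmult_lt_compat_l with (r := rho) in Ht; [|lra]. rewrite Rinv_r in Ht by lra. exact Ht.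
    - intros i. rewrite Cmod_mult, Cmod_pow, Rpow_mult_distr, <- Rmult_assoc.
      apply Rmult_le_compat_r; [apply pow_le, Cmod_ge_0|apply Hq]. }
  set (Q := fun t => epsilon (inhabits (RtoC 0)) (fun l => cser (fun i => quotient_coeff nu e i * t ^ i) l)).
  assert (Hrho' : (0 < / rho)%R) by (apply Rinv_0_lt_compat; lra).
  assert (HQ : is_ps (quotient_coeff nu e) Q).
  { apply (is_ps_intro _ _ (/ rho)); [exact Hrho'|]. intros t Ht. unfold Q.
    apply epsilon_spec, Hex. lra. }
  pose proof (is_ps_mult _ _ _ _ HQ HE) as HM.
  apply (is_ps_ext _ nu) in HM; [|intros i; apply quotient_conv, He0].
  destruct HM as (r2 & A2 & Hr2 & _ & Hs2).
  apply (is_ps_ext_near _ Q _ (Rmin d (Rmin r r2))); [|  |exact HQ].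
  - repeat apply Rmin_pos; lra.
  - intros t Ht. pose proof (Rmin_l d (Rmin r r2)). pose proof (Rmin_r d (Rmin r r2)).
    pose proof (Rmin_l r r2). pose proof (Rmin_r r r2).
    rewrite (cser_unique _ _ _ (Hs t ltac:(lra)) (Hs2 t ltac:(lra))). field. apply Hnz. lra.
Qed.

(** * Asymptotic expansions in powers and logarithms *)

Definition czero (u : nat -> C) : Prop :=
  forall eps : R, (0 < eps)%R -> exists N, forall n, (N <= n)%nat -> (Cmod (u n) < eps)%R.

Lemma filterlim_czero (u : nat -> C) :
  filterlim u eventually (locally (T := C_R_NormedModule) (RtoC 0)) <-> czero u.
Proof.
  assert (E0 : forall z : C, z - 0 = z) by (intros; ring).
  split.
  - intros H eps He.
    assert (He' : (0 < eps / sqrt 2)%R) by (apply Rdiv_lt_0_compat; [lra|apply Rlt_sqrt2_0]).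
    destruct (H (fun y : C => (Cmod y < eps)%R)) as [N HN].
    { exists (mkposreal _ He'). intros y Hy.
      apply C_NormedModule_mixin_compat2 in Hy. simpl in Hy.
      replace (sqrt 2 * (eps / sqrt 2))%R with eps in Hy by (field; apply sqrt2_neq_0).
      change (Cmod (y - 0) < eps)%R in Hy. rewrite E0 in Hy. exact Hy. }
    exists N. exact HN.
  - intros H P [eps HP]. destruct (H eps (cond_pos eps)) as [N HN].
    exists N. intros n Hn. apply HP. apply C_NormedModule_mixin_compat1.
    change (Cmod (u n - 0) < eps)%R. rewrite E0. apply HN, Hn.
Qed.

Lemma czero_ext (u v : nat -> C) : (forall n, (1 <= n)%nat -> u n = v n) -> czero u -> czero v.
Proof.
  intros E H eps He. destruct (H eps He) as [N HN]. exists (S N). intros n Hn.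
  rewrite <- E by lia. apply HN. lia.
Qed.

Lemma czero_plus u v : czero u -> czero v -> czero (fun n => u n + v n).
Proof.
  intros Hu Hv eps He. destruct (Hu (eps / 2)%R) as [N HN]; [lra|].
  destruct (Hv (eps / 2)%R) as [N' HN']; [lra|].
  exists (N + N')%nat. intros n Hn. eapply Rle_lt_trans; [apply Cmod_triangle|].
  specialize (HN n ltac:(lia)). specialize (HN' n ltac:(lia)). lra.
Qed.

Lemma czero_bounded_mult (u v : nat -> C) (M : R) :
  (forall n, (1 <= n)%nat -> (Cmod (v n) <= M)%R) -> czero u -> czero (fun n => v n * u n).
Proof.
  intros Hv Hu eps He.
  assert (HM : (0 <= M)%R) by (pose proof (Hv 1%nat (le_n 1)); pose proof (Cmod_ge_0 (v 1%nat)); lra).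
  destruct (Hu (eps / (M + 1))%R) as [N HN]; [apply Rdiv_lt_0_compat; lra|].
  exists (S N). intros n Hn. rewrite Cmod_mult. specialize (HN n ltac:(lia)). specialize (Hv n ltac:(lia)).
  apply Rle_lt_trans with (M * (eps / (M + 1)))%R.
  - apply Rmult_le_compat; try apply Cmod_ge_0; lra.
  - apply Rmult_lt_reg_r with (M + 1)%R; [lra|].
    replace (M * (eps / (M + 1)) * (M + 1))%R with (M * eps)%R by (field; lra). nra.
Qed.

Lemma czero_scal c u : czero u -> czero (fun n => c * u n).
Proof. intros H. apply (czero_bounded_mult u (fun _ => c) (Cmod c)); [intros; lra|exact H]. Qed.

Lemma czero_const c : czero (fun _ => c) -> c = 0.
Proof.
  intros H. apply Cmod_eq_0, Rle_antisym; [|apply Cmod_ge_0]. apply le_epsilon. intros eps He.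
  destruct (H eps He) as [N HN]. specialize (HN N (le_n N)). lra.
Qed.

Lemma INR_ge_1 n : (1 <= n)%nat -> (1 <= INR n)%R.
Proof. intros H. change 1%R with (INR 1). apply le_INR, H. Qed.

Lemma INR_C_neq_0 n : (1 <= n)%nat -> RtoC (INR n) <> 0.
Proof. intros H. apply RtoC_neq_0. pose proof (INR_ge_1 n H). lra. Qed.

Lemma czero_inv (K : R) (u : nat -> C) :
  (forall n, (1 <= n)%nat -> (Cmod (u n) <= K / INR n)%R) -> czero u.
Proof.
  intros H eps He. destruct (INR_unbounded (Rabs K / eps)) as [N HN].
  exists (S N). intros n Hn. eapply Rle_lt_trans; [apply H; lia|].
  assert (h : (INR N <= INR n)%R) by (apply le_INR; lia). pose proof (INR_ge_1 n ltac:(lia)).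
  apply Rmult_lt_reg_r with (INR n); [lra|]. unfold Rdiv. rewrite Rmult_assoc, Rinv_l, Rmult_1_r by lra.
  apply Rle_lt_trans with (Rabs K); [apply Rle_abs|].
  replace (Rabs K) with (eps * (Rabs K / eps))%R by (field; lra).
  apply Rmult_lt_compat_l; lra.
Qed.

(** From [ln x = 2 ln (sqrt x)] and [ln y < y]; it is enough for [ln s / s] to tend to 0. *)
Lemma ln_le_sqrt (x : R) : (1 <= x)%R -> (0 <= ln x <= 2 * sqrt x)%R.
Proof.
  intros Hx. split.
  - rewrite <- ln_1. destruct Hx as [Hx|Hx]; [left; apply ln_increasing; lra|rewrite <- Hx; lra].
  - assert (Hs : (0 < sqrt x)%R) by (apply sqrt_lt_R0; lra).
    rewrite <- (sqrt_sqrt x) at 1 by lra. rewrite ln_mult by assumption.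
    pose proof (exp_ineq1 (ln (sqrt x))). 
    assert (ln (sqrt x) < sqrt x)%R; [|lra].
    destruct (Req_dec (ln (sqrt x)) 0) as [E|E]; [lra|].
    pose proof (H E) as H1. rewrite exp_ln in H1 by exact Hs. lra.
Qed.

Lemma czero_ln_div : czero (fun n => RtoC (ln (INR n)) / INR n).
Proof.
  intros eps He. destruct (INR_unbounded ((2 / eps) ^ 2)) as [N HN].
  exists (S N). intros n Hn.
  assert (h : (INR N <= INR n)%R) by (apply le_INR; lia). pose proof (INR_ge_1 n ltac:(lia)) as H1.
  rewrite <- RtoC_div by lra. rewrite Cmod_R.
  destruct (ln_le_sqrt (INR n) H1) as [H2 H3].
  assert (Hs : (0 < sqrt (INR n))%R) by (apply sqrt_lt_R0; lra).
  assert (He2 : (0 < 2 / eps)%R) by (apply Rdiv_lt_0_compat; lra).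
  rewrite Rabs_pos_eq by (apply Rdiv_le_0_compat; lra).
  apply Rle_lt_trans with (2 * sqrt (INR n) / INR n)%R.
  { apply Rmult_le_compat_r; [left; apply Rinv_0_lt_compat; lra|exact H3]. }
  assert (E : (2 * sqrt (INR n) / INR n = 2 / sqrt (INR n))%R).
  { rewrite <- (sqrt_sqrt (INR n)) at 2 by lra. field. lra. }
  rewrite E.
  assert (Hlt : (2 / eps < sqrt (INR n))%R).
  { rewrite <- (sqrt_pow2 (2 / eps)) by lra. apply sqrt_lt_1_alt. split; [apply pow2_ge_0|lra]. }
  apply Rmult_lt_reg_r with (sqrt (INR n)); [exact Hs|]. unfold Rdiv at 1.
  rewrite Rmult_assoc, Rinv_l, Rmult_1_r by lra.
  replace 2%R with (eps * (2 / eps))%R by (field; lra). apply Rmult_lt_compat_l; lra.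
Qed.

Lemma log_poly_div_czero (al ga : nat -> C) d :
  czero (fun s => csum (fun j => (al j * ln (INR s) + ga j) * INR s ^ j) d / INR s ^ d).
Proof.
  induction d as [|d IH].
  - intros eps He. exists O. intros n _. simpl. replace (0 / 1) with (RtoC 0) by (field; apply RtoC_neq_0; lra).
    rewrite Cmod_0. exact He.
  - apply (czero_ext (fun s => / INR s * (csum (fun j => (al j * ln (INR s) + ga j) * INR s ^ j) d / INR s ^ d)
       + (al d * (RtoC (ln (INR s)) / INR s) + ga d * / INR s))).
    + intros n Hn. cbn [csum]. rewrite Cpow_S. pose proof (INR_C_neq_0 n Hn). field.
      split; [apply Cpow_nz|]; assumption.
    + assert (Hinv : forall n, (1 <= n)%nat -> Cmod (/ INR n) = (/ INR n)%R).
      { intros n Hn. pose proof (INR_ge_1 n Hn). rewrite Cmod_inv by (apply INR_C_neq_0, Hn).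
        rewrite Cmod_R, Rabs_pos_eq; lra. }
      apply czero_plus; [|apply czero_plus].
      * apply (czero_bounded_mult _ (fun n => / INR n) 1); [|exact IH].
        intros n Hn. rewrite Hinv by exact Hn. rewrite <- Rinv_1. pose proof (INR_ge_1 n Hn).
        apply Rinv_le_contravar; lra.
      * apply czero_scal, czero_ln_div.
      * apply czero_scal, (czero_inv 1). intros n Hn. rewrite Hinv by exact Hn. unfold Rdiv. lra.
Qed.

(** Comparing the values at [2s] and at [s] isolates [al ln 2], a constant tending to 0. *)
Lemma log_affine_czero (al ga : C) :
  czero (fun s => al * ln (INR s) + ga) -> al = 0 /\ ga = 0.
Proof.
  intros H.
  assert (Ha : al = 0).
  { assert (E : al * ln 2 = 0).
    { apply czero_const.
      apply (czero_ext (fun s => (al * ln (INR (2 * s)) + ga) + (-(1)) * (al * ln (INR s) + ga))).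
      - intros n Hn. rewrite mult_INR. pose proof (INR_ge_1 n Hn).
        rewrite ln_mult by (simpl; lra). rewrite RtoC_plus. simpl INR at 1.
        replace (1 + 1)%R with 2%R by ring. ring.
      - apply czero_plus; [|apply czero_scal, H].
        intros eps He. destruct (H eps He) as [N HN]. exists N. intros n Hn. apply HN. lia. }
    assert (Hln : RtoC (ln 2) <> 0) by (apply RtoC_neq_0; pose proof (ln_lt_2); lra).
    replace al with (al * ln 2 / ln 2) by (field; exact Hln). rewrite E. field. exact Hln. }
  split; [exact Ha|]. apply czero_const. apply (czero_ext (fun s => al * ln (INR s) + ga)); [|exact H].
  intros. rewrite Ha. ring.
Qed.

(** Descending on the degree: division by the top power of [s] sends the lower terms to 0, so the
    top pair of coefficients vanishes. Only the constant coefficient is kept in the conclusion. *)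
Lemma log_poly_czero (al ga : nat -> C) d :
  czero (fun s => csum (fun j => (al j * ln (INR s) + ga j) * INR s ^ j) (S d)) -> ga O = 0.
Proof.
  induction d as [|d IH]; intros H.
  - apply (log_affine_czero (al O) (ga O)). apply (czero_ext _ _) with (2 := H). intros. simpl. ring.
  - apply IH.
    assert (H2 : al (S d) = 0 /\ ga (S d) = 0).
    { apply log_affine_czero.
      apply (czero_ext (fun s => / INR s ^ S d * csum (fun j => (al j * ln (INR s) + ga j) * INR s ^ j) (S (S d))
        + (-(1)) * (csum (fun j => (al j * ln (INR s) + ga j) * INR s ^ j) (S d) / INR s ^ S d))).
      - intros n Hn. cbn [csum]. pose proof (INR_C_neq_0 n Hn). field. apply Cpow_nz. assumption.
      - apply czero_plus; [|apply czero_scal, log_poly_div_czero].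
        apply (czero_bounded_mult _ (fun s => / INR s ^ S d) 1); [|exact H].
        intros n Hn. pose proof (INR_ge_1 n Hn) as H1.
        rewrite Cmod_inv by (apply Cpow_nz, INR_C_neq_0, Hn).
        rewrite Cmod_pow, Cmod_R, Rabs_pos_eq by lra.
        rewrite <- Rinv_1. apply Rinv_le_contravar; [lra|]. apply pow_R1_Rle, H1. }
    destruct H2 as [Ha Hg].
    apply (czero_ext _ _) with (2 := H). intros n Hn. cbn [csum]. rewrite Ha, Hg. ring.
Qed.

Definition log_power_sum (a : nat -> C) (c : Z -> C) (J N s : nat) : C :=
  csum (fun j => a j * (INR s ^ j * ln (INR s))) (S J)
  + csum (fun i => c (Z.of_nat i - Z.of_nat N)%Z * Cpowz (INR s) (Z.of_nat i - Z.of_nat N)) (S (J + N)).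

(** The bound [J] is exposed as a parameter so that two expansions can be brought to a common one
    before being added. *)
Definition expansion (f : nat -> C) (a : nat -> C) (c : Z -> C) (J : nat) : Prop :=
  (forall j, (J < j)%nat -> a j = 0 /\ c (Z.of_nat j) = 0) /\
  forall N, czero (fun s => INR s ^ N * (f s - log_power_sum a c J N s)).

Lemma is_log_power_expansion_iff f a c :
  is_log_power_expansion f a c <-> exists J, expansion f a c J.
Proof.
  split; intros [J [H1 H2]]; exists J; (split; [exact H1|]); intros N; specialize (H2 N).
  - apply (proj1 (filterlim_czero _)) in H2. apply (czero_ext _ _) with (2 := H2). intros n _.
    rewrite !sum_n_csum. unfold log_power_sum. ring.
  - apply (proj2 (filterlim_czero _)). apply (czero_ext _ _) with (2 := H2). intros n _.
    rewrite !sum_n_csum. unfold log_power_sum. ring.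
Qed.

Lemma expansion_mono f a c J J' : (J <= J')%nat -> expansion f a c J -> expansion f a c J'.
Proof.
  intros HJ [H1 H2]. split; [intros; apply H1; lia|]. intros N.
  apply (czero_ext _ _) with (2 := H2 N). intros n _. do 2 f_equal. unfold log_power_sum. f_equal; symmetry.
  - apply csum_pad; [lia|]. intros j Hj. destruct (H1 j ltac:(lia)) as [E _]. rewrite E. ring.
  - apply csum_pad; [lia|]. intros i Hi. destruct (H1 (i - N)%nat ltac:(lia)) as [_ E].
    replace (Z.of_nat i - Z.of_nat N)%Z with (Z.of_nat (i - N)) by lia. rewrite E. ring.
Qed.

Lemma is_constant_term_ext f g S :
  (forall s, (1 <= s)%nat -> f s = g s) -> is_constant_term f S -> is_constant_term g S.
Proof.
  intros E (a & c & Ha & Hc). exists a, c. split; [|exact Hc].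
  apply is_log_power_expansion_iff in Ha. apply is_log_power_expansion_iff.
  destruct Ha as [J [H1 H2]]. exists J. split; [exact H1|]. intros N.
  apply (czero_ext _ _) with (2 := H2 N). intros n Hn. rewrite E by exact Hn. reflexivity.
Qed.

Lemma is_constant_term_plus f g S S' :
  is_constant_term f S -> is_constant_term g S' -> is_constant_term (fun s => f s + g s) (S + S').
Proof.
  intros (a & c & Ha & Hc) (a' & c' & Ha' & Hc').
  apply is_log_power_expansion_iff in Ha as [J HJ]. apply is_log_power_expansion_iff in Ha' as [J' HJ'].
  apply (expansion_mono _ _ _ _ (J + J')) in HJ; [|lia]. apply (expansion_mono _ _ _ _ (J + J')) in HJ'; [|lia].
  exists (fun j => a j + a' j), (fun z => c z + c' z). split; [|rewrite Hc, Hc'; reflexivity].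
  apply is_log_power_expansion_iff. exists (J + J')%nat. destruct HJ as [H1 H2], HJ' as [H1' H2']. split.
  - intros j Hj. destruct (H1 j Hj) as [-> ->], (H1' j Hj) as [-> ->]. split; ring.
  - intros N. apply (czero_ext _ _) with (2 := czero_plus _ _ (H2 N) (H2' N)). intros n _.
    unfold log_power_sum.
    rewrite (csum_ext (fun j => (a j + a' j) * (INR n ^ j * ln (INR n)))
      (fun j => a j * (INR n ^ j * ln (INR n)) + a' j * (INR n ^ j * ln (INR n)))) by (intros; ring).
    rewrite (csum_ext (fun i => (c (Z.of_nat i - Z.of_nat N)%Z + c' (Z.of_nat i - Z.of_nat N)%Z) * Cpowz (INR n) (Z.of_nat i - Z.of_nat N))
      (fun i => c (Z.of_nat i - Z.of_nat N)%Z * Cpowz (INR n) (Z.of_nat i - Z.of_nat N)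
        + c' (Z.of_nat i - Z.of_nat N)%Z * Cpowz (INR n) (Z.of_nat i - Z.of_nat N))) by (intros; ring).
    rewrite !csum_plus. ring.
Qed.

Lemma is_constant_term_scal k f S : is_constant_term f S -> is_constant_term (fun s => k * f s) (k * S).
Proof.
  intros (a & c & Ha & Hc). apply is_log_power_expansion_iff in Ha as [J [H1 H2]].
  exists (fun j => k * a j), (fun z => k * c z). split; [|rewrite Hc; reflexivity].
  apply is_log_power_expansion_iff. exists J. split.
  - intros j Hj. destruct (H1 j Hj) as [-> ->]. split; ring.
  - intros N. apply (czero_ext _ _) with (2 := czero_scal k _ (H2 N)). intros n _.
    unfold log_power_sum.
    rewrite (csum_ext (fun j => k * a j * (INR n ^ j * ln (INR n)))
      (fun j => k * (a j * (INR n ^ j * ln (INR n))))) by (intros; ring).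
    rewrite (csum_ext (fun i => k * c (Z.of_nat i - Z.of_nat N)%Z * Cpowz (INR n) (Z.of_nat i - Z.of_nat N))
      (fun i => k * (c (Z.of_nat i - Z.of_nat N)%Z * Cpowz (INR n) (Z.of_nat i - Z.of_nat N)))) by (intros; ring).
    rewrite !csum_scal. ring.
Qed.

Lemma is_constant_term_minus f g S S' :
  is_constant_term f S -> is_constant_term g S' -> is_constant_term (fun s => f s - g s) (S - S').
Proof.
  intros H H'. pose proof (is_constant_term_plus _ _ _ _ H (is_constant_term_scal (-(1)) _ _ H')) as H2.
  replace (S - S') with (S + - (1) * S') by ring.
  apply (is_constant_term_ext _ _ _) with (2 := H2). intros. ring.
Qed.

Lemma expansion_exact (f : nat -> C) (a : nat -> C) (c : Z -> C) J :
  (forall j, (J < j)%nat -> a j = 0 /\ c (Z.of_nat j) = 0) ->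
  (forall N s, (1 <= s)%nat -> f s = log_power_sum a c J N s) -> expansion f a c J.
Proof.
  intros H1 H2. split; [exact H1|]. intros N eps He. exists 1%nat. intros n Hn.
  rewrite (H2 N n Hn). match goal with |- (Cmod ?z < _)%R => replace z with (RtoC 0) by ring end.
  rewrite Cmod_0. exact He.
Qed.

Lemma is_constant_term_log_power p : is_constant_term (fun s => INR s ^ p * ln (INR s)) 0.
Proof.
  exists (fun j => if Nat.eqb j p then RtoC 1 else RtoC 0), (fun _ => 0). split; [|reflexivity].
  apply is_log_power_expansion_iff. exists p. apply expansion_exact.
  - intros j Hj. rewrite (proj2 (Nat.eqb_neq j p)) by lia. auto.
  - intros N s _. unfold log_power_sum.
    rewrite (csum_zero (fun i => 0 * _)) by (intros; ring).
    rewrite (csum_single _ (S p) p); [rewrite Nat.eqb_refl; ring|lia|].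
    intros i _ Hi. rewrite (proj2 (Nat.eqb_neq i p)) by exact Hi. ring.
Qed.

Lemma Cpowz_of_nat z n : Cpowz z (Z.of_nat n) = z ^ n.
Proof. destruct n as [|n]; [reflexivity|]. simpl Cpowz. rewrite SuccNat2Pos.id_succ. reflexivity. Qed.

Lemma Cpowz_opp_of_nat z n : Cpowz z (- Z.of_nat (S n)) = / z ^ S n.
Proof. simpl Cpowz. rewrite SuccNat2Pos.id_succ. reflexivity. Qed.

Lemma is_constant_term_power p :
  is_constant_term (fun s => INR s ^ p) (match p with O => RtoC 1 | _ => RtoC 0 end).
Proof.
  exists (fun _ => 0), (fun z => if Z.eqb z (Z.of_nat p) then RtoC 1 else RtoC 0).
  split; [|destruct p; reflexivity].
  apply is_log_power_expansion_iff. exists p. apply expansion_exact.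
  - intros j Hj. rewrite (proj2 (Z.eqb_neq _ _)) by lia. auto.
  - intros N s _. unfold log_power_sum.
    rewrite (csum_zero (fun i => 0 * _)) by (intros; ring).
    rewrite (csum_single _ (S (p + N)) (p + N)); [|lia|].
    + replace (Z.of_nat (p + N) - Z.of_nat N)%Z with (Z.of_nat p) by lia.
      rewrite Z.eqb_refl, Cpowz_of_nat. ring.
    + intros i _ Hi. rewrite (proj2 (Z.eqb_neq _ _)) by lia. ring.
Qed.

Lemma is_constant_term_const k : is_constant_term (fun _ => k) k.
Proof.
  pose proof (is_constant_term_scal k _ _ (is_constant_term_power 0)) as H.
  replace (k * 1) with k in H by ring.
  apply (is_constant_term_ext _ _ _) with (2 := H). intros. simpl. ring.
Qed.

Lemma is_constant_term_csum (f : nat -> nat -> C) (S : nat -> C) n :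
  (forall i, (i < n)%nat -> is_constant_term (f i) (S i)) ->
  is_constant_term (fun s => csum (fun i => f i s) n) (csum S n).
Proof.
  induction n as [|n IH]; intros H; simpl; [apply is_constant_term_const|].
  apply is_constant_term_plus; [apply IH; intros; apply H; lia|apply H; lia].
Qed.

Lemma is_constant_term_polynomial f :
  polynomial f -> is_constant_term (fun s => f (RtoC (INR s))) (f 0).
Proof.
  intros (c & d & H).
  pose proof (is_constant_term_csum (fun i s => c i * INR s ^ i) _ d
    (fun i _ => is_constant_term_scal (c i) _ _ (is_constant_term_power i))) as H1.
  replace (f 0) with (csum (fun i => c i * match i with O => RtoC 1 | S _ => RtoC 0 end) d).
  - apply (is_constant_term_ext _ _ _) with (2 := H1). intros. rewrite H. reflexivity.
  - rewrite H. apply csum_ext. intros [|i] _; [reflexivity|]. rewrite Cpow_S. ring.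
Qed.

(** Here [e j] is the coefficient of [s^(-(j+1))]. To reach precision [o(s^(-N))] the first [N]
    terms suffice, since [s^N] times the error is [O(1/s)]. *)
Lemma is_constant_term_vanishing (f : nat -> C) (e : nat -> C) :
  (forall L, exists K : R, forall s, (1 <= s)%nat ->
    (Cmod (f s - csum (fun j => e j / INR s ^ S j)%C L) <= K / INR s ^ S L)%R) ->
  is_constant_term f 0.
Proof.
  intros H. exists (fun _ => 0), (fun z => match z with Zneg p => e (pred (Pos.to_nat p)) | _ => RtoC 0 end).
  split; [|reflexivity]. apply is_log_power_expansion_iff. exists O. split.
  { intros [|j] Hj; [lia|]. auto. }
  intros N. destruct (H N) as [K HK]. apply (czero_inv K). intros s Hs. specialize (HK s Hs).
  pose proof (INR_ge_1 s Hs) as H1.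
  replace (log_power_sum _ _ _ _ _) with (csum (fun j => e j / INR s ^ S j) N).
  - rewrite Cmod_mult, Cmod_pow, Cmod_R, Rabs_pos_eq by lra.
    assert (Hp : (0 < INR s ^ N)%R) by (apply pow_lt; lra).
    eapply Rle_trans; [apply Rmult_le_compat_l; [lra|exact HK]|]. right. simpl. field. lra.
  - unfold log_power_sum. rewrite (csum_zero (fun j => 0 * _)) by (intros; ring).
    rewrite Nat.add_0_l. cbn [csum]. rewrite Z.sub_diag.
    (* The expansion lists exponents upwards from [-N], the series downwards from [-1]. *)
    rewrite (csum_rev (fun i => _ * Cpowz (INR s) (Z.of_nat i - Z.of_nat N))).
    match goal with |- _ = _ + (csum ?g N + _) => rewrite (csum_ext (fun j => e j / INR s ^ S j) g N) end; [ring|].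
    intros i Hi. cbv beta. replace (Z.of_nat (N - 1 - i) - Z.of_nat N)%Z with (- Z.of_nat (S i))%Z by lia.
    rewrite Cpowz_opp_of_nat.
    change (- Z.of_nat (S i))%Z with (Zneg (Pos.of_succ_nat i)). cbv iota.
    rewrite SuccNat2Pos.id_succ. reflexivity.
Qed.

(** The difference of two expansions is one of the zero function. At precision [N = 0] it is a
    polynomial in [s] and [log s] tending to 0, so its constant coefficient is 0. *)
Lemma is_constant_term_unique f S S' : is_constant_term f S -> is_constant_term f S' -> S = S'.
Proof.
  intros H H'.
  destruct (is_constant_term_minus _ _ _ _ H H') as (a & c & Ha & Hc).
  apply is_log_power_expansion_iff in Ha as [J [_ H2]].
  assert (E : - c 0%Z = 0).
  { change (- c 0%Z) with ((fun j => - c (Z.of_nat j)) O).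
    apply (log_poly_czero (fun j => - a j) (fun j => - c (Z.of_nat j)) J).
    apply (czero_ext _ _) with (2 := H2 O). intros n _. unfold log_power_sum. rewrite Nat.add_0_r.
    rewrite (csum_ext (fun j => (- a j * ln (INR n) + - c (Z.of_nat j)) * INR n ^ j)
      (fun j => (-(1)) * (a j * (INR n ^ j * ln (INR n))) + (-(1)) * (c (Z.of_nat j - Z.of_nat 0)%Z * Cpowz (INR n) (Z.of_nat j - Z.of_nat 0)))).
    - rewrite csum_plus, !csum_scal. simpl Cpow. ring.
    - intros j _. change (Z.of_nat 0) with 0%Z. rewrite Z.sub_0_r, Cpowz_of_nat. ring. }
  replace S with ((S - S') + S') by ring. rewrite <- Hc.
  replace (c 0%Z) with (- - c 0%Z) by ring. rewrite E. ring.
Qed.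

(** * Harmonic sums *)

(* From [p + 1 = j + (p + 1 - j)] applied to the binomial weight of the j-th term. *)
Lemma binomial_sum_step (u : nat -> C) p :
  INR (S p) * csum (fun j => u j / (INR (fact j) * INR (fact (S p - j)))) (S (S p))
  = csum (fun j => (u (S j) + u j) / (INR (fact j) * INR (fact (p - j)))) (S p).
Proof.
  rewrite <- csum_scal.
  rewrite (csum_ext _ (fun j => INR j * (u j / (INR (fact j) * INR (fact (S p - j))))
    + INR (S p - j) * (u j / (INR (fact j) * INR (fact (S p - j)))))).
  2:{ intros j Hj. rewrite (minus_INR (S p) j), RtoC_minus by lia. ring. }
  rewrite csum_plus.
  rewrite (csum_Sl (fun j => INR j * _)).
  rewrite (csum_ext (fun i => INR (S i) * _) (fun j => u (S j) / (INR (fact j) * INR (fact (p - j))))).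
  2:{ intros j Hj. rewrite fact_simpl, mult_INR, RtoC_mult. replace (S p - S j)%nat with (p - j)%nat by lia.
      field. repeat split; try apply INR_fact_C_neq_0. apply INR_S_C_neq_0. }
  change (csum (fun j => INR (S p - j) * (u j / (INR (fact j) * INR (fact (S p - j))))) (S (S p)))
    with (csum (fun j => INR (S p - j) * (u j / (INR (fact j) * INR (fact (S p - j))))) (S p)
      + INR (S p - S p) * (u (S p) / (INR (fact (S p)) * INR (fact (S p - S p))))).
  rewrite Nat.sub_diag.
  rewrite (csum_ext (fun j => INR (S p - j) * _) (fun j => u j / (INR (fact j) * INR (fact (p - j))))).
  2:{ intros j Hj. replace (S p - j)%nat with (S (p - j)) by lia. rewrite (fact_simpl (p - j)), mult_INR, RtoC_mult.
      field. repeat split; try apply INR_fact_C_neq_0. apply INR_S_C_neq_0. }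
  rewrite (csum_ext (fun j => (u (S j) + u j) / _) (fun j => u (S j) / (INR (fact j) * INR (fact (p - j)))
     + u j / (INR (fact j) * INR (fact (p - j))))).
  2:{ intros j _. field. split; apply INR_fact_C_neq_0. }
  rewrite csum_plus. change (RtoC (INR 0)) with (RtoC 0). ring.
Qed.

(** For [u j = (-1)^j] the consecutive sums [u (j+1) + u j] vanish in [binomial_sum_step]. *)
Lemma alternating_binomial_sum p :
  csum (fun j => (-(1)) ^ j / (INR (fact j) * INR (fact (S p - j)))) (S (S p)) = 0.
Proof.
  pose proof (binomial_sum_step (fun j => (-(1)) ^ j) p) as H. cbv beta in H.
  rewrite (csum_zero (fun j => ((- (1)) ^ S j + (- (1)) ^ j) / _)) in H.
  2:{ intros j _. rewrite Cpow_S. field. split; apply INR_fact_C_neq_0. }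
  pose proof (INR_S_C_neq_0 p) as Hp.
  match type of H with _ * ?z = _ => replace z with (/ INR (S p) * (INR (S p) * z)) by (field; exact Hp) end.
  rewrite H. ring.
Qed.

Lemma harmonic_S j : harmonic (S j) = (harmonic j + / INR (S j))%R.
Proof. unfold harmonic. rewrite sum_n_Sm by lia. reflexivity. Qed.

(** For [u j = (-1)^(j+1) H_j] the consecutive sum is [(-1)^j / (j+1)]. Absorbing [j + 1] into the
    factorial gives, up to sign, the alternating binomial sum without its term of index 0, hence
    [1/(p+1)!]. *)
Lemma harmonic_binomial_sum p :
  csum (fun j => (-(1)) ^ S j * harmonic j / (INR (fact j) * INR (fact (S p - j)))) (S (S p))
  = / (INR (S p) * INR (fact (S p))).
Proof.
  pose proof (INR_S_C_neq_0 p) as Hp.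
  pose proof (binomial_sum_step (fun j => (-(1)) ^ S j * harmonic j) p) as H. cbv beta in H.
  rewrite (csum_ext (fun j => ((- (1)) ^ S (S j) * _ + _) / _)
    (fun j => (-(1)) * ((-(1)) ^ S j / (INR (fact (S j)) * INR (fact (S p - S j)))))) in H.
  2:{ intros j Hj. rewrite harmonic_S, RtoC_plus, RtoC_inv by (apply not_0_INR; lia).
      rewrite fact_simpl, mult_INR, RtoC_mult. replace (S p - S j)%nat with (p - j)%nat by lia.
      rewrite !Cpow_S. field. repeat split; try apply INR_fact_C_neq_0. apply INR_S_C_neq_0. }
  rewrite csum_scal in H.
  pose proof (alternating_binomial_sum p) as H0. rewrite csum_Sl in H0.
  set (W := csum (fun i => (- (1)) ^ S i / (INR (fact (S i)) * INR (fact (S p - S i)))) (S p)) in *.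
  assert (E : W = - / INR (fact (S p))).
  { replace W with ((((- (1)) ^ 0 / (INR (fact 0) * INR (fact (S p - 0)))) + W) - / INR (fact (S p))).
    - rewrite H0. ring.
    - rewrite Nat.sub_0_r. simpl Cpow. change (INR (fact 0)) with 1%R. field. apply INR_fact_C_neq_0. }
  rewrite E in H.
  match type of H with _ * ?z = _ => replace z with (/ INR (S p) * (INR (S p) * z)) by (field; exact Hp) end.
  rewrite H. field. split; [apply INR_fact_C_neq_0|exact Hp].
Qed.

(** * Twisted Bernoulli polynomials *)

Lemma is_ps_div_X g G : is_ps g G -> g O = 0 -> is_ps (fun i => g (S i)) (fun t => G t / t).
Proof.
  intros (r & A & Hr & HA & Hs) H0. apply (is_ps_intro _ _ r Hr). intros t Ht.
  assert (Ht0 : t <> 0) by (apply Cmod_gt_0; lra).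
  assert (H1 : cser (fun i => g (S i) * t ^ S i) (G t)).
  { intros eps He. destruct (Hs t Ht eps He) as [N HN]. exists N. intros n Hn.
    specialize (HN (S n) ltac:(lia)). rewrite csum_Sl, H0 in HN.
    replace (0 * t ^ 0 + csum (fun i => g (S i) * t ^ S i) n - G t)
      with (csum (fun i => g (S i) * t ^ S i) n - G t) in HN by ring. exact HN. }
  replace (G t / t) with (/ t * G t) by (field; exact Ht0).
  eapply cser_ext; [|apply cser_scal, H1]. intros i. cbv beta. rewrite Cpow_S. field. exact Ht0.
Qed.

Lemma is_ps_mul_X h H : is_ps h H ->
  is_ps (fun i => match i with O => RtoC 0 | S j => h j end) (fun t => t * H t).
Proof.
  intros (r & A & Hr & HA & Hs). apply (is_ps_intro _ _ r Hr). intros t Ht.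
  pose proof (cser_scal t _ _ (Hs t Ht)) as H1. intros eps He. destruct (H1 eps He) as [N HN].
  exists (S N). intros [|n] Hn; [lia|]. specialize (HN n ltac:(lia)).
  rewrite csum_Sl.
  rewrite (csum_ext (fun i => h i * t ^ S i) (fun i => t * (h i * t ^ i))) by (intros; rewrite Cpow_S; ring).
  match goal with |- (Cmod (_ + ?x - ?y) < _)%R => replace (0 * t ^ 0 + x - y) with (x - y) by ring end.
  exact HN.
Qed.

Lemma Cpowz_pred (t : C) (i : nat) : t <> 0 -> t * Cpowz t (Z.of_nat i - 1) = t ^ i.
Proof.
  intros Ht. destruct i as [|i].
  - simpl. field. exact Ht.
  - replace (Z.of_nat (S i) - 1)%Z with (Z.of_nat i) by lia. rewrite Cpowz_of_nat. reflexivity.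
Qed.

Section TwistedBernoulli.

Variables (chi : Z -> C) (m : nat).
Hypothesis Hm : (1 <= m)%nat.
Hypothesis Hchi : forall k : Z, chi (k + Z.of_nat m)%Z = chi k.

Lemma periodic_nat (k : Z) (s : nat) : chi (k + Z.of_nat (m * s))%Z = chi k.
Proof.
  induction s as [|s IH].
  - rewrite Nat.mul_0_r. f_equal. lia.
  - rewrite <- IH, <- (Hchi (k + Z.of_nat (m * s))). f_equal. lia.
Qed.

Definition exp_sum (w : C) (N : nat) (t : C) : C :=
  csum (fun i => chi (Z.of_nat (S i)) * Cexp ((1 - (INR (S i) + w)) * t)) N.

(** This is [F(-t, w-1)] with its denominator rewritten in decaying exponentials. Without the factor
    [1/t] the simple pole disappears, so ordinary power series are enough. *)
Definition twisted_gen (w t : C) : C := t * exp_sum w m t / (1 - Cexp (- INR m * t)).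

(** The geometric sum over [s] full periods, cross-multiplied so that it holds also where
    [1 - e^(-mt)] vanishes. *)
Lemma exp_sum_period (w t : C) s :
  (1 - Cexp (- INR m * t)) * exp_sum w (m * s) t = (1 - Cexp (- INR (m * s) * t)) * exp_sum w m t.
Proof.
  induction s as [|s IH].
  - rewrite Nat.mul_0_r. unfold exp_sum at 1. simpl csum. simpl INR at 2.
    replace (- 0 * t) with (RtoC 0) by ring. rewrite Cexp_0. ring.
  - replace (m * S s)%nat with (m * s + m)%nat by lia.
    unfold exp_sum at 1. rewrite csum_app. fold (exp_sum w (m * s) t).
    rewrite (csum_ext _ (fun i => Cexp (- INR (m * s) * t) * (chi (Z.of_nat (S i)) * Cexp ((1 - (INR (S i) + w)) * t)))).
    2:{ intros i _. replace (Z.of_nat (S (m * s + i))) with (Z.of_nat (S i) + Z.of_nat (m * s))%Z by lia.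
        rewrite periodic_nat. replace (S (m * s + i)) with (m * s + S i)%nat by lia.
        rewrite plus_INR, RtoC_plus.
        replace ((1 - (INR (m * s) + INR (S i) + w)) * t) with (- INR (m * s) * t + (1 - (INR (S i) + w)) * t) by ring.
        rewrite Cexp_plus. ring. }
    rewrite csum_scal. fold (exp_sum w m t).
    rewrite plus_INR, RtoC_plus.
    replace (- (INR (m * s) + INR m) * t) with (- INR (m * s) * t + - INR m * t) by ring.
    rewrite Cexp_plus, Cmult_plus_distr_l, IH. ring.
Qed.

Lemma exp_sum_shift (w t : C) N : exp_sum (w + 1) N t = Cexp (- t) * exp_sum w N t.
Proof.
  unfold exp_sum. rewrite <- csum_scal. apply csum_ext. intros i _.
  replace ((1 - (INR (S i) + (w + 1))) * t) with (- t + (1 - (INR (S i) + w)) * t) by ring.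
  rewrite Cexp_plus. ring.
Qed.

(** The upper end of the geometric sum contributes [e^(-mst)] times the generating function at [w],
    that is [e^((1-ms)t)] times the one at [w + 1]. In this form the exponential has Taylor
    coefficients [exp_coeff (ms)], exactly those of the kernels at [b = ms]. *)
Lemma twisted_gen_diff (w t : C) s : 1 - Cexp (- INR m * t) <> 0 ->
  twisted_gen w t - twisted_gen (w + 1) t * Cexp ((1 - INR (m * s)) * t) = t * exp_sum w (m * s) t.
Proof.
  intros H. unfold twisted_gen. rewrite exp_sum_shift.
  replace (exp_sum w (m * s) t) with ((1 - Cexp (- INR m * t)) * exp_sum w (m * s) t / (1 - Cexp (- INR m * t)))
    by (field; exact H).
  rewrite exp_sum_period.
  replace ((1 - INR (m * s)) * t) with (t + - INR (m * s) * t) by ring. rewrite Cexp_plus, Cexp_opp.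
  field. split; [exact H|apply Cexp_neq_0].
Qed.

Lemma twisted_F_eq (w t : C) : 1 - Cexp (- INR m * t) <> 0 ->
  twisted_F chi m (- t) (w - 1) = twisted_gen w t.
Proof.
  intros H. unfold twisted_F. rewrite sum_n_m_csum. unfold twisted_gen, exp_sum.
  unfold Cdiv. rewrite <- csum_scal, <- csum_scal_r. apply csum_ext. intros i _.
  replace (INR m * - t) with (- INR m * t) by ring.
  replace ((1 - (INR (S i) + w)) * t) with (INR (S i) * - t + (w - 1) * - t) by ring.
  rewrite Cexp_plus. field. split; [exact H|].
  intros E. apply H. replace (1 - Cexp (- INR m * t)) with (- (Cexp (- INR m * t) - 1)) by ring. rewrite E. ring.
Qed.

Lemma exp_denominator_ps : is_ps (fun i => - ((- INR m) ^ S i / INR (fact (S i))))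
    (fun t => (1 - Cexp (- INR m * t)) / t).
Proof.
  (* [is_ps_exp 0] supplies the constant function 1. Dividing by [t] then removes the zero at the
     origin and leaves the leading coefficient [m]. *)
  pose proof (is_ps_minus _ _ _ _ (is_ps_exp 0) (is_ps_exp (- INR m))) as H.
  apply is_ps_div_X in H.
  - apply (is_ps_ext _ (fun i => - ((- INR m) ^ S i / INR (fact (S i))))) in H.
    + apply (is_ps_ext_near _ _ _ 1 Rlt_0_1) with (2 := H). intros t Ht. cbv beta.
      replace (0 * t) with (RtoC 0) by ring. rewrite Cexp_0. reflexivity.
    + intros i. cbv beta. rewrite (Cpow_S 0). field. apply INR_fact_C_neq_0.
  - simpl. ring.
Qed.

Lemma exp_denominator_coeff : - ((- INR m) ^ 1 / INR (fact 1)) <> 0.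
Proof.
  replace (- ((- INR m) ^ 1 / INR (fact 1))) with (RtoC (INR m)).
  - apply INR_C_neq_0, Hm.
  - simpl. field.
Qed.

Lemma exp_denominator_near : exists d : R, (0 < d)%R /\
  forall t : C, (0 < Cmod t < d)%R -> 1 - Cexp (- INR m * t) <> 0.
Proof.
  destruct (is_ps_near_nonzero _ _ exp_denominator_ps exp_denominator_coeff) as (d & Hd & H).
  exists d. split; [exact Hd|]. intros t Ht E. apply (H t Ht). rewrite E.
  field. apply Cmod_gt_0. lra.
Qed.

Lemma twisted_gen_ps_ex w : exists h, is_ps h (twisted_gen w).
Proof.
  destruct exp_denominator_near as (d & Hd & Hn).
  assert (HN : is_ps (fun i => csum (fun k => chi (Z.of_nat (S k)) * ((1 - (INR (S k) + w)) ^ i / INR (fact i))) m)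
     (exp_sum w m)).
  { unfold exp_sum. apply (is_ps_csum (fun k i => chi (Z.of_nat (S k)) * ((1 - (INR (S k) + w)) ^ i / INR (fact i)))
      (fun k t => chi (Z.of_nat (S k)) * Cexp ((1 - (INR (S k) + w)) * t))).
    intros k _. apply is_ps_scal, is_ps_exp. }
  eexists. apply (is_ps_ext_near _ _ _ d Hd) with (2 := is_ps_div _ _ _ _ HN exp_denominator_ps exp_denominator_coeff).
  intros t Ht. unfold twisted_gen. field. split; [apply Hn, Ht|apply Cmod_gt_0; lra].
Qed.

Definition bernoulli (w : C) (i : nat) : C := twisted_bernoulli chi m (Z.of_nat i - 1) w.

(** The quotient series of [twisted_gen] is a witness for the epsilon choice, so the chosen
    coefficients satisfy their specification; multiplying the Laurent series by [t] turns it back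
    into a power series. *)
Lemma bernoulli_ps w : is_ps (bernoulli w) (twisted_gen w).
Proof.
  destruct exp_denominator_near as (d & Hd & Hn).
  assert (H : is_twisted_bernoulli chi m w (fun k => twisted_bernoulli chi m k w)).
  { unfold twisted_bernoulli.
    apply (epsilon_spec (inhabits (fun _ : Z => RtoC 0)) (is_twisted_bernoulli chi m w)).
    destruct (twisted_gen_ps_ex w) as [h (r & A & Hr & HA & Hs)].
    exists (fun k => if Z.ltb k (-1) then RtoC 0 else h (Z.to_nat (k + 1))). split.
    - intros k Hk. rewrite (proj2 (Z.ltb_lt _ _) Hk). reflexivity.
    - exists (Rmin d r). split; [apply Rmin_pos; lra|]. intros t Ht.
      pose proof (Rmin_l d r). pose proof (Rmin_r d r).
      assert (Ht0 : t <> 0) by (apply Cmod_gt_0; lra).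
      apply is_series_cser. rewrite twisted_F_eq by (apply Hn; lra).
      eapply cser_ext; [|apply cser_scal, Hs; lra]. intros i. cbv beta.
      rewrite (proj2 (Z.ltb_ge _ _)) by lia. replace (Z.to_nat (Z.of_nat i - 1 + 1)) with i by lia.
      rewrite <- (Cpowz_pred t i Ht0). field. exact Ht0. }
  destruct H as [_ (r & Hr & Hs)].
  apply (is_ps_intro _ _ (Rmin d r)); [apply Rmin_pos; lra|]. intros t Ht.
  pose proof (Rmin_l d r). pose proof (Rmin_r d r).
  assert (Ht0 : t <> 0) by (apply Cmod_gt_0; lra).
  specialize (Hs t ltac:(lra)). apply is_series_cser in Hs. rewrite twisted_F_eq in Hs by (apply Hn; lra).
  replace (twisted_gen w t) with (t * (/ t * twisted_gen w t)) by (field; exact Ht0).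
  eapply cser_ext; [|apply cser_scal, Hs]. intros i. cbv beta. unfold bernoulli.
  rewrite <- (Cpowz_pred t i Ht0). ring.
Qed.

(** Coefficients of both sides of [twisted_gen_diff]. For [i = l + 1] this is a Faulhaber formula: a
    twisted power sum up to [ms] is a polynomial in [ms], since [exp_coeff] is polynomial in its
    argument. *)
Lemma bernoulli_diff w s i :
  bernoulli w i - conv (bernoulli (w + 1)) (exp_coeff (INR (m * s))) i
  = match i with
    | O => RtoC 0
    | S l => csum (fun k => chi (Z.of_nat (S k)) * exp_coeff (INR (S k) + w) l) (m * s)
    end.
Proof.
  destruct exp_denominator_near as (d & Hd & Hn).
  apply (ps_unique (fun i => bernoulli w i - conv (bernoulli (w + 1)) (exp_coeff (INR (m * s))) i)
    (fun i => match i with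
    | O => RtoC 0
    | S l => csum (fun k => chi (Z.of_nat (S k)) * exp_coeff (INR (S k) + w) l) (m * s)
    end) (fun t => twisted_gen w t - twisted_gen (w + 1) t * Cexp ((1 - INR (m * s)) * t))
    (fun t => t * exp_sum w (m * s) t) d Hd).
  - intros t Ht. apply twisted_gen_diff, Hn, Ht.
  - apply is_ps_minus; [apply bernoulli_ps|]. apply is_ps_mult; [apply bernoulli_ps|].
    apply (is_ps_exp (1 - INR (m * s))).
  - apply is_ps_mul_X. unfold exp_sum.
    apply (is_ps_csum (fun k l => chi (Z.of_nat (S k)) * exp_coeff (INR (S k) + w) l)
      (fun k t => chi (Z.of_nat (S k)) * Cexp ((1 - (INR (S k) + w)) * t))).
    intros k _. apply is_ps_scal. apply (is_ps_exp (1 - (INR (S k) + w))).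
Qed.

(** The case [s = 0], where the sum is empty: the generating function at [w] is [e^t] times the one
    at [w + 1]. *)
Lemma bernoulli_conv_0 w i : bernoulli w i = conv (bernoulli (w + 1)) (exp_coeff 0) i.
Proof.
  pose proof (bernoulli_diff w 0 i) as H. rewrite Nat.mul_0_r in H. simpl INR in H. simpl csum in H.
  replace (bernoulli w i) with ((bernoulli w i - conv (bernoulli (w + 1)) (exp_coeff 0) i)
    + conv (bernoulli (w + 1)) (exp_coeff 0) i) by ring.
  rewrite H. destruct i; ring.
Qed.

(** Expanding the coefficients at [w] through those at [w + 1] and grouping by [p = j + q], the
    inner sum is that of [harmonic_binomial_sum], equal to the value at 0 of the correcting
    polynomial. *)
Lemma harmonic_bernoulli_sum w N :
  csum (fun j => (-(1)) ^ S j / INR (fact j) * harmonic j * bernoulli w (N - j)%nat) (S N)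
  = csum (fun p => bernoulli (w + 1) (N - p)%nat * log_kernel_poly p 0) (S N).
Proof.
  rewrite (csum_ext _ (fun j => csum (fun q => (-(1)) ^ S j / INR (fact j) * harmonic j
     * (bernoulli (w + 1) (N - (j + q))%nat * / INR (fact q))) (S N - j))).
  2:{ intros j Hj. rewrite bernoulli_conv_0. unfold conv. rewrite csum_rev, csum_scal. f_equal.
      replace (S N - j)%nat with (S (N - j)) by lia. apply csum_ext. intros q Hq.
      replace (S (N - j) - 1 - q)%nat with (N - (j + q))%nat by lia.
      replace (N - j - (N - (j + q)))%nat with q by lia.
      unfold exp_coeff. replace (1 - 0) with (RtoC 1) by ring. rewrite Cpow_1_l. field. apply INR_fact_C_neq_0. }
  rewrite (csum_triangle (fun j q => (-(1)) ^ S j / INR (fact j) * harmonic j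
     * (bernoulli (w + 1) (N - (j + q))%nat * / INR (fact q)))).
  apply csum_ext. intros p Hp.
  rewrite (csum_ext _ (fun j => bernoulli (w + 1) (N - p)%nat *
     ((-(1)) ^ S j * harmonic j / (INR (fact j) * INR (fact (p - j)))))).
  2:{ intros j Hj. replace (j + (p - j))%nat with p by lia. field. split; apply INR_fact_C_neq_0. }
  rewrite csum_scal. f_equal. destruct p as [|p].
  (* For [p = 0] both sides vanish: [H_0 = 0] and [log_kernel_poly 0] is 0. *)
  - unfold harmonic. rewrite (csum_single _ 1 0) by lia. rewrite sum_n_m_zero by lia. simpl.
    change (RtoC (@zero R_AbelianMonoid)) with (RtoC 0). field.
  - rewrite harmonic_binomial_sum, log_kernel_poly_0. reflexivity.
Qed.

End TwistedBernoulli.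

(** * Integral representation and conclusion *)

(** Away from 0 every lower power is dominated by [t^L] at the cost of [d^(-L)], so the bounds far
    from and close to the origin get the same shape. *)
Lemma pow_le_pow_div (d t : R) i L : (0 < d <= 1)%R -> (d <= t)%R -> (i <= L)%nat ->
  (t ^ i <= t ^ L * / d ^ L)%R.
Proof.
  intros Hd Ht Hi. assert (0 < d ^ L)%R by (apply pow_lt; lra).
  apply Rmult_le_reg_r with (d ^ L)%R; [lra|]. rewrite Rmult_assoc, Rinv_l, Rmult_1_r by lra.
  replace L with (i + (L - i))%nat by lia. rewrite !pow_add.
  assert (0 < d ^ i <= 1)%R by (split; [apply pow_lt; lra|rewrite <- (pow1 i); apply pow_incr; lra]).
  assert (0 < d ^ (L - i))%R by (apply pow_lt; lra).
  assert (d ^ (L - i) <= t ^ (L - i))%R by (apply pow_incr; lra).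
  apply Rmult_le_compat_l; [apply pow_le; lra|]. nra.
Qed.

Lemma Re_csum_scal_r (f : nat -> R) (e : R) n :
  Re (csum (fun i => RtoC (f i * e)) n) = (Re (csum (fun i => RtoC (f i)) n) * e)%R.
Proof.
  rewrite (csum_ext (fun i => RtoC (f i * e)) (fun i => RtoC (f i) * RtoC e)) by (intros; apply RtoC_mult).
  rewrite csum_scal_r. unfold Re. simpl. ring.
Qed.

Lemma Re_csum_Cmod_ge_0 (f : nat -> C) n : (0 <= Re (csum (fun i => RtoC (Cmod (f i))) n))%R.
Proof. eapply Rle_trans; [apply (Cmod_ge_0 (csum f n))|]. apply Cmod_csum_le. intros; lra. Qed.

Section IntegralRepresentation.

Variables (chi : Z -> C) (m : nat).
Hypothesis Hm : (1 <= m)%nat.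
Hypothesis Hchi : forall k : Z, chi (k + Z.of_nat m)%Z = chi k.

Definition gen_remainder (w : C) (L : nat) (t : R) : C :=
  twisted_gen chi m w t - csum (fun i => bernoulli chi m w i * RtoC t ^ i) L.

Lemma exp_denominator_ge (d t : R) : (0 < d)%R -> (d <= t)%R ->
  (0 < 1 - exp (- d) <= Cmod (1 - Cexp (- INR m * t)))%R.
Proof.
  intros Hd Ht. split.
  - assert (exp (- d) < 1)%R; [|lra]. rewrite <- exp_0. apply exp_increasing. lra.
  - assert (Cmod (Cexp (- INR m * t)) <= exp (- d))%R.
    { rewrite Cmod_Cexp. apply exp_le. unfold Re. simpl. pose proof (INR_ge_1 m Hm). nra. }
    assert (1 <= Cmod (1 - Cexp (- INR m * t)) + Cmod (Cexp (- INR m * t)))%R; [|lra].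
    rewrite <- Cmod_1 at 1.
    replace (RtoC 1) with ((1 - Cexp (- INR m * t)) + Cexp (- INR m * t)) at 1 by ring.
    apply Cmod_triangle.
Qed.

Lemma exp_denominator_neq_0 (t : R) : (0 < t)%R -> 1 - Cexp (- INR m * t) <> 0.
Proof.
  intros Ht. apply Cmod_gt_0. pose proof (exp_denominator_ge t t Ht (Rle_refl t)). lra.
Qed.

Lemma ccont_gen_remainder w L t : (0 < t)%R -> ccont (gen_remainder w L) t.
Proof.
  intros Ht. unfold gen_remainder, twisted_gen, exp_sum. ccont_tac.
  apply exp_denominator_neq_0, Ht.
Qed.

(** Below [d] the power series remainder applies. Above [d] the denominator is at least
    [1 - e^(-d)], each exponential times [e^(-t)] decays at rate [k + Re w >= 1 + Re w], and the
    subtracted polynomial at rate 1; hence the minimum of the two rates, positive because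
    [Re w > -1]. *)
Lemma gen_remainder_bound w L : (-1 < Re w)%R -> (1 <= L)%nat ->
  exists K : R, forall t : R, (0 < t)%R ->
    (Cmod (gen_remainder w L t) * exp (- t) <= K * t ^ L * exp (- (Rmin 1 (1 + Re w) * t)))%R.
Proof.
  intros Hw HL. set (de := Rmin 1 (1 + Re w)).
  assert (Hde : (0 < de)%R) by (apply Rmin_pos; lra).
  assert (Hde1 : (de <= 1)%R) by apply Rmin_l. assert (Hde2 : (de <= 1 + Re w)%R) by apply Rmin_r.
  destruct (ps_remainder _ _ L (bernoulli_ps chi m Hm w)) as (K1 & d0 & Hd0 & HK1 & Hnear).
  set (d := Rmin d0 1). assert (Hd : (0 < d)%R) by (apply Rmin_pos; lra).
  assert (Hd1 : (d <= 1)%R) by apply Rmin_r. assert (Hd2 : (d <= d0)%R) by apply Rmin_l.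
  set (X := Re (csum (fun i => RtoC (Cmod (chi (Z.of_nat (S i))))) m)).
  set (Y := Re (csum (fun i => RtoC (Cmod (bernoulli chi m w i))) L)).
  assert (HX : (0 <= X)%R) by apply (Re_csum_Cmod_ge_0 (fun i => chi (Z.of_nat (S i)))).
  assert (HY : (0 <= Y)%R) by apply Re_csum_Cmod_ge_0.
  set (q := (/ (1 - exp (- d)))%R).
  pose proof (exp_denominator_ge d d Hd (Rle_refl d)) as [Hq0 _].
  assert (Hq : (0 < q)%R) by (apply Rinv_0_lt_compat; exact Hq0).
  assert (HdL : (0 < / d ^ L)%R) by (apply Rinv_0_lt_compat, pow_lt; lra).
  exists (K1 + (X * q + Y) * / d ^ L)%R. intros t Ht.
  assert (HtL : (0 < t ^ L)%R) by (apply pow_lt; lra).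
  assert (Hexp : (0 < exp (- t) <= exp (- (de * t)))%R) by (split; [apply exp_pos|apply exp_le; nra]).
  assert (HXY : (0 <= (X * q + Y) * / d ^ L)%R).
  { apply Rmult_le_pos; [|lra]. pose proof (Rmult_le_pos X q HX ltac:(lra)). lra. }
  destruct (Rlt_le_dec t d) as [Htd|Htd].
  - assert (Hct : Cmod (RtoC t) = t) by (rewrite Cmod_R, Rabs_pos_eq; lra).
    specialize (Hnear (RtoC t) ltac:(rewrite Hct; lra)). rewrite Hct in Hnear.
    fold (gen_remainder w L t) in Hnear.
    apply Rmult_le_compat; try lra; [apply Cmod_ge_0|].
    eapply Rle_trans; [exact Hnear|]. apply Rmult_le_compat_r; lra.
  - assert (H1 : (Cmod (twisted_gen chi m w t) * exp (- t) <= (t ^ L * / d ^ L) * (X * exp (- (de * t)) * q))%R).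
    { unfold twisted_gen. rewrite Cmod_div by (apply exp_denominator_neq_0, Ht).
      rewrite Cmod_mult, Cmod_R, Rabs_pos_eq by lra.
      assert (HS : (Cmod (exp_sum chi w m t) * exp (- t) <= X * exp (- (de * t)))%R).
      { replace (Cmod (exp_sum chi w m t) * exp (- t))%R with (Cmod (exp_sum chi w m t * RtoC (exp (- t)))).
        2:{ rewrite Cmod_mult, Cmod_R, (Rabs_pos_eq (exp (- t))) by lra. reflexivity. }
        unfold exp_sum. rewrite <- csum_scal_r. unfold X. rewrite <- Re_csum_scal_r.
        apply Cmod_csum_le. intros i _. rewrite !Cmod_mult, Rmult_assoc.
        apply Rmult_le_compat_l; [apply Cmod_ge_0|].
        rewrite Cmod_Cexp, Cmod_R, Rabs_pos_eq, <- exp_plus by lra.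
        apply exp_le. unfold Re in *. cbn [Cmult Cminus Cplus Copp fst snd RtoC].
        pose proof (INR_ge_1 (S i) ltac:(lia)). nra. }
      pose proof (exp_denominator_ge d t Hd Htd) as [_ Hden].
      replace (t * Cmod (exp_sum chi w m t) / Cmod (1 - Cexp (- INR m * t)) * exp (- t))%R
        with (t * ((Cmod (exp_sum chi w m t) * exp (- t)) * / Cmod (1 - Cexp (- INR m * t))))%R
        by (unfold Rdiv; ring).
      assert (Hinv : (0 < / Cmod (1 - Cexp (- INR m * t)) <= q)%R).
      { split; [apply Rinv_0_lt_compat; lra|]. apply Rinv_le_contravar; lra. }
      assert (0 <= Cmod (exp_sum chi w m t) * exp (- t))%R by (apply Rmult_le_pos; [apply Cmod_ge_0|lra]).
      apply Rmult_le_compat; [lra| | |].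
      - apply Rmult_le_pos; lra.
      (* The factor [t] of the generating function is absorbed into [t^L]; this is where [L >= 1]
         enters. *)
      - rewrite <- (pow_1 t) at 1. apply pow_le_pow_div; [lra|lra|lia].
      - apply Rmult_le_compat; lra. }
    assert (H2 : (Cmod (csum (fun i => bernoulli chi m w i * RtoC t ^ i)%C L) <= Y * (t ^ L * / d ^ L))%R).
    { unfold Y. rewrite <- Re_csum_scal_r. apply Cmod_csum_le. intros i Hi.
      rewrite Cmod_mult, Cmod_pow, Cmod_R, (Rabs_pos_eq t) by lra.
      apply Rmult_le_compat_l; [apply Cmod_ge_0|]. apply pow_le_pow_div; [lra|lra|lia]. }
    assert (H3 : (Cmod (gen_remainder w L t) <= Cmod (twisted_gen chi m w t)
       + Cmod (csum (fun i => bernoulli chi m w i * RtoC t ^ i)%C L))%R).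
    { unfold gen_remainder, Cminus. eapply Rle_trans; [apply Cmod_triangle|]. rewrite Cmod_opp. lra. }
    apply Rle_trans with (Cmod (twisted_gen chi m w t) * exp (- t)
       + Cmod (csum (fun i => bernoulli chi m w i * RtoC t ^ i)%C L) * exp (- t))%R.
    { rewrite <- Rmult_plus_distr_r. apply Rmult_le_compat_r; lra. }
    apply Rle_trans with ((t ^ L * / d ^ L) * (X * exp (- (de * t)) * q)
      + Y * (t ^ L * / d ^ L) * exp (- (de * t)))%R.
    { apply Rplus_le_compat; [exact H1|]. apply Rmult_le_compat; try lra. apply Cmod_ge_0. }
    assert (0 <= K1 * t ^ L * exp (- (de * t)))%R by (repeat apply Rmult_le_pos; lra).
    nra.
Qed.

(** At [w + 1] the decay rate equals 1, so the factors [e^(-t)] cancel and a purely polynomial bound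
    remains. *)
Lemma gen_remainder_bound_shift w L : (-1 < Re w)%R -> (1 <= L)%nat ->
  exists K : R, forall t : R, (0 < t)%R -> (Cmod (gen_remainder (w + 1) L t) <= K * t ^ L)%R.
Proof.
  intros Hw HL.
  assert (Hw1 : (0 < Re (w + 1))%R) by (unfold Re in *; simpl; lra).
  destruct (gen_remainder_bound (w + 1) L) as [K HK]; [lra|exact HL|]. exists K. intros t Ht.
  specialize (HK t Ht). rewrite Rmin_left, Rmult_1_l in HK by lra.
  apply Rmult_le_reg_r with (exp (- t)); [apply exp_pos|exact HK].
Qed.

Variables (n : nat) (w : C).
Hypothesis Hw : (-1 < Re w)%R.

Definition main_kernel (t : R) : C :=
  RtoC (exp (- (1 * t))) * gen_remainder w (S (S n)) t / RtoC t ^ S (S n).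

Definition tail_kernel (s : nat) (t : R) : C :=
  RtoC (exp (- (INR (m * s) * t))) * gen_remainder (w + 1) (S (S n)) t / RtoC t ^ S (S n).

Lemma RtoC_pos_pow_neq_0 (t : R) k : (0 < t)%R -> RtoC t ^ k <> 0.
Proof. intros Ht. apply Cpow_nz, RtoC_neq_0. lra. Qed.

Lemma Cmod_div_pow (z : C) (t : R) k : (0 < t)%R -> Cmod (z / RtoC t ^ k) = (Cmod z / t ^ k)%R.
Proof.
  intros Ht. rewrite Cmod_div by (apply RtoC_pos_pow_neq_0, Ht).
  rewrite Cmod_pow, Cmod_R, Rabs_pos_eq by lra. reflexivity.
Qed.

Lemma main_kernel_cint : exists l, cint main_kernel l.
Proof.
  destruct (gen_remainder_bound w (S (S n)) Hw ltac:(lia)) as [K HK].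
  apply (cint_dominated _ K (Rmin 1 (1 + Re w))).
  - apply Rmin_pos; lra.
  - intros t Ht. unfold main_kernel.
    apply (ccont_mult (fun t => RtoC (exp (- (1 * t))) * gen_remainder w (S (S n)) t) (fun t => / RtoC t ^ S (S n))).
    + apply ccont_mult; [apply ccont_exp_neg|apply ccont_gen_remainder, Ht].
    + ccont_tac. apply RtoC_pos_pow_neq_0, Ht.
  - intros t Ht. unfold main_kernel. rewrite Cmod_div_pow by exact Ht.
    assert (0 < t ^ S (S n))%R by (apply pow_lt; lra).
    rewrite Cmod_mult, Cmod_R, Rabs_pos_eq, Rmult_1_l by (left; apply exp_pos).
    apply Rmult_le_reg_r with (t ^ S (S n))%R; [lra|]. unfold Rdiv.
    rewrite Rmult_assoc, Rinv_l, Rmult_1_r by lra. rewrite Rmult_comm.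
    eapply Rle_trans; [apply HK, Ht|]. right; ring.
Qed.

(** Pulling [1/t] out of the bracket turns the Laurent remainder into a Taylor remainder with
    [n + 2] terms and raises the denominator to [t^(n+2)]. *)
Lemma sr_integrand_eq t : (0 < t)%R -> main_kernel t = sr_integrand chi m n w t.
Proof.
  intros Ht. assert (Ht0 : RtoC t <> 0) by (apply RtoC_neq_0; lra).
  unfold main_kernel, sr_integrand, gen_remainder.
  rewrite twisted_F_eq by (apply exp_denominator_neq_0, Ht).
  rewrite sum_n_csum. rewrite RtoC_div, Rmult_1_l by lra.
  replace (S (n + 1)) with (S (S n)) by lia.
  rewrite (csum_ext (fun i => twisted_bernoulli chi m (Z.of_nat i - 1) w * Cpowz t (Z.of_nat i - 1))
    (fun i => / t * (bernoulli chi m w i * RtoC t ^ i))).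
  - rewrite csum_scal, !Cpow_S. field. repeat split; try apply Cpow_nz; exact Ht0.
  - intros i _. unfold bernoulli. rewrite <- (Cpowz_pred t i Ht0). field. exact Ht0.
Qed.

(** After clearing powers of [t], the exponential parts agree by [twisted_gen_diff] and the
    polynomial parts by [bernoulli_diff]. The kernels at [b = ms] arise because
    [t^i e^(-mst) / t^(n+2)] is the leading part of the kernel of order [n + 1 - i]. *)
Lemma kernel_identity s t : (0 < t)%R ->
  csum (fun k => chi (Z.of_nat (S k)) * log_kernel (INR (S k) + w) n t) (m * s)
  = main_kernel t
    - csum (fun i => bernoulli chi m (w + 1) i * log_kernel (INR (m * s)) (S n - i) t) (S (S n))
    - tail_kernel s t.
Proof.
  intros Ht. assert (Ht0 : RtoC t <> 0) by (apply RtoC_neq_0; lra).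
  set (e := RtoC (exp (- (1 * t)))).
  assert (He : e = Cexp (- t)) by (unfold e; rewrite Rmult_1_l, <- RtoC_opp, Cexp_RtoC; reflexivity).
  set (P := Cexp (- INR (m * s) * t)).
  assert (HP : RtoC (exp (- (INR (m * s) * t))) = P)
    by (unfold P; rewrite <- Cexp_RtoC, RtoC_opp, RtoC_mult; f_equal; ring).
  set (A := csum (fun k => chi (Z.of_nat (S k)) * Cexp (- (INR (S k) + w) * t)) (m * s)).
  set (T := csum (fun l => csum (fun k => chi (Z.of_nat (S k)) * exp_coeff (INR (S k) + w) l) (m * s) * RtoC t ^ l) (S n)).
  assert (E1 : csum (fun k => chi (Z.of_nat (S k)) * log_kernel (INR (S k) + w) n t) (m * s) = (A - e * T) / RtoC t ^ S n).
  { replace T with (csum (fun k => csum (fun l => chi (Z.of_nat (S k)) * exp_coeff (INR (S k) + w) l * RtoC t ^ l) (S n)) (m * s)).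
    2:{ rewrite csum_swap. apply csum_ext. intros l _. apply csum_scal_r. }
    unfold A. unfold Cdiv. rewrite <- csum_scal, <- csum_minus, <- csum_scal_r. apply csum_ext. intros k _.
    unfold log_kernel. fold e.
    rewrite (csum_ext (fun l => chi (Z.of_nat (S k)) * exp_coeff (INR (S k) + w) l * RtoC t ^ l)
      (fun l => chi (Z.of_nat (S k)) * (exp_coeff (INR (S k) + w) l * RtoC t ^ l))) by (intros; ring).
    rewrite csum_scal. unfold Cdiv. ring. }
  set (Bw := csum (fun i => bernoulli chi m w i * RtoC t ^ i) (S (S n))).
  set (Bw1 := csum (fun i => bernoulli chi m (w + 1) i * RtoC t ^ i) (S (S n))).
  set (Cv := csum (fun i => conv (bernoulli chi m (w + 1)) (exp_coeff (INR (m * s))) i * RtoC t ^ i) (S (S n))).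
  (* The truncations of the kernels of decreasing orders fill a triangle, whose antidiagonals are
     the convolution [Cv]. *)
  assert (E2 : csum (fun i => bernoulli chi m (w + 1) i * log_kernel (INR (m * s)) (S n - i) t) (S (S n))
    = (P * Bw1 - e * Cv) / RtoC t ^ S (S n)).
  { replace Cv with (csum (fun i => csum (fun j => (bernoulli chi m (w + 1) i * RtoC t ^ i) * (exp_coeff (INR (m * s)) j * RtoC t ^ j)) (S (S n) - i)) (S (S n))).
    2:{ rewrite (csum_triangle (fun i j => (bernoulli chi m (w + 1) i * RtoC t ^ i) * (exp_coeff (INR (m * s)) j * RtoC t ^ j))).
        apply csum_ext. intros k _. unfold conv. rewrite <- csum_scal_r. apply csum_ext. intros i Hi.
        replace (RtoC t ^ k) with (RtoC t ^ i * RtoC t ^ (k - i)) by (rewrite <- Cpow_add_r; f_equal; lia). ring. }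
    unfold Bw1. unfold Cdiv. rewrite <- !csum_scal, <- csum_minus, <- csum_scal_r. apply csum_ext. intros i Hi.
    rewrite csum_scal. unfold log_kernel. fold e. fold P.
    replace (S (S n) - i)%nat with (S (S n - i)) by lia.
    replace (RtoC t ^ S (S n)) with (RtoC t ^ i * RtoC t ^ S (S n - i)) by (rewrite <- Cpow_add_r; f_equal; lia).
    field. split; apply Cpow_nz; exact Ht0. }
  (* Polynomial parts: the coefficients of index 0 cancel, which releases the factor [t]. *)
  assert (E3 : Bw - Cv = RtoC t * T).
  { unfold Bw, Cv, T. rewrite <- csum_minus, csum_Sl, <- csum_scal.
    rewrite (csum_ext (fun i => bernoulli chi m w (S i) * RtoC t ^ S i - _) 
      (fun l => RtoC t * (csum (fun k => chi (Z.of_nat (S k)) * exp_coeff (INR (S k) + w) l) (m * s) * RtoC t ^ l))).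
    - pose proof (bernoulli_diff chi m Hm Hchi w s 0) as H0. cbv iota in H0.
      match goal with |- ?a * ?x - ?b * ?x + ?y = _ => replace (a * x - b * x + y) with ((a - b) * x + y) by ring end.
      rewrite H0. ring.
    - intros l _. pose proof (bernoulli_diff chi m Hm Hchi w s (S l)) as H0. cbv iota in H0. rewrite <- H0.
      rewrite Cpow_S. ring. }
  (* Exponential parts: this is [twisted_gen_diff] multiplied by [e^(-t)]. *)
  assert (E4 : e * twisted_gen chi m w t - P * twisted_gen chi m (w + 1) t = RtoC t * A).
  { pose proof (twisted_gen_diff chi m Hm Hchi w t s (exp_denominator_neq_0 t Ht)) as H.
    replace P with (Cexp (- t) * Cexp ((1 - INR (m * s)) * t)) by (unfold P; rewrite <- Cexp_plus; f_equal; ring).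
    rewrite He.
    transitivity (Cexp (- t) * (RtoC t * exp_sum chi w (m * s) t)); [rewrite <- H; ring|].
    replace A with (Cexp (- t) * exp_sum chi w (m * s) t); [ring|].
    unfold A, exp_sum. rewrite <- csum_scal. apply csum_ext. intros k _.
    replace (- (INR (S k) + w) * t) with (- t + (1 - (INR (S k) + w)) * t) by ring.
    rewrite Cexp_plus. ring. }
  rewrite E1, E2. unfold main_kernel, tail_kernel, gen_remainder. rewrite HP. fold e. fold Bw. fold Bw1.
  replace A with (/ RtoC t * (e * twisted_gen chi m w t - P * twisted_gen chi m (w + 1) t)) by (rewrite E4; field; exact Ht0).
  replace T with (/ RtoC t * (Bw - Cv)) by (rewrite E3; field; exact Ht0).
  rewrite !Cpow_S. field. repeat split; try apply Cpow_nz; exact Ht0.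
Qed.

Definition tail_integral (s : nat) : C :=
  RInt_gen (V := C_R_CompleteNormedModule) (tail_kernel s) (at_right 0) (Rbar_locally p_infty).

Lemma INR_ms_ge s : (1 <= s)%nat -> (1 <= INR s <= INR (m * s))%R.
Proof.
  intros Hs. rewrite mult_INR. pose proof (INR_ge_1 s Hs). pose proof (INR_ge_1 m Hm). nra.
Qed.

Lemma ccont_tail_kernel s t : (0 < t)%R -> ccont (tail_kernel s) t.
Proof.
  intros Ht. unfold tail_kernel.
  apply (ccont_mult (fun t => RtoC (exp (- (INR (m * s) * t))) * gen_remainder (w + 1) (S (S n)) t) (fun t => / RtoC t ^ S (S n))).
  - apply ccont_mult; [apply ccont_exp_neg|apply ccont_gen_remainder, Ht].
  - ccont_tac. apply RtoC_pos_pow_neq_0, Ht.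
Qed.

Lemma tail_integral_spec s : (1 <= s)%nat -> cint (tail_kernel s) (tail_integral s).
Proof.
  intros Hs. pose proof (INR_ms_ge s Hs) as Hms.
  destruct (gen_remainder_bound_shift w (S (S n)) Hw ltac:(lia)) as [K HK].
  assert (Hex : exists l, cint (tail_kernel s) l).
  { apply (cint_dominated _ K (INR (m * s))); [lra|apply ccont_tail_kernel|].
    intros t Ht. unfold tail_kernel. rewrite Cmod_div_pow by exact Ht.
    assert (0 < t ^ S (S n))%R by (apply pow_lt; lra).
    rewrite Cmod_mult, Cmod_R, Rabs_pos_eq by (left; apply exp_pos).
    apply Rmult_le_reg_r with (t ^ S (S n))%R; [lra|]. unfold Rdiv.
    rewrite Rmult_assoc, Rinv_l, Rmult_1_r by lra.
    pose proof (exp_pos (- (INR (m * s) * t))). specialize (HK t Ht). nra. }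
  destruct Hex as [l Hl]. unfold tail_integral.
  pose proof (is_RInt_gen_unique _ _ Hl) as E. unfold cint. rewrite E. exact Hl.
Qed.

(** Watson's lemma: [L] further Taylor terms of the generating function are integrated by
    [cint_moment], giving the coefficients [b_(n+1+j)(w+1) j! / m^(j+1)] of [s^(-(j+1))], and the
    remainder is at most [K] times the moment of order [L]. *)
Lemma tail_integral_expansion : is_constant_term tail_integral 0.
Proof.
  apply (is_constant_term_vanishing _ (fun j => bernoulli chi m (w + 1) (S (S n) + j) * INR (fact j) / INR m ^ S j)).
  intros L. destruct (gen_remainder_bound_shift w (S (S n) + L) Hw ltac:(lia)) as [K HK].
  assert (HK0 : (0 <= K)%R).
  { specialize (HK 1%R Rlt_0_1). rewrite pow1 in HK.
    pose proof (Cmod_ge_0 (gen_remainder (w + 1) (S (S n) + L) 1)). lra. }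
  exists (K * INR (fact L))%R. intros s Hs. pose proof (INR_ms_ge s Hs) as Hms.
  pose proof (cint_minus _ _ _ _ (tail_integral_spec s Hs)
    (cint_csum (fun j t => bernoulli chi m (w + 1) (S (S n) + j) * (RtoC t ^ j * RtoC (exp (- (INR (m * s) * t))))) _ L
      (fun j _ => cint_scal (bernoulli chi m (w + 1) (S (S n) + j)) _ _ (cint_moment (INR (m * s)) j ltac:(lra))))) as HI.
  pose proof (cint_scal (RtoC K) _ _ (cint_moment (INR (m * s)) L ltac:(lra))) as HM.
  apply Rle_trans with (K * (INR (fact L) / INR (m * s) ^ S L))%R.
  - assert (Hms0 : RtoC (INR (m * s)) <> 0) by (apply RtoC_neq_0; lra).
    match goal with |- (Cmod (_ - ?x) <= _)%R => replace x with
      (csum (fun j => bernoulli chi m (w + 1) (S (S n) + j) * (INR (fact j) / RtoC (INR (m * s)) ^ S j)) L) end.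
    2:{ apply csum_ext. intros j _. rewrite mult_INR, RtoC_mult, Cpow_mult_l. field.
        split; apply Cpow_nz; apply INR_C_neq_0; assumption. }
    eapply (cint_norm_le _ (fun t => K * (t ^ L * exp (- (INR (m * s) * t))))%R); [|exact HI|].
    + intros t Ht. assert (Ht0 : RtoC t <> 0) by (apply RtoC_neq_0; lra).
      cbv beta. match goal with |- (Cmod ?z <= _)%R => replace z with
        (RtoC (exp (- (INR (m * s) * t))) * gen_remainder (w + 1) (S (S n) + L) t / RtoC t ^ S (S n)) end.
      * rewrite Cmod_div_pow by exact Ht.
        assert (0 < t ^ S (S n))%R by (apply pow_lt; lra).
        rewrite Cmod_mult, Cmod_R, Rabs_pos_eq by (left; apply exp_pos).
        apply Rmult_le_reg_r with (t ^ S (S n))%R; [lra|]. unfold Rdiv.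
        rewrite Rmult_assoc, Rinv_l, Rmult_1_r by lra.
        pose proof (exp_pos (- (INR (m * s) * t))) as Hp. specialize (HK t Ht). rewrite pow_add in HK. nra.
      * unfold tail_kernel, gen_remainder. rewrite csum_app.
        rewrite (csum_ext (fun i => bernoulli chi m (w + 1) (S (S n) + i) * RtoC t ^ (S (S n) + i))
          (fun j => RtoC t ^ S (S n) * (bernoulli chi m (w + 1) (S (S n) + j) * RtoC t ^ j)))
          by (intros; rewrite Cpow_add_r; ring).
        rewrite (csum_ext (fun j => bernoulli chi m (w + 1) (S (S n) + j) * (RtoC t ^ j * RtoC (exp (- (INR (m * s) * t)))))
          (fun j => RtoC (exp (- (INR (m * s) * t))) * (bernoulli chi m (w + 1) (S (S n) + j) * RtoC t ^ j))) by (intros; ring).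
        rewrite !csum_scal. field. apply Cpow_nz, Ht0.
    + eapply cint_ext; [|eapply cint_eq; [|exact HM]].
      * intros t Ht. cbv beta. rewrite !RtoC_mult, RtoC_pow. reflexivity.
      * assert (INR (m * s) ^ S L <> 0)%R by (apply pow_nonzero; lra).
        rewrite RtoC_mult, RtoC_div, RtoC_pow by assumption. reflexivity.
  - unfold Rdiv. rewrite Rmult_assoc. apply Rmult_le_compat_l; [exact HK0|].
    apply Rmult_le_compat_l; [apply pos_INR|].
    apply Rinv_le_contravar; [apply pow_lt; lra|apply pow_incr; lra].
Qed.

(** By [bernoulli_diff] the sum is a polynomial in [s], and its value at [s = 0] is an empty sum. *)
Lemma character_poly_sum_expansion :
  is_constant_term
    (fun s => csum (fun k => chi (Z.of_nat (S k)) * log_kernel_poly n (INR (S k) + w)) (m * s)) 0.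
Proof.
  destruct (log_kernel_poly_span n) as (q & d & Hq).
  (* The argument [ms] is written [0 + m x] to fit [polynomial_comp_affine]. *)
  set (f := fun x : C => csum (fun l => q l * (bernoulli chi m w (S l)
     - conv (bernoulli chi m (w + 1)) (exp_coeff (0 + INR m * x)) (S l))) d).
  assert (Hf : forall s, f (RtoC (INR s)) = csum (fun k => chi (Z.of_nat (S k)) * log_kernel_poly n (INR (S k) + w)) (m * s)).
  { intros s. unfold f.
    rewrite (csum_ext (fun k => chi (Z.of_nat (S k)) * log_kernel_poly n (INR (S k) + w))
      (fun k => csum (fun l => q l * (chi (Z.of_nat (S k)) * exp_coeff (INR (S k) + w) l)) d)).
    - rewrite csum_swap. apply csum_ext. intros l _. rewrite csum_scal. f_equal.
      replace (0 + INR m * INR s) with (RtoC (INR (m * s))) by (rewrite mult_INR, RtoC_mult; ring).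
      apply (bernoulli_diff chi m Hm Hchi w s (S l)).
    - intros k _. rewrite Hq, <- csum_scal. apply csum_ext. intros; ring. }
  assert (Hp : polynomial f).
  { unfold f. apply (polynomial_csum (fun l x => q l * (bernoulli chi m w (S l)
      - conv (bernoulli chi m (w + 1)) (exp_coeff (0 + INR m * x)) (S l)))). intros l _.
    apply polynomial_scal.
    apply (polynomial_ext (fun x => bernoulli chi m w (S l)
      + (-(1)) * conv (bernoulli chi m (w + 1)) (exp_coeff (0 + INR m * x)) (S l))); [intros; ring|].
    apply polynomial_plus; [apply polynomial_const|]. apply polynomial_scal. unfold conv.
    apply (polynomial_csum (fun i x => bernoulli chi m (w + 1) i * exp_coeff (0 + INR m * x) (S l - i))). intros i _.
    apply polynomial_scal, (polynomial_comp_affine 0 (INR m) (fun b => exp_coeff b (S l - i))), polynomial_exp_coeff. }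
  assert (H0 : f 0 = 0).
  { change (RtoC 0) with (RtoC (INR 0)) at 1. rewrite Hf, Nat.mul_0_r. reflexivity. }
  rewrite <- H0. apply (is_constant_term_ext _ _ _) with (2 := is_constant_term_polynomial f Hp).
  intros s _. apply Hf.
Qed.

(** Since [(ms)^p log (ms) = m^p s^p (log s + log m)], the logarithmic part reaches the constant
    term only for [p = 0], with coefficient [- log m]. *)
Lemma log_kernel_value_expansion p :
  is_constant_term (fun s => (-(1)) ^ S p / INR (fact p) * (RtoC (INR (m * s)) ^ p * Clog (INR (m * s)))
      + log_kernel_poly p (INR (m * s)))
    (match p with O => - RtoC (ln (INR m)) | _ => RtoC 0 end + log_kernel_poly p 0).
Proof.
  pose proof (INR_ge_1 m Hm) as Hm1.
  apply is_constant_term_plus.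
  - pose proof (is_constant_term_scal ((-(1)) ^ S p / INR (fact p) * INR m ^ p) _ _
      (is_constant_term_plus _ _ _ _ (is_constant_term_log_power p)
        (is_constant_term_scal (ln (INR m)) _ _ (is_constant_term_power p)))) as H.
    match type of H with is_constant_term _ ?c =>
      replace (match p with O => - RtoC (ln (INR m)) | _ => RtoC 0 end) with c end.
    + apply (is_constant_term_ext _ _ _) with (2 := H). intros s Hs. cbv beta.
      pose proof (INR_ge_1 s Hs). rewrite mult_INR, Clog_RtoC by nra.
      rewrite ln_mult by lra. rewrite RtoC_plus, RtoC_mult, Cpow_mult_l. field. apply INR_fact_C_neq_0.
    + destruct p as [|p]; [simpl; field|field; apply INR_fact_C_neq_0].
  - pose proof (is_constant_term_polynomial _ (polynomial_comp_affine 0 (INR m) _ (polynomial_log_kernel_poly p))) as H.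
    cbv beta in H. replace (0 + INR m * 0) with (RtoC 0) in H by ring.
    apply (is_constant_term_ext _ _ _) with (2 := H). intros s _.
    rewrite mult_INR, RtoC_mult. f_equal. ring.
Qed.

Lemma Cpow_m1_sq k : (-(1)) ^ k * (-(1)) ^ k = 1.
Proof. rewrite <- Cpow_mult_l. replace (- (1) * - (1)) with (RtoC 1) by ring. apply Cpow_1_l. Qed.

(** Both sides of [kernel_identity] are integrated, and uniqueness of the improper integral equates
    the results; the equality is then solved for the logarithmic sum. *)
Lemma twisted_log_sum_eq (I : C) s : cint main_kernel I -> (1 <= s)%nat ->
  twisted_log_sum chi m n w s =
  (-(1)) ^ S n * INR (fact n) *
    (I - csum (fun i => bernoulli chi m (w + 1) i *
        ((-(1)) ^ S (S n - i) / INR (fact (S n - i)) * (RtoC (INR (m * s)) ^ (S n - i) * Clog (INR (m * s)))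
         + log_kernel_poly (S n - i) (INR (m * s)))) (S (S n))
     - tail_integral s
     - csum (fun k => chi (Z.of_nat (S k)) * log_kernel_poly n (INR (S k) + w)) (m * s)).
Proof.
  intros HI Hs. pose proof (INR_ms_ge s Hs) as Hms.
  assert (HL : cint (fun t => csum (fun k => chi (Z.of_nat (S k)) * log_kernel (INR (S k) + w) n t) (m * s))
    (csum (fun k => chi (Z.of_nat (S k)) * ((-(1)) ^ S n / INR (fact n) * ((INR (S k) + w) ^ n * Clog (INR (S k) + w))
       + log_kernel_poly n (INR (S k) + w))) (m * s))).
  { apply (cint_csum (fun k t => chi (Z.of_nat (S k)) * log_kernel (INR (S k) + w) n t)).
    intros k _. apply cint_scal, cint_log_kernel. pose proof (INR_ge_1 (S k) ltac:(lia)).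
    unfold Re in *. cbn [Cplus fst RtoC]. lra. }
  assert (HR : cint (fun t => csum (fun k => chi (Z.of_nat (S k)) * log_kernel (INR (S k) + w) n t) (m * s))
    (I - csum (fun i => bernoulli chi m (w + 1) i *
        ((-(1)) ^ S (S n - i) / INR (fact (S n - i)) * (RtoC (INR (m * s)) ^ (S n - i) * Clog (INR (m * s)))
         + log_kernel_poly (S n - i) (INR (m * s)))) (S (S n))
     - tail_integral s)).
  { eapply cint_ext; [intros t Ht; symmetry; apply kernel_identity, Ht|].
    apply cint_minus; [apply cint_minus; [exact HI|]|apply tail_integral_spec, Hs].
    apply (cint_csum (fun i t => bernoulli chi m (w + 1) i * log_kernel (INR (m * s)) (S n - i) t)).
    intros i _. apply cint_scal, cint_log_kernel. unfold Re; simpl fst. lra. }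
  rewrite <- (cint_unique _ _ _ HL HR). unfold twisted_log_sum. rewrite sum_n_m_csum.
  rewrite <- csum_minus, <- csum_scal. apply csum_ext. intros k _.
  (* The sign [(-1)^(n+1)] is its own inverse, so multiplying by it undoes the normalisation of the
     kernel integral. *)
  match goal with |- _ * ?x * ?y = ?e * _ * (_ * (_ / _ * _ + ?q) - _ * ?q) =>
    transitivity ((e * e) * (chi (Z.of_nat (S k)) * x * y)); [rewrite Cpow_m1_sq; ring|field] end.
  apply INR_fact_C_neq_0.
Qed.

Lemma twisted_log_sum_constant_term (I : C) : cint main_kernel I ->
  is_constant_term (twisted_log_sum chi m n w)
    ((-(1)) ^ S n * INR (fact n) *
      (I + bernoulli chi m (w + 1) (S n) * ln (INR m)
       - csum (fun p => bernoulli chi m (w + 1) (S n - p) * log_kernel_poly p 0) (S (S n)))).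
Proof.
  intros HI.
  pose proof (is_constant_term_scal ((-(1)) ^ S n * INR (fact n)) _ _
    (is_constant_term_minus _ _ _ _ (is_constant_term_minus _ _ _ _ (is_constant_term_minus _ _ _ _
      (is_constant_term_const I)
      (is_constant_term_csum _ _ (S (S n)) (fun i _ => is_constant_term_scal (bernoulli chi m (w + 1) i) _ _
         (log_kernel_value_expansion (S n - i)))))
      tail_integral_expansion) character_poly_sum_expansion)) as H.
  match type of H with is_constant_term _ ?c => match goal with |- is_constant_term _ ?c' => replace c' with c end end.
  - apply (is_constant_term_ext _ _ _) with (2 := H). intros s Hs. cbv beta. symmetry.
    apply twisted_log_sum_eq; assumption.
  - f_equal.
    rewrite (csum_rev (fun p => bernoulli chi m (w + 1) (S n - p) * log_kernel_poly p 0)).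
    rewrite (csum_ext (fun i => bernoulli chi m (w + 1) (S n - (S (S n) - 1 - i)) * log_kernel_poly (S (S n) - 1 - i) 0)
      (fun i => bernoulli chi m (w + 1) i * log_kernel_poly (S n - i) 0)).
    2:{ intros i Hi. replace (S n - (S (S n) - 1 - i))%nat with i by lia.
        replace (S (S n) - 1 - i)%nat with (S n - i)%nat by lia. reflexivity. }
    rewrite (csum_ext (fun i => bernoulli chi m (w + 1) i * (match (S n - i)%nat with O => _ | S _ => _ end + _))
      (fun i => bernoulli chi m (w + 1) i * (match (S n - i)%nat with O => - RtoC (ln (INR m)) | _ => RtoC 0 end)
        + bernoulli chi m (w + 1) i * log_kernel_poly (S n - i) 0)) by (intros; ring).
    rewrite csum_plus.
    (* Only [i = n + 1], the kernel of order 0, carries [log m]; its weight is [b_n(w+1)]. *)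
    rewrite (csum_single (fun i => bernoulli chi m (w + 1) i * (match (S n - i)%nat with O => - RtoC (ln (INR m)) | _ => RtoC 0 end)) _ (S n)).
    + rewrite Nat.sub_diag. ring.
    + lia.
    + intros i Hi Hne. replace (S n - i)%nat with (S (n - i)) by lia. ring.
Qed.

End IntegralRepresentation.

Theorem theorem6p1 (chi : Z -> C) (m n : nat) (w : C) :
  (1 <= m)%nat ->
  (forall k : Z, chi (k + Z.of_nat m)%Z = chi k) ->
  chi 0%Z = 0 ->
  (-1 < Re w)%R ->
  ex_RInt_gen (V := C_R_CompleteNormedModule) (sr_integrand chi m n w)
    (at_right 0) (Rbar_locally p_infty)
  /\
  stirling_ramanujan chi m n w =
    Cpow (- (1)) (n + 1) * INR (fact n)
      * RInt_gen (V := C_R_CompleteNormedModule) (sr_integrand chi m n w)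
          (at_right 0) (Rbar_locally p_infty)
    - Cpow (- (1)) (n + 1) * INR (fact n)
      * sum_n (fun j : nat =>
                 Cpow (- (1)) (j + 1) / INR (fact j) * harmonic j
                 * twisted_bernoulli chi m (Z.of_nat n - Z.of_nat j) w) (n + 1)
    + Cpow (- (1)) (n + 1) * INR (fact n)
      * twisted_bernoulli chi m (Z.of_nat n) (w + 1) * ln (INR m).
Proof.
  intros Hm Hchi _ Hw.
  destruct (main_kernel_cint chi m Hm n w Hw) as [I HI].
  assert (HI' : cint (sr_integrand chi m n w) I).
  { eapply cint_ext; [|exact HI]. intros t Ht. apply sr_integrand_eq; assumption. }
  split; [exists I; exact HI'|].
  pose proof (is_RInt_gen_unique _ _ HI') as EI. rewrite EI.
  pose proof (twisted_log_sum_constant_term chi m Hm Hchi n w Hw I HI) as HS.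
  assert (E : stirling_ramanujan chi m n w = (-(1)) ^ S n * INR (fact n) *
      (I + bernoulli chi m (w + 1) (S n) * ln (INR m)
       - csum (fun p => bernoulli chi m (w + 1) (S n - p) * log_kernel_poly p 0) (S (S n)))).
  (* The explicit constant term proves that one exists, so the epsilon choice is a constant term as
     well, and uniqueness identifies the two. *)
  { apply (is_constant_term_unique (twisted_log_sum chi m n w)); [|exact HS].
    unfold stirling_ramanujan. apply epsilon_spec. eexists. exact HS. }
  rewrite E, sum_n_csum.
  rewrite (csum_ext (fun j => Cpow (- (1)) (j + 1) / INR (fact j) * harmonic j
                 * twisted_bernoulli chi m (Z.of_nat n - Z.of_nat j) w)
    (fun j => (-(1)) ^ S j / INR (fact j) * harmonic j * bernoulli chi m w (S n - j))).
  (* The coefficient [b_n(w+1)] has power series index [n + 1], because indices are shifted by one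
     against Laurent exponents. *)
  - replace (n + 1)%nat with (S n) by lia. rewrite (harmonic_bernoulli_sum chi m Hm Hchi).
    unfold bernoulli at 1. replace (Z.of_nat (S n) - 1)%Z with (Z.of_nat n) by lia. ring.
  - intros j Hj. unfold bernoulli. replace (j + 1)%nat with (S j) by lia.
    replace (Z.of_nat (S n - j) - 1)%Z with (Z.of_nat n - Z.of_nat j)%Z by lia. reflexivity.
Qed.
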